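(* Let $n\ge 1$, let $m_1,\dots,m_n$ be nonnegative integers, $|m|=m_1+\dots+m_n$, and let $a,b,c,d,e,f,g,z_1,\dots,z_n$ be nonzero complex numbers with $a^3q^{2+|m|}=bcdefg$. Put $\lambda=a^2q/bcd$. Then $$\sum_{y_1=0}^{m_1}\cdots\sum_{y_n=0}^{m_n} \Bigg(\frac{\Delta(zq^y)}{\Delta(z)}\prod_{1\leq j\leq k\leq n} \frac{\theta(az_jz_kq^{y_j+y_k})}{\theta(az_jz_k)} \prod_{j,k=1}^n\frac{(q^{-m_j}z_k/z_j,az_jz_k)_{y_k}}{(qz_k/z_j, aq^{1+m_j}z_jz_k)_{y_k}}$$ $$\times\prod_{k=1}^n\frac {(bz_k,cz_k,dz_k,ez_k,fz_k,gz_k)_{y_k}} {(aqz_k/b,aqz_k/c,aqz_k/d,aqz_k/e,aqz_k/f,aqz_k/g)_{y_k}} \,q^{|y|}\Bigg)$$ $$=\frac{\prod_{j,k=1}^n(aqz_jz_k)_{m_k}} {\prod_{1\leq j<k\leq n}(aqz_jz_k)_{m_j+m_k}}\cdot \frac{(\lambda q/e,\lambda q/f,aq/ef)_{|m|}} {\prod_{k=1}^n(\lambda qz_k,aqz_k/e,aqz_k/f,q^{-m_k}g/az_k)_{m_k}}$$ $$\times\sum_{y_1=0}^{m_1}\cdots\sum_{y_n=0}^{m_n} \Bigg(\frac{\Delta(zq^y)}{\Delta(z)}\prod_{k=1}^n\frac{\theta(\lambda z_k q^{y_k+|y|})} {\theta(\lambda z_k)}\cdot \frac{(\lambda b/a,\lambda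 c/a,\lambda d/a)_{|y|}} {(\lambda q/e,\lambda q/f,\lambda q/g)_{|y|}} \prod_{j=1}^n\frac{(\lambda z_j)_{|y|}}{(\lambda q^{1+m_j}z_j)_{|y|}} \,q^{|y|}$$ $$\times \prod_{k=1}^n\frac{(ez_k,fz_k,gz_k)_{y_k}} {(aqz_k/b,aqz_k/c,aqz_k/d)_{y_k}} \prod_{j,k=1}^n\frac{(q^{-m_j}z_k/z_j)_{y_k}}{(qz_k/z_j)_{y_k}}\Bigg).$$
   Context: Fix $p\in\mathbb C$ with $|p|<1$ and $q\in\mathbb C\setminus\{0\}$. For $x\neq 0$ put $\theta(x)=\prod_{j=0}^\infty(1-p^jx)(1-p^{j+1}/x)$ (so $\theta(x)=1-x$ when $p=0$). The elliptic Pochhammer symbol is $(a)_k=\theta(a)\theta(aq)\cdots\theta(aq^{k-1})$ for integers $k\ge 0$, with $(a)_0=1$, and $(a_1,\dots,a_r)_k=(a_1)_k\cdots(a_r)_k$. Everything after a slash is in the denominator, e.g. $q^{-m_k}g/az_k$ means $q^{-m_k}g/(az_k)$ and $a^2q/bcd$ means $a^2q/(bcd)$. For $z=(z_1,\dots,z_n)$, the elliptic Vandermonde determinant is $\Delta(z)=\prod_{1\le j<k\le n}z_j\,\theta(z_k/z_j)$, and $zq^y=(z_1q^{y_1},\dots,z_nq^{y_n})$, $|y|=y_1+\dots+y_n$. Standing assumption: all expressions are well-defined, i.e. the parameters are such that no denominator occurring on either side vanishes. *)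

(* Defs.v *)
From HB Require Import structures.
From mathcomp Require Import all_boot all_order all_algebra complex.
From mathcomp Require Import all_classical all_reals all_analysis.
Import Order.TTheory GRing.Theory Num.Theory numFieldNormedType.Exports.

Set Implicit Arguments.
Unset Strict Implicit.
Unset Printing Implicit Defensive.

Local Open Scope classical_set_scope.
Local Open Scope ring_scope.
Local Open Scope complex_scope.

Section EllipticSymbols.
Variable R : realType.
Implicit Types p q a x : R[i].

(* R[i]^o carries the topology of the complex modulus; only meaningful for
   |p| < 1 and x <> 0, where the infinite product converges. *)
Definition theta p x : R[i] :=
  lim ((\prod_(0 <= j < N) ((1 - p ^+ j * x) * (1 - p ^+ j.+1 / x)) : R[i]^o)
         @[N --> \oo]).

Lemma theta0 x : theta 0 x = 1 - x.
Proof.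
rewrite /theta; apply: (@cvg_lim (R[i]^o)) => //.
apply: (cvg_near_cst (1 - x : R[i]^o)).
near=> N.
have N0 : (0 < N)%N by near: N; exact: nbhs_infty_gt.
rewrite big_ltn // expr0 mul1r expr1 mul0r subr0 mulr1 big_nat_cond big1 ?mulr1 //.
by case=> //= j _; rewrite !expr0n /= !mul0r subr0 mulr1.
Unshelve. all: by end_near. Qed.

Definition epoch p q a (k : nat) : R[i] := \prod_(i < k) theta p (a * q ^+ i).

(* (a_1, ..., a_r)_k *)
Definition epochs p q (s : seq R[i]) (k : nat) : R[i] :=
  \prod_(a <- s) epoch p q a k.

Definition vandermonde p n (z : 'I_n -> R[i]) : R[i] :=
  \prod_(j < n) \prod_(k < n | (j < k)%N) (z j * theta p (z k / z j)).

End EllipticSymbols.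

(* The multi-indices y with 0 <= y_k <= m_k for all k. *)
Notation box m := {dffun forall k, 'I_(m k).+1}.

(* |y| = y_1 + ... + y_n, for y in box m as well as for y : 'I_n -> nat. *)
Notation wt y := (\sum_k (y k : nat))%N.

(* Main.v *)
(** Write [theta (exp u) = exp (u / 2) * s u] with [s] odd; then
    [h x y = s (x + y) * s (x - y)] satisfies the three-term relation
    [h x y h u v - h x u h y v + h x v h y u = 0], a consequence of the Jacobi
    triple product. Both sides of the identity are specialisations of sums over
    all subsets of a finite set of points [w k]: the index [k] becomes a cluster
    of [m k] points in arithmetic progression with step [eta] ([q = exp eta]), and
    only the subsets which are initial segments of every cluster contribute.

    The resulting identity between sums over subsets is proved by induction on
    the number of points. With two parameters written as [sg + v] and [sg - v],
    the difference of the two sides is a form of degree [N] in the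
    vectors [h a], so by the three-term relation it vanishes as soon as it does at
    more than [N] points in general position; at the points where one of the two
    parameters equals some [w m] the point [m] drops out.

    This requires genericity of the parameters. The general case follows by
    continuity, multiplying [a, b, e, g, lam] by [t, t^3, t^3, t^-3, t^-1]: this
    preserves the balancing condition and all but countably many [t > 0] are
    generic. *)

Require Import Defs.
From HB Require Import structures.
From mathcomp Require Import all_boot all_order all_algebra.
From mathcomp Require Import ring lra zify.
Import Order.TTheory GRing.Theory Num.Theory.

Set Implicit Arguments.
Unset Strict Implicit.
Unset Printing Implicit Defensive.

Local Open Scope ring_scope.

(** * Interpolation *)

(** A form of degree N + 1 must be shown to vanish at N + 2 points, but equating a parameter with
    some [w m] yields only N + 1 of them. Everything hinges on one more point. The sum over signs
    does not change when a single [w m0] is replaced by its opposite, so when the other side is a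
    product the missing zero is found at [- w m0]; this settles [jackson_C]. The general right side
    has no such visible symmetry. There the extra point is the one where two of the parameters
    become [b6] and [- b6]: their factors are then even in the point and come out of the left sum,
    leaving exactly a sum evaluated by [jackson_C], while on the right all terms but one vanish.
    This is why the product case is proved separately and first. *)

Section Interpolation.
Variables (V : eqType) (F : fieldType) (h : V -> V -> F).
Hypothesis h_xx : forall x, h x x = 0.
Hypothesis h_anti : forall x y, h y x = - h x y.
Hypothesis h_plucker : forall x y u v,
  h x y * h u v - h x u * h y v + h x v * h y u = 0.

(** By [h_plucker] the functions [h a] span a space of dimension at most two, so these are binary
    forms. The predicate is syntactic: degrees are found by following the shape of an expression,
    and [homog_ext] allows the expression to be rewritten first. *)
Inductive homogeneous : nat -> (V -> F) -> Prop :=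
| homog_const c : homogeneous 0 (fun=> c)
| homog_h a : homogeneous 1 (h a)
| homog_mul N M f g : homogeneous N f -> homogeneous M g ->
    homogeneous (N + M) (fun v => f v * g v)
| homog_add N f g : homogeneous N f -> homogeneous N g ->
    homogeneous N (fun v => f v + g v)
| homog_ext N f g : f =1 g -> homogeneous N f -> homogeneous N g.

Lemma homog_zero N : (exists v : V, True) -> homogeneous N (fun=> 0).
Proof.
move=> [a _]; elim: N => [|N IH]; first exact: homog_const.
rewrite -addn1; apply: homog_ext (homog_mul IH (homog_h a)) => v.
by rewrite mul0r.
Qed.

Lemma homog_scale N c f : homogeneous N f -> homogeneous N (fun v => c * f v).
Proof. by move=> hf; have := homog_mul (homog_const c) hf. Qed.

Lemma homog_sum N (J : Type) (r : seq J) (P : pred J) (f : J -> V -> F) :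
  (exists v : V, True) -> (forall j, P j -> homogeneous N (f j)) ->
  homogeneous N (fun v => \sum_(j <- r | P j) f j v).
Proof.
move=> V0 hf; elim: r => [|j r IH].
  by apply: homog_ext (homog_zero N V0) => v; rewrite big_nil.
have [Pj|nPj] := boolP (P j).
  by apply: homog_ext (homog_add (hf j Pj) IH) => v; rewrite big_cons Pj.
by apply: homog_ext IH => v; rewrite big_cons (negbTE nPj).
Qed.

Lemma homog_prod (J : Type) (r : seq J) (P : pred J) (f : J -> V -> F) :
  (forall j, P j -> homogeneous 1 (f j)) ->
  homogeneous (count P r) (fun v => \prod_(j <- r | P j) f j v).
Proof.
move=> hf; elim: r => [|j r IH].
  by apply: homog_ext (homog_const 1) => v; rewrite big_nil.
have [Pj|nPj] := boolP (P j).
  by rewrite /= Pj; apply: homog_ext (homog_mul (hf j Pj) IH) => v;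
    rewrite big_cons Pj.
by rewrite /= (negbTE nPj); apply: homog_ext IH => v; rewrite big_cons (negbTE nPj).
Qed.

(** Dehomogenisation in the coordinates [h v c] and [h v d], of which every [h a v] is a combination
    by the Plucker relation. The points with [h v d = 0] lie at infinity, where only the coefficient
    of degree [N] is seen. *)
Lemma homog_polyP (c d : V) (N : nat) (f : V -> F) : h c d != 0 ->
  homogeneous N f -> exists G : {poly F}, [/\ (size G <= N.+1)%N,
   forall v, h v d != 0 -> f v = h v d ^+ N * G.[h v c / h v d] &
   forall v, h v d = 0 -> f v = h v c ^+ N * G`_N].
Proof.
move=> hcd; elim=> {N f}.
- move=> k; exists k%:P; split; first exact: size_polyC_leq1.
    by move=> v _; rewrite hornerC mul1r.
  by move=> v _; rewrite coefC mul1r.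
- move=> a; have hav v : h a v = (h a c * h v d - h a d * h v c) / h c d.
    apply: (mulIf hcd); rewrite mulfVK //.
    by apply/eqP; rewrite -subr_eq0 -(h_plucker a v c d); apply/eqP; ring.
  exists ((h a c / h c d)%:P - (h a d / h c d) *: 'X); split.
  + rewrite (leq_trans (size_polyD _ _)) // geq_max.
    rewrite (leq_trans (size_polyC_leq1 _)) //= size_polyN.
    by rewrite (leq_trans (size_scale_leq _ _)) // size_polyX.
  + by move=> v hv; rewrite hav hornerD hornerN hornerZ hornerX hornerC; field; rewrite hv hcd.
  + move=> v hv; rewrite hav hv coefB coefZ coefX coefC /=.
    by rewrite expr1 mulr0 sub0r mulr1 sub0r; field.
- move=> N M f g _ [Gf [sf f1 f2]] _ [Gg [sg g1 g2]]; exists (Gf * Gg); split.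
  + rewrite (leq_trans (size_polyMleq _ _)) //.
    by rewrite -ltnS -(ltn_add2r 1) ; lia.
  + by move=> v hv; rewrite (f1 v hv) (g1 v hv) hornerM exprD; ring.
  + move=> v hv; rewrite (f2 v hv) (g2 v hv) exprD.
    (* The size bounds leave a single product of coefficients in degree [N + M]. *)
    suff -> : (Gf * Gg)`_(N + M) = Gf`_N * Gg`_M by ring.
    rewrite coefM (bigD1 (inord N : 'I_(N + M).+1)) //= inordK ?ltnS ?leq_addr //.
    rewrite addKn big1 ?addr0 // => i iN.
    have {}iN : (i : nat) != N.
      apply: contraNneq iN => eqi; apply/eqP/val_inj.
      by rewrite /= inordK ?ltnS ?leq_addr.
    have [ltiN|ltNi|eqiN] := ltngtP i N; last by rewrite eqiN eqxx in iN.
      rewrite [Gg`__]nth_default ?mulr0 // (leq_trans sg) //.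
      by rewrite -addnBAC ?(ltnW ltiN) // -add1n leq_add2r subn_gt0.
    by rewrite [Gf`__]nth_default ?mul0r // (leq_trans sf).
- move=> N f g _ [Gf [sf f1 f2]] _ [Gg [sg g1 g2]]; exists (Gf + Gg); split.
  + by rewrite (leq_trans (size_polyD _ _)) // geq_max sf sg.
  + by move=> v hv; rewrite (f1 v hv) (g1 v hv) hornerD mulrDr.
  + by move=> v hv; rewrite (f2 v hv) (g2 v hv) coefD mulrDr.
- move=> N f g fg _ [Gf [sf f1 f2]]; exists Gf; split=> // v hv; rewrite -fg.
    exact: f1.
  exact: f2.
Qed.

Lemma homog0P N f : homogeneous N f -> N = 0%N -> exists k, forall v, f v = k.
Proof.
elim=> {N f} //; first by move=> k _; exists k.
- move=> N M f g _ IHf _ IHg /eqP; rewrite addn_eq0.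
  move=> /andP[/eqP/IHf[k fk] /eqP/IHg[l gl]].
  by exists (k * l) => u; rewrite fk gl.
- move=> N f g _ IHf _ IHg N0; have [k fk] := IHf N0.
  by have [l gl] := IHg N0; exists (k + l) => u; rewrite fk gl.
- move=> N f g fg _ IHf N0; have [k fk] := IHf N0.
  by exists k => u; rewrite -fg.
Qed.

(** A nonzero binary form of degree [N] has at most [N] zeros on the projective line, and
    [h x y != 0] says that [x] and [y] are different points of it. The first point is put at
    infinity; the others become roots of a polynomial. *)
Lemma homog_interpolation (N : nat) (f : V -> F) (pts : seq V) :
  homogeneous N f -> size pts = N.+1 -> pairwise (fun x y => h x y != 0) pts ->
  {in pts, forall x, f x = 0} -> forall v, f v = 0.
Proof.
case: N => [|N] hf.
  case: pts => [|x [|//]] //= _ _ /(_ x (mem_head _ _)) fx v.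
  by have [k fk] := homog0P hf erefl; rewrite fk -(fk x).
case: pts => [//|d pts]; case: pts => [//|c pts] /= [sz].
move=> /andP[/andP[dc /allP hd] /andP[/allP hc hp]] f0.
have cd : h c d != 0 by rewrite h_anti oppr_eq0.
have [G [sG f1 f2]] := homog_polyP cd hf.
(* The zero at infinity lowers the degree by one, so the remaining [N.+1] points are too many
   roots. *)
have GN : G`_N.+1 = 0.
  have := f2 d (h_xx d); rewrite f0 ?mem_head //.
  move/esym/eqP; rewrite mulf_eq0 expf_eq0 /= h_anti oppr_eq0.
  by rewrite (negbTE cd) => /eqP.
have {}sG : (size G <= N.+1)%N.
  apply/leq_sizeP => j; rewrite leq_eqVlt => /predU1P[<- //|ltj].
  by apply/(leq_sizeP _ _ sG).
suff G0 : G = 0.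
  move=> v; have [hv|hv] := eqVneq (h v d) 0.
    by rewrite (f2 v hv) G0 coef0 mulr0.
  by rewrite (f1 v hv) G0 horner0 mulr0.
pose t v := h v c / h v d.
have nd x : x \in c :: pts -> h x d != 0.
  by rewrite h_anti oppr_eq0 inE => /predU1P[->|/hd].
apply: (@roots_geq_poly_eq0 _ _ [seq t x | x <- c :: pts]).
- apply/allP => u /mapP[x xp ->]; have := f1 x (nd x xp).
  rewrite f0; last by rewrite inE xp orbT.
  move/esym/eqP; rewrite mulf_eq0 expf_eq0 /= (negbTE (nd x xp)).
  by rewrite rootE.
(* By the Plucker relation the difference [t x - t y] has numerator [h x y * h c d]. *)
- have tne x y : h x d != 0 -> h y d != 0 -> h x y != 0 -> t x != t y.
    move=> xd yd; apply: contraNneq => txy.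
    have : h x c * h y d = h y c * h x d.
      have := congr1 (fun u => u * h x d * h y d) txy.
      by rewrite /t mulfVK // => ->; rewrite mulrAC mulfVK.
    have := h_plucker x y c d => e1 e2.
    by apply/eqP; apply: (mulIf cd); rewrite mul0r -e1 e2; ring.
  have: pairwise (fun x y => h x y != 0) (c :: pts).
    by rewrite /= hp andbT; apply/allP.
  elim: (c :: pts) nd => //= y l IH H /andP[/allP hy hl].
  rewrite IH // ?andbT; last by move=> x xl; apply: H; rewrite inE xl orbT.
  apply/mapP => -[x xl]; apply/eqP/tne; last exact: hy.
    by apply: H; rewrite mem_head.
  by apply: H; rewrite inE xl orbT.
- by rewrite /= size_map sz.
Qed.
End Interpolation.

(** * Transformation of sums over subsets *)

(** Serves to derive affine consequences of a balancing condition: [ring] only has to check that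
    both equations have the same difference of sides. *)
Lemma eq_lin (F : zmodType) (a b x y : F) : a = b -> x - y = a - b -> x = y.
Proof. by move=> -> /eqP; rewrite subrr subr_eq0 => /eqP. Qed.

Section PairProducts.
Variables (F : comNzRingType) (I : finType) (lt : rel I).
Hypothesis lt_irr : irreflexive lt.
Hypothesis lt_tour : forall i j, i != j -> lt i j = ~~ lt j i.

Implicit Types (U : {set I}) (f g : I -> I -> F).

(** The tournament [lt] picks one order of each two-element subset, so for symmetric [f] the value
    does not depend on [lt]. *)
Definition pairs (U : {set I}) (f : I -> I -> F) : F :=
  \prod_(i in U) \prod_(j in U | lt i j) f i j.

Lemma eq_pairs U f g : {in U &, f =2 g} -> pairs U f = pairs U g.
Proof.
by move=> fg; apply: eq_bigr => i iU; apply: eq_bigr => j /andP[jU _]; apply: fg.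
Qed.

Lemma pairs_setD1 U f m : (forall i j, f i j = f j i) -> m \in U ->
  pairs U f = \prod_(k in U :\ m) f m k * pairs (U :\ m) f.
Proof.
move=> fC mU; rewrite /pairs (big_setD1 m mU) /=.
under [X in _ * X]eq_bigr => i _.
  rewrite big_mkcondr (big_setD1 m mU) /= -big_mkcondr; over.
rewrite big_split /= mulrA; congr (_ * _).
rewrite big_mkcondr (big_setD1 m mU) /= lt_irr mul1r -big_split /=.
apply: eq_bigr => i; rewrite !inE => /andP[im _]; rewrite (fC i m) (lt_tour im).
by case: (lt m i); rewrite ?mulr1 ?mul1r.
Qed.
End PairProducts.

Section Subsets.
Variables (F : numFieldType) (s : F -> F) (eta : F) (I : finType) (lt : rel I).
Hypothesis lt_irr : irreflexive lt.
Hypothesis lt_tour : forall i j, i != j -> lt i j = ~~ lt j i.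
Hypothesis sN : forall u, s (- u) = - s u.

Definition hs x y := s (x + y) * s (x - y).
Hypothesis hs_plucker : forall x y u v,
  hs x y * hs u v - hs x u * hs y v + hs x v * hs y u = 0.

Implicit Types (U S T : {set I}) (w : I -> F).

Lemma s_zero : s 0 = 0.
Proof.
have : s 0 *+ 2 == 0 by rewrite mulr2n -{1}oppr0 sN addNr.
by rewrite mulrn_eq0 => /eqP.
Qed.

Lemma hs_xx x : hs x x = 0. Proof. by rewrite /hs subrr s_zero mulr0. Qed.

Lemma hs_anti x y : hs y x = - hs x y.
Proof. by rewrite /hs -(opprB x y) sN mulrN addrC. Qed.

(** Nonvanishing is required on a whole coset of the multiples of [eta], so that it survives the
    shift of a parameter by [eta] in every inductive step. *)
Definition generic u := forall i : int, s (u + i%:~R * eta) != 0.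

Lemma generic_shift u v (i : int) : v = u + i%:~R * eta -> generic u -> generic v.
Proof.
by move=> -> gu j; rewrite -addrA -mulrDl -intrD; apply: gu.
Qed.

Lemma generic_at u v (i : int) : v = u + i%:~R * eta -> generic u -> s v != 0.
Proof. by move=> ->. Qed.

(* [csum] and [rsum] below are the left and right sides of the identity over the
   subsets of [U]; in [csum] the elements of [S] have the sign of [w] reversed. *)
Definition flip w S k := if k \in S then - w k else w k.

(** For signed points x_i the arguments x_i + x_j and 2 x_i are roots of type C, and the sum over
    [S] runs over all changes of sign. *)
Definition cterm (g : F -> F) U w S :=
  pairs lt U (fun i j => s (flip w S i + flip w S j + eta)
          / s (flip w S i + flip w S j))
  * \prod_(k in U) (g (flip w S k) / s (flip w S k + flip w S k)).

Definition csum g U w := \sum_(S : {set I} | S \subset U) cterm g U w S.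

Lemma eq_cterm g g' U w w' S S' : g =1 g' -> {in U, flip w S =1 flip w' S'} ->
  cterm g U w S = cterm g' U w' S'.
Proof.
move=> gg ff; congr (_ * _).
  by apply: eq_pairs => i j iU jU; rewrite !ff.
by apply: eq_bigr => k kU; rewrite gg !ff.
Qed.

Lemma eq_csum g g' U w w' : g =1 g' -> {in U, w =1 w'} ->
  csum g U w = csum g' U w'.
Proof.
by move=> gg ww; apply: eq_bigr => S _; apply: eq_cterm => // k kU; rewrite /flip ww.
Qed.

(** Reversing the sign of one point merely permutes the terms, by toggling the membership of [m] in
    [S]. *)
Lemma csum_flip g U w m : m \in U ->
  csum g U (fun k => if k == m then - w k else w k) = csum g U w.
Proof.
move=> mU; pose tog (S : {set I}) := if m \in S then S :\ m else m |: S.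
have togm S : (m \in tog S) = (m \notin S).
  by rewrite /tog; case: ifP => mS; rewrite !inE eqxx.
have togk S k : k != m -> (k \in tog S) = (k \in S).
  by move=> km; rewrite /tog; case: ifP => mS; rewrite !inE (negbTE km).
have togK : involutive tog.
  move=> S; apply/setP => k; have [->|km] := eqVneq k m.
    by rewrite !togm negbK.
  by rewrite !togk.
have togU S : (tog S \subset U) = (S \subset U).
  apply/subsetP/subsetP => sub k; have [->//|km] := eqVneq k m.
    by move=> kS; apply: sub; rewrite togk.
  by rewrite togk //; apply: sub.
rewrite /csum (reindex_inj (inv_inj togK)) /=.
apply: eq_big => S; rewrite ?togU // => _; apply: eq_cterm => // k _.
rewrite /flip; have [->|km] := eqVneq k m; last by rewrite togk.
by rewrite togm; case: (m \in S); rewrite ?opprK.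
Qed.

(** If [m] is in [S] its point is [- w m] and the factor [s (x + b)] vanishes. Otherwise the pair
    factors of [m] turn [s (x + w m)] into [s (x + w m + eta)] at every other point, which is the
    shift of [b], and the factor [s (w m + b)] cancels the denominator of [m]. *)
Lemma csum_remove g b U w m : m \in U -> b = w m ->
  {in U :\ m, forall k, s (w m + w k) != 0 /\ s (w m - w k) != 0} ->
  s (w m + w m) != 0 ->
  csum (fun x => s (x + b) * g x) U w
  = g (w m) * csum (fun x => s (x + (b + eta)) * g x) (U :\ m) w.
Proof.
move=> mU -> nz nzm; rewrite /csum (bigID (fun S : {set I} => m \in S)) /= big1; last first.
  move=> S /andP[_ mS]; rewrite /cterm (bigD1 m mU) /= /flip mS addNr s_zero.
  by rewrite !mul0r mulr0.
rewrite add0r mulr_sumr; apply: eq_big => S; first by rewrite subsetD1.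
move=> /andP[_ mS]; rewrite /cterm (pairs_setD1 lt_irr lt_tour _ mU); last first.
  by move=> i j; rewrite [flip w S i + _]addrC.
have fm : flip w S m = w m by rewrite /flip (negbTE mS).
rewrite (big_setD1 m mU) /= fm.
set X := \prod_(k in U :\ m) _; set Y := \prod_(k in U :\ m) _.
set Z := \prod_(k in U :\ m) _; set Pr := pairs _ _ _.
suff <- : X * Y = Z by field.
rewrite -big_split; apply: eq_bigr => k kU /=.
have nzk : s (w m + flip w S k) != 0.
  by have [] := nz k kU; rewrite /flip; case: ifP.
have -> : flip w S k + (w m + eta) = w m + flip w S k + eta by ring.
rewrite [flip w S k + w m]addrC.
by move: (s (flip w S k + flip w S k))^-1 => di; field.
Qed.

Lemma homog_prodset U (f : I -> F -> F) :
  (forall k, k \in U -> homogeneous hs 1 (f k)) ->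
  homogeneous hs #|U| (fun v => \prod_(k in U) f k v).
Proof.
move=> hf; have -> : #|U| = count (mem U) (index_enum I).
  by rewrite -sum1_card sum1_count.
exact: homog_prod.
Qed.

Lemma homog_prodn N (f : nat -> F -> F) :
  (forall k, homogeneous hs 1 (f k)) ->
  homogeneous hs N (fun v => \prod_(k < N) f k v).
Proof.
move=> hf; have {1}-> : N = count xpredT (index_enum 'I_N).
  by rewrite -sum1_count sum1_card card_ord.
by apply: homog_prod => k _; apply: hf.
Qed.

Local Fact half2 (x : F) : x / 2 + x / 2 = x. Proof. by field. Qed.

Lemma csum_set0 g w : csum g set0 w = 1.
Proof.
rewrite /csum (big_pred1 set0) => [|S]; last by rewrite subset0.
by rewrite /cterm /pairs !big_set0 mulr1.
Qed.

(** Under the balancing condition of [jackson_C] the last argument equals b1 + b4 + (N - 1 - l) eta.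
    In the form chosen [b4] is eliminated, and for [b1], [b2] equal to [sg + v], [sg - v] the last
    two factors combine into a value of [hs] at [v]. *)
Definition cprod N b1 b2 b3 := \prod_(l < N)
  (s (b1 + b2 + l%:R * eta) * s (b1 + b3 + l%:R * eta)
   * s (- (b2 + b3) - l%:R * eta)).

Lemma cprodS N b1 b2 b3 b4 : b1 + b2 + b3 + b4 + N.+1%:R * eta = eta ->
  cprod N.+1 b1 b2 b3
  = s (b1 + b2) * s (b1 + b3) * s (b1 + b4) * cprod N (b1 + eta) b2 b3.
Proof.
move=> bal; rewrite /cprod !big_split /=.
rewrite big_ord_recl [X in _ * X * _]big_ord_recl big_ord_recr /=.
rewrite mul0r !addr0.
have -> : - (b2 + b3) - N%:R * eta = b1 + b4.
  by apply: (eq_lin (esym bal)); rewrite -natr1; ring.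
have sh b : \prod_(i < N) s (b1 + b + (lift ord0 i)%:R * eta)
          = \prod_(i < N) s (b1 + eta + b + i%:R * eta).
  by apply: eq_bigr => i _; congr s; rewrite lift0 -natr1; ring.
by rewrite !sh; ring.
Qed.

(* The special case of [bailey_C] in which the right-hand side is a product. *)
Lemma jackson_C N U w b1 b2 b3 b4 : #|U| = N ->
  {in U &, forall i j, i != j -> s (w i - w j) != 0} ->
  {in U &, forall i j, s (w i + w j) != 0} ->
  {in U &, forall i j, generic (w i + w j - (b1 + b2))} ->
  {in U &, forall i j, generic (w i - w j - (b1 + b2))} ->
  b1 + b2 + b3 + b4 + N%:R * eta = eta ->
  csum (fun x => s (x + b1) * (s (x + b2) * (s (x + b3) * s (x + b4)))) U w
  = cprod N b1 b2 b3.
Proof.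
elim: N U w b1 b2 b3 b4 => [|N IH] U w b1 b2 b3 b4 cU wB wD gD gB bal.
  by rewrite (cards0_eq cU) csum_set0 /cprod big_ord0.
pose sg := (b1 + b2) / 2.
pose f v := csum (fun x => s (x + (sg + v)) * (s (x + (sg - v)) * (s (x + b3) * s (x + b4)))) U w
   - cprod N.+1 (sg + v) (sg - v) b3.
suff f0 : f ((b1 - b2) / 2) = 0.
  have e1 : sg + (b1 - b2) / 2 = b1 by rewrite /sg; field.
  have e2 : sg - (b1 - b2) / 2 = b2 by rewrite /sg; field.
  by apply/eqP; rewrite -subr_eq0; move: f0; rewrite /f e1 e2 => ->.
have sg2 : sg + sg = b1 + b2 by exact: half2.
have fhom : homogeneous hs N.+1 f.
  apply: homog_add; first apply: homog_sum; first by exists 0.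
    move=> S _; rewrite -cU; apply: homog_ext (homog_scale (pairs lt U (fun i j => s (flip w S i + flip w S j + eta)
          / s (flip w S i + flip w S j)) * \prod_(k in U) ((s (flip w S k + b3) * s (flip w S k + b4)) / s (flip w S k + flip w S k))) (homog_prodset (U := U) (fun k _ => homog_h hs (flip w S k + sg)))).
      move=> v; rewrite /cterm -mulrA -big_split /=; congr (_ * _).
      apply: eq_bigr => k _; rewrite /hs !addrA.
      by move: (s (flip w S k + flip w S k))^-1 => di; ring.
    apply: homog_ext (homog_scale (- \prod_(l < N.+1) (s (b1 + b2 + l%:R * eta) * -1)) (homog_prodn N.+1 (fun l => homog_h hs (sg + b3 + l%:R * eta)))) => v.
    rewrite /cprod mulNr -big_split /=; congr (- _); apply: eq_bigr => l _.
    have -> : sg + v + (sg - v) = b1 + b2 by rewrite -sg2; ring.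
    have -> : - (sg - v + b3) - l%:R * eta = - (sg + b3 + l%:R * eta - v) by ring.
    have -> : sg + v + b3 + l%:R * eta = sg + b3 + l%:R * eta + v by ring.
    by rewrite sN /hs; ring.
have [m0 m0U] : exists m0, m0 \in U by apply/set0Pn; rewrite -card_gt0 cU.
(* the points where the sum collapses to [U :\ m] *)
have key w' m c1 c2 : m \in U -> {in U :\ m, w' =1 w} -> w' m = w m \/ w' m = - w m ->
    c1 + c2 = b1 + b2 -> c1 = w' m ->
    csum (fun x => s (x + c1) * (s (x + c2) * (s (x + b3) * s (x + b4)))) U w'
    = cprod N.+1 c1 c2 b3.
  move=> mU ww' wm cc c1E.
  have cE : w' m + w' m = w m + w m \/ w' m + w' m = - (w m + w m).
    by case: wm => ->; [left|right]; rewrite ?opprD.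
  rewrite (csum_remove (fun x => s (x + c2) * (s (x + b3) * s (x + b4))) mU c1E); first last.
  - by case: cE => ->; rewrite ?sN ?oppr_eq0 wD.
  - move=> k kU; rewrite (ww' k kU); move: kU; rewrite !inE => /andP[km kU].
    case: wm => ->; split; first exact: wD.
    - by apply: wB; rewrite // eq_sym.
    - by rewrite addrC; apply: wB.
    - by rewrite -opprD sN oppr_eq0 wD.
  have bal' : c1 + c2 + b3 + b4 + N.+1%:R * eta = eta by rewrite cc.
  rewrite (cprodS bal') c1E; congr (_ * _); first by rewrite mulrA.
  rewrite -c1E (eq_csum (g' := (fun x => s (x + (c1 + eta)) * (s (x + c2) * (s (x + b3) * s (x + b4))))) _ ww') //.
  have sub k : k \in U :\ m -> k \in U by rewrite inE => /andP[].
  apply: IH => //.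
  - by move: cU; rewrite (cardsD1 m) mU => -[].
  - by move=> i j /sub iU /sub jU; apply: wB.
  - by move=> i j /sub iU /sub jU; apply: wD.
  - move=> i j /sub iU /sub jU; apply: generic_shift (-1) _ (gD i j iU jU).
    by rewrite -cc; ring.
  - move=> i j /sub iU /sub jU; apply: generic_shift (-1) _ (gB i j iU jU).
    by rewrite -cc; ring.
  - by apply: (eq_lin bal'); rewrite -natr1; ring.
(* The set [U] has [N.+1] elements but [N.+2] points are needed; the sign symmetry of [csum]
   supplies the one coming from [- w m0]. *)
apply: (homog_interpolation hs_xx hs_anti hs_plucker fhom
  (pts := (- w m0 - sg) :: [seq w m - sg | m <- enum U])).
- by rewrite /= size_map -cardE cU.
- rewrite /= pairwise_map; apply/andP; split.
    apply/allP => x /mapP[k]; rewrite mem_enum => kU ->; rewrite /= /hs mulf_neq0 //.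
      apply: generic_at 0 _ (gB k m0 kU m0U); rewrite -sg2; ring.
    have -> : - w m0 - sg - (w k - sg) = - (w k + w m0) by ring.
    by rewrite sN oppr_eq0 wD.
  have : {subset enum U <= U} by move=> k; rewrite mem_enum.
  elim: (enum U) (enum_uniq U) => //= k l IHl /andP[kl /IHl{}IHl] sub.
  have kU : k \in U by apply: sub; rewrite mem_head.
  have lU : {subset l <= U} by move=> i il; apply: sub; rewrite inE il orbT.
  rewrite IHl // andbT; apply/allP => i il; rewrite /= /hs mulf_neq0 //.
    apply: generic_at 0 _ (gD k i kU (lU i il)); rewrite -sg2; ring.
  have -> : w k - sg - (w i - sg) = w k - w i by ring.
  by apply: wB => //; [apply: lU|apply: contraNneq kl => ->].
- move=> v; rewrite inE => /predU1P[->|/mapP[m]].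
    apply/eqP; rewrite subr_eq0; apply/eqP; rewrite -(csum_flip _ w m0U).
    apply: (key _ m0) => //.
    + by move=> k; rewrite !inE => /andP[/negbTE-> _].
    + by rewrite eqxx; right.
    + by rewrite -sg2; ring.
    + by rewrite eqxx; ring.
  rewrite mem_enum => mU ->.
  apply/eqP; rewrite subr_eq0; apply/eqP; apply: (key _ m) => //.
  + by left.
  + by rewrite -sg2; ring.
  + by ring.
Qed.
Section Bailey.
Variables b1 b2 b3 : F.
Let B := b1 + b2 + b3.

(** The products over [l] from [#|T|] to [N] stand for quotients of Pochhammer symbols of lengths
    [N] and [#|T|]. Written without division they keep each term a form when [b4] and [b5] vary with
    constant sum. *)
Definition rterm N b4 b5 b6 U w T :=
  (\prod_(l < #|T|) (s (b1 + b2 + l%:R * eta) * s (b1 + b3 + l%:R * eta)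
          * s (b2 + b3 + l%:R * eta)))
  * (\prod_(#|T| <= l < N) (s (B + b4 + l%:R * eta) * s (B + b5 + l%:R * eta)
          * s (B + b6 + l%:R * eta)))
  * (\prod_(j in T) \prod_(k in U :\: T) (s (w k - w j + eta) / s (w k - w j)))
  * (\prod_(k in T) (s (b4 - w k) * s (b5 - w k) * s (b6 - w k)
          / s (w k + B - eta + #|T|%:R * eta)))
  * (\prod_(k in U :\: T) (s (w k + b1) * s (w k + b2) * s (w k + b3)
          / s (w k + B + #|T|%:R * eta))).

Definition rsum N b4 b5 b6 U w :=
  \sum_(T : {set I} | T \subset U) rterm N b4 b5 b6 U w T.

(** If [m] is in [T] the factor [s (b4 - w m)] vanishes. Otherwise the factor of [b4] at [l = #|T|]
    cancels the denominator of [m], the factors of [b5] and [b6] at [l = N] become [s (w m + b6)]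
    and [s (w m + b5)] up to sign by balancing, and the mixed factors of [m] shift [b4] by [eta]. *)
Lemma rsum_remove N b4 b5 b6 U w m : #|U| = N.+1 -> m \in U -> b4 = w m ->
  {in U :\ m, forall k, s (w m - w k) != 0} -> generic (w m + B) ->
  B + b4 + b5 + b6 + N%:R * eta = 0 ->
  rsum N.+1 b4 b5 b6 U w
  = s (w m + b1) * s (w m + b2) * s (w m + b3) * s (w m + b5) * s (w m + b6)
    * rsum N (b4 + eta) b5 b6 (U :\ m) w.
Proof.
move=> cU mU b4E nz gm bal.
rewrite /rsum (bigID (fun T : {set I} => m \in T)) /= big1; last first.
  move=> T /andP[_ mT]; rewrite /rterm [X in _ * X * _](bigD1 m mT) /=.
  by rewrite b4E subrr s_zero !mul0r mulr0 mul0r.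
rewrite add0r mulr_sumr; apply: eq_big => T; first by rewrite subsetD1.
move=> /andP[TU mT]; rewrite /rterm.
have cT : (#|T| <= N)%N.
  have : (#|T| <= #|U :\ m|)%N by apply: subset_leq_card; rewrite subsetD1 TU.
  by move: cU; rewrite (cardsD1 m) mU add1n => -[<-].
have UT : (U :\: T) :\ m = (U :\ m) :\: T.
  by apply/setP => k; rewrite !inE; case: (k \in T); rewrite ?andbF.
have mUT : m \in U :\: T by rewrite inE mT.
have E0 : \prod_(j in T) \prod_(k in U :\: T) (s (w k - w j + eta) / s (w k - w j))
  = \prod_(j in T) (s (w m - w j + eta) / s (w m - w j))
  * \prod_(j in T) \prod_(k in U :\ m :\: T) (s (w k - w j + eta) / s (w k - w j)).
  by rewrite -big_split; apply: eq_bigr => j _; rewrite (big_setD1 m mUT) UT.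
rewrite E0 (big_setD1 m mUT) /= UT {E0}.
have E1 : \prod_(#|T| <= l < N.+1) (s (B + b4 + l%:R * eta)
      * s (B + b5 + l%:R * eta) * s (B + b6 + l%:R * eta))
    = s (w m + B + #|T|%:R * eta) * s (w m + b5) * s (w m + b6)
    * \prod_(#|T| <= l < N) (s (B + (b4 + eta) + l%:R * eta)
      * s (B + b5 + l%:R * eta) * s (B + b6 + l%:R * eta)).
  rewrite !big_split /= big_ltn ?ltnS // big_add1 /=.
  rewrite [\prod_(_ <= i < N.+1) s (B + b5 + _)]big_nat_recr //=.
  rewrite [\prod_(_ <= i < N.+1) s (B + b6 + _)]big_nat_recr //=.
  have -> : B + b4 + #|T|%:R * eta = w m + B + #|T|%:R * eta by rewrite b4E; ring.
  have -> : B + b5 + N%:R * eta = - (w m + b6).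
    by rewrite -b4E; apply: (eq_lin bal); ring.
  have -> : B + b6 + N%:R * eta = - (w m + b5).
    by rewrite -b4E; apply: (eq_lin bal); ring.
  have -> : \prod_(#|T| <= i < N) s (B + b4 + i.+1%:R * eta)
     = \prod_(#|T| <= i < N) s (B + (b4 + eta) + i%:R * eta).
    by apply: eq_bigr => i _; congr s; rewrite -natr1; ring.
  by rewrite !sN; ring.
have E2 : \prod_(j in T) (s (w m - w j + eta) / s (w m - w j))
     * \prod_(k in T) (s (b4 - w k) * s (b5 - w k) * s (b6 - w k)
          / s (w k + B - eta + #|T|%:R * eta))
   = \prod_(k in T) (s (b4 + eta - w k) * s (b5 - w k) * s (b6 - w k)
          / s (w k + B - eta + #|T|%:R * eta)).
  rewrite -big_split /=; apply: eq_bigr => k kT.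
  have -> : b4 + eta - w k = w m - w k + eta by rewrite b4E; ring.
  rewrite b4E; have : s (w m - w k) != 0.
    apply: nz; rewrite !inE (subsetP TU k kT) andbT.
    by apply: contraNneq mT => <-.
  by move: (s (w k + B - eta + #|T|%:R * eta))^-1 => di ?; field.
rewrite E1 -E2.
set X1 := \prod_(l < #|T|) _; set X2 := \prod_(_ <= _ < _) _.
set X3 := \prod_(j in T) (_ / _); set X4 := \prod_(j in T) _.
set X5 := \prod_(k in T) _; set X6 := \prod_(k in _) _.
have := generic_at (i := #|T|) (erefl _) gm; rewrite pmulrn => nzm.
by field.
Qed.

(** Interpolation in [b4] and [b5] at constant sum. No denominator of [rterm] contains either of
    them, which is what makes the right side a form. *)
Lemma bailey_C N U w b4 b5 b6 : #|U| = N ->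
  {in U &, forall i j, i != j -> s (w i - w j) != 0} ->
  {in U &, forall i j, s (w i + w j) != 0} ->
  {in U &, forall i j, generic (w i + w j - (b1 + b2))} ->
  {in U &, forall i j, generic (w i - w j - (b1 + b2))} ->
  {in U &, forall i j, generic (w i + w j - (b4 + b5))} ->
  {in U, forall i, generic (w i + B)} -> {in U, forall i, s (w i + b6) != 0} ->
  B + b4 + b5 + b6 + N%:R * eta = eta ->
  csum (fun x => s (x + b4) * (s (x + b5) * (s (x + b6)
          * (s (x + b1) * s (x + b2) * s (x + b3))))) U w
  = rsum N b4 b5 b6 U w.
Proof.
elim: N U w b4 b5 b6 => [|N IH] U w b4 b5 b6 cU wB wD gD gB gE gw w6 bal.
  rewrite (cards0_eq cU) csum_set0 /rsum (big_pred1 set0) => [|T]; last by rewrite subset0.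
  by rewrite /rterm cards0 set0D !big_set0 big_ord0 big_geq // !mul1r.
pose sg := (b4 + b5) / 2.
pose f v := csum (fun x => s (x + (sg + v)) * (s (x + (sg - v)) * (s (x + b6)
          * (s (x + b1) * s (x + b2) * s (x + b3))))) U w
   - rsum N.+1 (sg + v) (sg - v) b6 U w.
suff f0 : f ((b4 - b5) / 2) = 0.
  have e1 : sg + (b4 - b5) / 2 = b4 by rewrite /sg; field.
  have e2 : sg - (b4 - b5) / 2 = b5 by rewrite /sg; field.
  by apply/eqP; rewrite -subr_eq0; move: f0; rewrite /f e1 e2 => ->.
have sg2 : sg + sg = b4 + b5 by exact: half2.
have fhom : homogeneous hs N.+1 f.
  apply: homog_add; first apply: homog_sum; first by exists 0.
    move=> S _; rewrite -cU; apply: homog_ext (homog_scale (pairs lt U (fun i j => s (flip w S i + flip w S j + eta)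
          / s (flip w S i + flip w S j)) * \prod_(k in U) ((s (flip w S k + b6)  * (s (flip w S k + b1) * s (flip w S k + b2) * s (flip w S k + b3))) / s (flip w S k + flip w S k))) (homog_prodset (U := U) (fun k _ => homog_h hs (flip w S k + sg)))).
      move=> v; rewrite /cterm -mulrA -big_split /=; congr (_ * _).
      apply: eq_bigr => k _; rewrite /hs !addrA.
      by move: (s (flip w S k + flip w S k))^-1 => di; ring.
  suff hr : homogeneous hs N.+1 (fun v => rsum N.+1 (sg + v) (sg - v) b6 U w).
    by apply: homog_ext (homog_scale (-1) hr) => v; rewrite mulN1r.
  apply: homog_sum => [|T TU]; first by exists 0.
  have cT : (#|T| <= N.+1)%N by rewrite -cU subset_leq_card.
  (* The products over [l] contribute degree [N.+1 - #|T|], the points of [T] degree [#|T|]. *)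
  rewrite -{1}(subnK cT).
  have hn : homogeneous hs (N.+1 - #|T|) (fun v => \prod_(#|T| <= l < N.+1) hs (B + sg + l%:R * eta) v).
    have {1}-> : (N.+1 - #|T|)%N = count xpredT (index_iota #|T| N.+1).
      by rewrite count_predT size_iota.
    by apply: homog_prod => l _; apply: homog_h.
  have ht : homogeneous hs #|T| (fun v => \prod_(k in T) hs (sg - w k) v).
    by apply: homog_prodset => k _; apply: homog_h.
  apply: homog_ext (homog_scale ((\prod_(l < #|T|) (s (b1 + b2 + l%:R * eta) * s (b1 + b3 + l%:R * eta)
          * s (b2 + b3 + l%:R * eta)))
    * (\prod_(#|T| <= l < N.+1) s (B + b6 + l%:R * eta))
    * (\prod_(j in T) \prod_(k in U :\: T) (s (w k - w j + eta) / s (w k - w j)))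
    * (\prod_(k in T) (s (b6 - w k) / s (w k + B - eta + #|T|%:R * eta)))
    * (\prod_(k in U :\: T) (s (w k + b1) * s (w k + b2) * s (w k + b3)
          / s (w k + B + #|T|%:R * eta)))) (homog_mul hn ht)) => v.
  have e1 : \prod_(#|T| <= l < N.+1) (s (B + (sg + v) + l%:R * eta) * s (B + (sg - v) + l%:R * eta)
          * s (B + b6 + l%:R * eta)) =
     \prod_(#|T| <= l < N.+1) s (B + b6 + l%:R * eta) * \prod_(#|T| <= l < N.+1) hs (B + sg + l%:R * eta) v.
    rewrite -big_split; apply: eq_bigr => l _; rewrite /hs /=.
    have -> : B + (sg + v) + l%:R * eta = B + sg + l%:R * eta + v by ring.
    have -> : B + (sg - v) + l%:R * eta = B + sg + l%:R * eta - v by ring.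
    by rewrite mulrC.
  have e2 : (\prod_(k in T) (s (sg + v - w k) * s (sg - v - w k) * s (b6 - w k)
          / s (w k + B - eta + #|T|%:R * eta)))
    = (\prod_(k in T) (s (b6 - w k) / s (w k + B - eta + #|T|%:R * eta)))
      * \prod_(k in T) hs (sg - w k) v.
    rewrite -big_split; apply: eq_bigr => k _; rewrite /hs /=.
    have -> : sg + v - w k = sg - w k + v by ring.
    have -> : sg - v - w k = sg - w k - v by ring.
    by move: (s (w k + B - eta + #|T|%:R * eta))^-1 => di; ring.
  rewrite /rterm e1 e2.
  set X1 := \prod_(l < #|T|) _; set X2 := \prod_(_ <= l < _) s _.
  set X3 := \prod_(j in T) \prod_(k in _) _; set X5 := \prod_(k in T) _.
  set X6 := \prod_(k in U :\: T) _; set X4 := \prod_(_ <= l < _) _.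
  set X7 := \prod_(k in T) hs _ _.
  by ring.
have [m0 m0U] : exists m0, m0 \in U by apply/set0Pn; rewrite -card_gt0 cU.
have key m c4 c5 : m \in U -> c4 + c5 = b4 + b5 -> c4 = w m ->
    csum (fun x => s (x + c4) * (s (x + c5) * (s (x + b6)
          * (s (x + b1) * s (x + b2) * s (x + b3))))) U w
    = rsum N.+1 c4 c5 b6 U w.
  move=> mU cc c4E.
  have sub k : k \in U :\ m -> k \in U by rewrite inE => /andP[].
  have bal' : B + c4 + c5 + b6 + N.+1%:R * eta = eta.
    have -> : c4 = b4 + b5 - c5 by rewrite -cc; ring.
    by rewrite -[RHS]bal; ring.
  rewrite (csum_remove (fun x => s (x + c5) * (s (x + b6)
     * (s (x + b1) * s (x + b2) * s (x + b3)))) mU c4E); first last.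
  - by apply: wD.
  - move=> k; rewrite !inE => /andP[km kU]; split; first exact: wD.
    by apply: wB; rewrite // eq_sym.
  rewrite (rsum_remove cU mU c4E); first last.
  - by apply: (eq_lin bal'); rewrite -natr1; ring.
  - exact: gw.
  - move=> k; rewrite !inE => /andP[km kU].
    by apply: wB; rewrite // eq_sym.
  rewrite IH //; last 1 first.
  - by apply: (eq_lin bal'); rewrite -natr1; ring.
  - by rewrite -!mulrA; ring.
  - by move: cU; rewrite (cardsD1 m) mU add1n => -[].
  - by move=> i j /sub iU /sub jU; apply: wB.
  - by move=> i j /sub iU /sub jU; apply: wD.
  - by move=> i j /sub iU /sub jU; apply: gD.
  - by move=> i j /sub iU /sub jU; apply: gB.
  - move=> i j /sub iU /sub jU; apply: generic_shift (-1) _ (gE i j iU jU).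
    by rewrite -cc; ring.
  - by move=> i /sub iU; apply: gw.
  - by move=> i /sub iU; apply: w6.
(* At the extra point the first parameter is [- b6]. That it differs from the other points follows
   from [w6] and, through the balancing condition, from [gw]. *)
apply: (homog_interpolation hs_xx hs_anti hs_plucker fhom
  (pts := (- b6 - sg) :: [seq w m - sg | m <- enum U])).
- by rewrite /= size_map -cardE cU.
- rewrite /= pairwise_map; apply/andP; split.
    apply/allP => x /mapP[k]; rewrite mem_enum => kU ->; rewrite /= /hs mulf_neq0 //.
      apply: (generic_at (i := N) _ (gw k kU)); rewrite -pmulrn.
      by apply: (eq_lin (esym bal)); rewrite -natr1 -(addrA B) -sg2; ring.
    have -> : - b6 - sg - (w k - sg) = - (w k + b6) by ring.
    by rewrite sN oppr_eq0 w6.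
  have : {subset enum U <= U} by move=> k; rewrite mem_enum.
  elim: (enum U) (enum_uniq U) => //= k l IHl /andP[kl /IHl{}IHl] sub.
  have kU : k \in U by apply: sub; rewrite mem_head.
  have lU : {subset l <= U} by move=> i il; apply: sub; rewrite inE il orbT.
  rewrite IHl // andbT; apply/allP => i il; rewrite /= /hs mulf_neq0 //.
    apply: generic_at 0 _ (gE k i kU (lU i il)); rewrite -sg2; ring.
  have -> : w k - sg - (w i - sg) = w k - w i by ring.
  by apply: wB => //; [apply: lU|apply: contraNneq kl => ->].
- move=> v; rewrite inE => /predU1P[->|/mapP[m]]; last first.
    rewrite mem_enum => mU ->.
    apply/eqP; rewrite subr_eq0; apply/eqP; apply: (key m) => //.
      by rewrite -sg2; ring.
    by ring.
  rewrite /f; have -> : sg + (- b6 - sg) = - b6 by ring.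
  set c5 := sg - _.
  have c5E : c5 = b4 + b5 + b6 by rewrite /c5 -sg2; ring.
  have bal' : b1 + b2 + b3 + c5 + N.+1%:R * eta = eta.
    by rewrite c5E -[RHS]bal /B; ring.
  (* Balancing now gives [B + c5 + N%:R * eta = 0], the argument of a factor present in every term
     with [#|T| <= N]; only [T = U] is left. *)
  have -> : rsum N.+1 (- b6) c5 b6 U w = \prod_(l < N.+1) (s (b1 + b2 + l%:R * eta)
      * s (b1 + b3 + l%:R * eta) * s (b2 + b3 + l%:R * eta))
      * \prod_(k in U) - (s (w k + b6) * s (w k - b6)).
    rewrite /rsum (bigD1 U) //= big1 ?addr0 => [|T /andP[TU TneU]].
      rewrite /rterm setDv cU big_geq // big_set0 !mulr1.
      under [X in _ * X * _]eq_bigr do rewrite big_set0.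
      rewrite big1_eq mulr1; congr (_ * _); apply: eq_bigr => k kU.
      have := generic_at (i := N) (erefl _) (gw k kU); rewrite -pmulrn => nz.
      have -> : w k + B - eta + N.+1%:R * eta = w k + B + N%:R * eta.
        by rewrite -natr1; ring.
      have -> : c5 - w k = - (w k + B + N%:R * eta).
        by apply: (eq_lin bal'); rewrite -natr1 /B; ring.
      have -> : - b6 - w k = - (w k + b6) by ring.
      have -> : b6 - w k = - (w k - b6) by ring.
      by rewrite !sN; field.
    have cT : (#|T| < N.+1)%N.
      by rewrite -cU proper_card // properEneq TneU.
    rewrite /rterm big_nat_recr //=.
    have -> : B + c5 + N%:R * eta = 0.
      by apply: (eq_lin bal'); rewrite -natr1 /B; ring.
    by rewrite s_zero !(mulr0, mul0r).
  (* The product [s (x + b6) * s (x - b6)] is even in [x], hence the same for both signs of a point,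
     and it leaves the sum. *)
  have -> : csum (fun x => s (x + - b6) * (s (x + c5) * (s (x + b6)
       * (s (x + b1) * s (x + b2) * s (x + b3))))) U w
     = \prod_(k in U) (s (w k + b6) * s (w k - b6)) *
       csum (fun x => s (x + b1) * (s (x + b2) * (s (x + b3) * s (x + c5)))) U w.
    rewrite mulr_sumr; apply: eq_bigr => S _; rewrite /cterm mulrCA; congr (_ * _).
    rewrite -big_split; apply: eq_bigr => k kU /=.
    have -> : s (w k + b6) * s (w k - b6) = s (flip w S k + b6) * s (flip w S k - b6).
      rewrite /flip; case: ifP => // _; have -> : - w k + b6 = - (w k - b6) by ring.
      by rewrite -opprD !sN; ring.
    by move: (s (flip w S k + flip w S k))^-1 => di; ring.
  rewrite (jackson_C cU) //; apply/eqP; rewrite subr_eq0; apply/eqP.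
  rewrite prodrN cU mulrCA mulrA mulrC; congr (_ * _).
  have -> : (-1) ^+ N.+1 = \prod_(l < N.+1) (-1) :> F.
    by rewrite big_const_ord iter_mulr_1.
  rewrite -big_split /cprod; apply: eq_bigr => l _ /=.
  have -> : - (b2 + b3) - l%:R * eta = - (b2 + b3 + l%:R * eta) by ring.
  by rewrite sN mulrN mulN1r.
Qed.
End Bailey.
End Subsets.

(** * Clusters of points in arithmetic progression *)

Section Ranges.
Variable F : fieldType.
Implicit Types f : nat -> F.

(** Pochhammer symbols whose arguments lie in one arithmetic progression are intervals of one
    sequence [f], so their identities become statements about cutting and joining intervals. *)
Definition rng f a b := \prod_(a <= i < b) f i.

Lemma rng_cat f a b c : (a <= b)%N -> (b <= c)%N -> rng f a c = rng f a b * rng f b c.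
Proof. by move=> ab bc; rewrite /rng (big_cat_nat _ (n := b)). Qed.

Lemma rng1 f a : rng f a a.+1 = f a.
Proof. by rewrite /rng big_nat1. Qed.

Lemma rng_neq0 f a b : (forall i, f i != 0) -> rng f a b != 0.
Proof.
by move=> f0; rewrite prodf_seq_neq0; apply/allP => i _; rewrite f0.
Qed.

Lemma telescope_prod f a b : (a <= b)%N -> (forall k, (a <= k <= b)%N -> f k != 0) ->
  \prod_(a <= k < b) (f k.+1 / f k) = f b / f a.
Proof.
rewrite leq_eqVlt => /predU1P[<-|ab] f0; first by rewrite big_geq // divff // f0 ?leqnn.
by rewrite telescope_prodf // => k /andP[ak kb]; apply: f0; rewrite (ltnW ak) (ltnW kb).
Qed.

Lemma telescope_prodV f a b : (a <= b)%N -> (forall k, (a <= k <= b)%N -> f k != 0) ->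
  \prod_(a <= k < b) (f k / f k.+1) = f a / f b.
Proof.
move=> ab f0; rewrite -[RHS]invf_div -telescope_prod // -prodfV.
by apply: eq_bigr => k _; rewrite invf_div.
Qed.

(** In the application [f i] is [s (c1 + c2 - eta + i%:R * eta)]. The left side is what telescoping
    yields, the right side separates a part independent of [u] and [v] from the quotients in the
    summand. The essential point is [e2]: the interval from 0 to 1 + mu + v is cut in two ways. *)
Lemma block_pair f u v mu nu : (u <= mu)%N -> (v <= nu)%N -> (forall i, f i != 0) ->
  rng f 0 u / rng f v (u + v) * (rng f (1 + nu + u) (1 + nu + mu)
     / rng f (1 + v + u) (1 + v + mu))
  = rng f (1 + nu) (1 + nu + mu) / rng f 1 (1 + mu)
    * (f (u + v)%N / f 0%N * (rng f 0 v * rng f 0 u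
       / (rng f (1 + mu) (1 + mu + v) * rng f (1 + nu) (1 + nu + u)))).
Proof.
move=> um vn f0; have R a b := rng_neq0 a b f0.
have e1 : rng f (1 + nu) (1 + nu + mu)
   = rng f (1 + nu) (1 + nu + u) * rng f (1 + nu + u) (1 + nu + mu).
  by apply: rng_cat; lia.
have e2 : f 0%N * rng f 1 (1 + mu) * rng f (1 + mu) (1 + mu + v)
   = rng f 0 v * rng f v (u + v) * f (u + v)%N * rng f (1 + v + u) (1 + v + mu).
  have -> : (1 + v + u = (u + v).+1)%N by lia.
  have -> : (1 + v + mu = 1 + mu + v)%N by lia.
  by rewrite -(rng1 f 0) -(rng1 f (u + v)) -!rng_cat //; lia.
rewrite e1.
have -> : rng f (1 + mu) (1 + mu + v) = rng f 0 v * rng f v (u + v) * f (u + v)%N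
    * rng f (1 + v + u) (1 + v + mu) / (f 0%N * rng f 1 (1 + mu)).
  by rewrite -e2; field; rewrite R f0.
by field; rewrite ?R ?f0.
Qed.

Lemma block_diag f u mu : (u <= mu)%N -> (forall i, f i != 0) ->
  (rng f u (u + u))^-1 / rng f (u + u).+1 (u + mu).+1
  = (rng f 1 (1 + mu))^-1
    * (f (u + u)%N / f 0%N * (rng f 0 u / rng f (1 + mu) (1 + mu + u))).
Proof.
move=> um f0; have R a b := rng_neq0 a b f0.
have e2 : f 0%N * rng f 1 (1 + mu) * rng f (1 + mu) (1 + mu + u)
   = rng f 0 u * rng f u (u + u) * f (u + u)%N * rng f (u + u).+1 (u + mu).+1.
  have -> : ((u + mu).+1 = 1 + mu + u)%N by lia.
  by rewrite -(rng1 f 0) -(rng1 f (u + u)) -!rng_cat //; lia.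
have -> : rng f (1 + mu) (1 + mu + u) = rng f 0 u * rng f u (u + u) * f (u + u)%N
    * rng f (u + u).+1 (u + mu).+1 / (f 0%N * rng f 1 (1 + mu)).
  by rewrite -e2; field; rewrite R f0.
by field; rewrite ?R ?f0.
Qed.

Lemma rng_shift f g a n : (forall i, g i = f (a + i)%N) ->
  \prod_(i < n) g i = rng f a (a + n).
Proof.
move=> gf; rewrite /rng -[X in \prod_(X <= _ < _) _]add0n big_addn addKn big_mkord.
by apply: eq_bigr => i _; rewrite gf addnC.
Qed.

Lemma rng_rev f g a n : (forall i, (i < n)%N -> g i = f (a + n - i.+1)%N) ->
  \prod_(i < n) g i = rng f a (a + n).
Proof.
move=> gf; rewrite -(rng_shift (g := fun i => f (a + i)%N)) //.
rewrite (reindex_inj rev_ord_inj) /=; apply: eq_bigr => i _.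
by rewrite gf ?ltn_subrL ?(leq_ltn_trans _ (ltn_ord i)) //; congr f; have := ltn_ord i; lia.
Qed.
End Ranges.

(** * Telescoping of the pair factors over clusters *)

Section Specialization.
Variables (F : numFieldType) (s : F -> F) (eta : F).
Hypothesis sN : forall u, s (- u) = - s u.
Hypothesis s_plucker : forall x y u v,
  hs s x y * hs s u v - hs s x u * hs s y v + hs s x v * hs s y u = 0.

Definition shifted_poch u k := \prod_(i < k) s (u + i%:R * eta).

(** Up to sign both sides are the product of [s] over the u + v + 1 points from dl - u eta to dl + v
    eta, with the point dl + (v - u) eta singled out on the left and dl on the right. *)
Lemma block_vandermonde dl u v :
  \prod_(i < u) s (dl + v%:R * eta - i%:R * eta)
  * \prod_(i < v) s (- dl + u%:R * eta - i%:R * eta)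
  * s (dl + v%:R * eta - u%:R * eta) * (-1) ^+ u
  = (-1) ^+ v * (s dl * shifted_poch (dl + eta) v * shifted_poch (- dl + eta) u).
Proof.
pose f i := s (dl - u%:R * eta + i%:R * eta).
have e1 : \prod_(i < u) s (dl + v%:R * eta - i%:R * eta) = rng f v.+1 (v.+1 + u).
  apply: (rng_rev (g := fun i => s (dl + v%:R * eta - i%:R * eta))) => i iu.
  rewrite /f; congr s; have -> : (v.+1 + u - i.+1 = v + u - i)%N by lia.
  by rewrite natrB ?natrD; [ring|lia].
have sgn n (g : nat -> F) : \prod_(i < n) - g i = (-1) ^+ n * \prod_(i < n) g i.
  elim: n => [|n IH]; first by rewrite !big_ord0 mulr1.
  by rewrite !big_ord_recr /= IH exprS; ring.
have e2 : \prod_(i < v) s (- dl + u%:R * eta - i%:R * eta) = (-1) ^+ v * rng f 0 v.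
  rewrite -(@rng_shift _ f f 0 v) // -(sgn v f); apply: eq_bigr => i _.
  by rewrite /f -sN; congr s; ring.
have e3 : shifted_poch (dl + eta) v = rng f u.+1 (u.+1 + v).
  apply: (rng_shift (g := fun i => s (dl + eta + i%:R * eta))) => i.
  by rewrite /f; congr s; rewrite addSn -natr1 natrD; ring.
have e4 : shifted_poch (- dl + eta) u = (-1) ^+ u * rng f 0 u.
  rewrite -(@rng_rev _ f (fun i => f (u - i.+1)%N) 0 u) ?add0n // -(sgn u (fun i => f (u - i.+1)%N)).
  apply: eq_bigr => i _; rewrite /f -sN; congr s.
  by rewrite natrB // -natr1; ring.
have e5 : s (dl + v%:R * eta - u%:R * eta) = f v by rewrite /f; congr s; ring.
have e6 : s dl = f u by rewrite /f; congr s; ring.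
rewrite e1 e2 e3 e4 e5 e6 -(rng1 f v) -(rng1 f u).
have -> : rng f v.+1 (v.+1 + u) * ((-1) ^+ v * rng f 0 v) * rng f v v.+1 * (-1) ^+ u
  = (-1) ^+ u * (-1) ^+ v * (rng f 0 v * rng f v v.+1 * rng f v.+1 (v.+1 + u)) by ring.
have -> : (-1) ^+ v * (rng f u u.+1 * rng f u.+1 (u.+1 + v) * ((-1) ^+ u * rng f 0 u))
  = (-1) ^+ u * (-1) ^+ v * (rng f 0 u * rng f u u.+1 * rng f u.+1 (u.+1 + v)) by ring.
rewrite -!rng_cat //; try lia.
by have -> : (v.+1 + u = u.+1 + v)%N by lia.
Qed.

Definition pair_factor x y := s (x + y + eta) / s (x + y).

Lemma generic_nat u (k : nat) : generic s eta u -> s (u + k%:R * eta) != 0.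
Proof. by move=> gu; have := gu k%:Z; rewrite -pmulrn. Qed.

(** Neighbouring points of a cluster differ by [eta], so the pair factors telescope. Cutting at [u]
    and [v] gives four blocks: pairs with equal signs produce values of [f], pairs with opposite
    signs produce the factors in the difference [dl]. *)
Lemma pair_block c1 c2 u v mu nu : (u <= mu)%N -> (v <= nu)%N ->
  let f i := s (c1 + c2 - eta + i%:R * eta) in
  let dl := c2 - c1 in
  let w i := c1 + i%:R * eta in let w' i := c2 + i%:R * eta in
  (forall i, f i != 0) ->
  (forall k l, (k <= nu)%N -> (l < mu)%N -> s (dl + k%:R * eta - l%:R * eta) != 0) ->
  (forall k l, (k <= mu)%N -> (l < nu)%N -> s (- dl + k%:R * eta - l%:R * eta) != 0) ->
  \prod_(0 <= i < mu) \prod_(0 <= j < nu)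
     pair_factor (if (i < u)%N then - w i else w i) (if (j < v)%N then - w' j else w' j)
  = \prod_(0 <= i < u) (s (dl + nu%:R * eta - i%:R * eta) / s (dl + v%:R * eta - i%:R * eta))
  * \prod_(0 <= i < v) (s (- dl + mu%:R * eta - i%:R * eta) / s (- dl + u%:R * eta - i%:R * eta))
  * (rng f 0 u / rng f v (u + v) * (rng f (1 + nu + u) (1 + nu + mu)
     / rng f (1 + v + u) (1 + v + mu))).
Proof.
move=> um vn f dl w w' f0 nd nd'.
have row1 i : (0 <= i < u)%N -> \prod_(0 <= j < nu)
     pair_factor (if (i < u)%N then - w i else w i) (if (j < v)%N then - w' j else w' j)
   = s (dl + nu%:R * eta - i%:R * eta) / s (dl + v%:R * eta - i%:R * eta)
     * (f i / f (v + i)%N).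
  move=> /andP[_ iu]; rewrite iu (big_cat_nat _ (n := v)) //= mulrC; congr (_ * _).
    rewrite -(telescope_prod (f := fun j => s (dl + j%:R * eta - i%:R * eta)) vn).
      apply: eq_big_nat => j /andP[vj _]; rewrite ltnNge vj /= /pair_factor.
      by congr (s _ / s _); rewrite /w /w' /dl -?natr1; ring.
    by move=> k /andP[_ kn]; apply: nd => //; apply: leq_trans um.
  rewrite -[f i](congr1 f (add0n i)).
  rewrite -(telescope_prodV (f := fun j => f (j + i)%N) (leq0n v)) //.
  apply: eq_big_nat => j /andP[_ jv]; rewrite jv /pair_factor /f.
  rewrite -(opprD (w i)) -[_ + eta]opprK sN [s (- (w i + _))]sN invrN mulrNN.
  by congr (s _ / s _); rewrite /w /w' ?addSn -?natr1 ?natrD; ring.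
have row2 i : (u <= i < mu)%N -> \prod_(0 <= j < nu)
     pair_factor (if (i < u)%N then - w i else w i) (if (j < v)%N then - w' j else w' j)
   = \prod_(0 <= j < v) (s (- dl + i.+1%:R * eta - j%:R * eta) / s (- dl + i%:R * eta - j%:R * eta))
     * (f (1 + nu + i)%N / f (1 + v + i)%N).
  move=> /andP[ui _]; rewrite ltnNge ui (big_cat_nat _ (n := v)) //=; congr (_ * _).
    apply: eq_big_nat => j /andP[_ jv]; rewrite jv /pair_factor.
    by congr (s _ / s _); rewrite /w /w' /dl -?natr1; ring.
  rewrite -(telescope_prod (f := fun j => f (1 + j + i)%N) vn) //.
  apply: eq_big_nat => j /andP[vj _]; rewrite ltnNge vj /= /pair_factor /f.
  by congr (s _ / s _); rewrite /w /w' ?addSn ?add0n -?natr1 ?natrD; ring.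
rewrite (big_cat_nat _ (n := u)) //= (eq_big_nat _ _ row1) (eq_big_nat _ _ row2).
(* The block with [i] beyond [u] and [j] below [v] telescopes in [i] instead of [j]. *)
rewrite !big_split /= exchange_big_nat /=.
have -> : \prod_(0 <= j < v) \prod_(u <= i < mu)
      (s (- dl + i.+1%:R * eta - j%:R * eta) / s (- dl + i%:R * eta - j%:R * eta))
   = \prod_(0 <= i < v) (s (- dl + mu%:R * eta - i%:R * eta) / s (- dl + u%:R * eta - i%:R * eta)).
  apply: eq_big_nat => j /andP[_ jv].
  rewrite (telescope_prod (f := fun i => s (- dl + i%:R * eta - j%:R * eta)) um) //.
  by move=> k /andP[_ km]; apply: nd' => //; apply: leq_trans vn.
rewrite !big_split /= !prodfV.
have sh a x y : \prod_(x <= i < y) f (a + i)%N = rng f (a + x) (a + y).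
  by rewrite /rng [(a + x)%N]addnC big_addn addKn; apply: eq_bigr => i _; rewrite addnC.
have -> : \prod_(0 <= i < u) f i = rng f 0 u by [].
by rewrite !sh addn0 [(v + u)%N]addnC; ring.
Qed.

(** For pairs inside one cluster the telescoped product at index [i] starts at [f (i.+1 + i)], which
    up to sign is [s (W i + W i)]; it cancels the diagonal factor, and reversed points leave the
    sign. *)
Lemma diag_block c u mu : (u <= mu)%N ->
  let f i := s (c + c - eta + i%:R * eta) in
  let w i := c + i%:R * eta in
  (forall i, f i != 0) ->
  (forall k l, (l < k)%N -> (k <= mu)%N -> s (k%:R * eta - l%:R * eta) != 0) ->
  let W i := if (i < u)%N then - w i else w i in
  (\prod_(0 <= i < mu) \prod_(0 <= j < mu | (i < j)%N) pair_factor (W i) (W j))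
  * \prod_(0 <= i < mu) (s (W i + W i))^-1
  = (-1) ^+ u
  * \prod_(0 <= i < u) (s (mu%:R * eta - i%:R * eta) / s (u%:R * eta - i%:R * eta))
  * ((rng f u (u + u))^-1 / rng f (u + u).+1 (u + mu).+1).
Proof.
move=> um f w f0 nd W.
have tri i : \prod_(0 <= j < mu | (i < j)%N) pair_factor (W i) (W j)
   = \prod_(i.+1 <= j < mu) pair_factor (W i) (W j).
  by rewrite [RHS](big_nat_widenl _ 0).
under eq_bigr do rewrite tri.
have row1 i : (0 <= i < u)%N ->
    (\prod_(i.+1 <= j < mu) pair_factor (W i) (W j)) / s (W i + W i)
   = - (s (mu%:R * eta - i%:R * eta) / s (u%:R * eta - i%:R * eta)) * (f (u + i)%N)^-1.
  move=> /andP[_ iu]; rewrite (big_cat_nat _ (n := u)) //=.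
  have -> : \prod_(u <= j < mu) pair_factor (W i) (W j)
      = s (mu%:R * eta - i%:R * eta) / s (u%:R * eta - i%:R * eta).
    rewrite -(telescope_prod (f := fun j => s (j%:R * eta - i%:R * eta)) um).
      apply: eq_big_nat => j /andP[uj _]; rewrite /pair_factor /W iu ltnNge uj /=.
      by congr (s _ / s _); rewrite /w -?natr1; ring.
    by move=> k /andP[uk km]; apply: nd => //; apply: leq_trans uk.
  have -> : \prod_(i.+1 <= j < u) pair_factor (W i) (W j) = f (i.+1 + i)%N / f (u + i)%N.
    rewrite -(telescope_prodV (f := fun j => f (j + i)%N) iu) //.
    apply: eq_big_nat => j /andP[_ ju]; rewrite /W iu ju /pair_factor /f.
    rewrite -(opprD (w i)) -[_ + eta]opprK sN [s (- (w i + _))]sN invrN mulrNN.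
    by congr (s _ / s _); rewrite /w ?addSn -?natr1 ?natrD; ring.
  have -> : s (W i + W i) = - f (i.+1 + i)%N.
    by rewrite /W iu -opprD sN /f; congr (- s _); rewrite /w addSn -natr1 natrD; ring.
  by move: (s (mu%:R * eta - i%:R * eta) / _) => X; field; rewrite !f0.
(* Here the order of the products is exchanged, because for unreversed points it is the smaller
   index [i] that telescopes at fixed [j]. *)
have row2 : (\prod_(u <= i < mu) \prod_(i.+1 <= j < mu) pair_factor (W i) (W j))
     = \prod_(u <= j < mu) (f (j.+1 + j)%N / f (1 + u + j)%N).
  under eq_big_nat => i /andP[ui _] do rewrite (big_nat_widenl _ u) /= ?(leqW ui) //.
  rewrite (exchange_big_dep_nat xpredT) //=; apply: eq_big_nat => j /andP[uj jm].
  have -> : \prod_(u <= i < mu | (i < j)%N) pair_factor (W i) (W j) = \prod_(u <= i < j) pair_factor (W i) (W j).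
    by rewrite [RHS](big_nat_widen _ _ mu) // ltnW.
  rewrite -[(j.+1 + j)%N]/(1 + j + j)%N.
  rewrite -(telescope_prod (f := fun i => f (1 + i + j)%N) uj) //.
  apply: eq_big_nat => i /andP[ui _]; rewrite /pair_factor /W !ltnNge ui uj /= /f.
  by congr (s _ / s _); rewrite /w ?addSn ?add0n -?natr1 ?natrD; ring.
rewrite -big_split /= (big_cat_nat _ (n := u)) //= (eq_big_nat _ _ row1).
rewrite [X in _ * X]big_split /= row2 -big_split /=.
have -> : \prod_(u <= i < mu) (f (i.+1 + i)%N / f (1 + u + i)%N * (s (W i + W i))^-1)
   = \prod_(u <= i < mu) (f ((1 + u) + i)%N)^-1.
  apply: eq_big_nat => j /andP[uj _].
  have -> : s (W j + W j) = f (j.+1 + j)%N.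
    by rewrite /W ltnNge uj /= /f; congr s; rewrite /w addSn -natr1 natrD; ring.
  by field; rewrite !f0.
have sh a x y : \prod_(x <= i < y) f (a + i)%N = rng f (a + x) (a + y).
  by rewrite /rng [(a + x)%N]addnC big_addn addKn; apply: eq_bigr => i _; rewrite addnC.
rewrite big_split /= !prodfV !sh addn0 !add1n !addSn.
rewrite -[RHS]mulrA [RHS]mulrA -[LHS]mulrA; congr (_ * _).
have sgn k (X : nat -> F) :
    \prod_(0 <= i < k) - X i = (-1) ^+ k * \prod_(0 <= i < k) X i.
  elim: k => [|k IH]; first by rewrite !big_geq // mulr1.
  by rewrite !big_nat_recr //= IH exprS; ring.
exact: sgn.
Qed.
End Specialization.

Section DoubleProducts.
Variables (R : Type) (idx : R) (op : Monoid.com_law idx) (n : nat).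
Implicit Types G : 'I_n -> 'I_n -> R.

(** The monoid is left abstract since the splitting serves both for products of factors and for sums
    of their exponents. *)
Lemma big_square G :
  \big[op/idx]_(j < n) \big[op/idx]_(k < n) G j k
  = op (\big[op/idx]_(j < n) G j j)
       (\big[op/idx]_(j < n) \big[op/idx]_(k < n | (j < k)%N) (op (G j k) (G k j))).
Proof.
have -> : \big[op/idx]_(j < n) \big[op/idx]_(k < n | (j < k)%N) (op (G j k) (G k j))
  = \big[op/idx]_(j < n) \big[op/idx]_(k < n | k != j) G j k.
  under eq_bigr do rewrite big_split.
  rewrite big_split /= [X in op _ X](exchange_big_dep xpredT) //= -big_split.
  apply: eq_bigr => j _ /=; rewrite [RHS](bigID (fun k : 'I_n => (j < k)%N)) /=.
  congr (op _ _); apply: eq_bigl => k; rewrite -(inj_eq val_inj) /=; lia.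
by rewrite -big_split; apply: eq_bigr => j _; rewrite (bigD1 j).
Qed.

Lemma big_triangle G :
  \big[op/idx]_(j < n) \big[op/idx]_(k < n | (j <= k)%N) G j k
  = op (\big[op/idx]_(j < n) G j j)
       (\big[op/idx]_(j < n) \big[op/idx]_(k < n | (j < k)%N) G j k).
Proof.
rewrite -big_split; apply: eq_bigr => j _ /=; rewrite (bigD1 j) //=; congr (op _ _).
by apply: eq_bigl => k; rewrite -(inj_eq val_inj) /=; lia.
Qed.
End DoubleProducts.

Lemma prod_square (K : comPzRingType) n (G : 'I_n -> 'I_n -> K) :
  \prod_(j < n) \prod_(k < n) G j k
  = \prod_(j < n) G j j * \prod_(j < n) \prod_(k < n | (j < k)%N) (G j k * G k j).
Proof. exact: big_square. Qed.

Lemma prod_triangle (K : comPzRingType) n (G : 'I_n -> 'I_n -> K) :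
  \prod_(j < n) \prod_(k < n | (j <= k)%N) G j k
  = \prod_(j < n) G j j * \prod_(j < n) \prod_(k < n | (j < k)%N) G j k.
Proof. exact: big_triangle. Qed.

(** * Subsets that are initial segments of every cluster *)

Section InitialSegments.
Variables (n : nat) (m : 'I_n -> nat).
Local Notation cells := {k : 'I_n & 'I_(m k)}.
Implicit Types (y : 'I_n -> nat) (S : {set cells}).

Definition cell_lt (i j : cells) :=
  (tag i < tag j)%N || (tag i == tag j) && (tagged i < tagged j)%N.

Lemma cell_lt_irr : irreflexive cell_lt.
Proof. by move=> i; rewrite /cell_lt eqxx !ltnn. Qed.

Lemma cell_lt_tour (i j : cells) : i != j -> cell_lt i j = ~~ cell_lt j i.
Proof.
case: i j => [k s] [l t]; rewrite /cell_lt /= => ij.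
have [kl|kl] := eqVneq k l.
  move: s t ij; rewrite {k}kl !ltnn /= => s t ij.
  have : (s : nat) != t.
    by apply: contraNneq ij => st; apply/eqP; congr existT; apply: val_inj.
  lia.
rewrite !orbF; have : (k : nat) != l by apply: contraNneq kl => kl; apply/eqP/val_inj.
by lia.
Qed.

Definition seg y : {set cells} := [set i : cells | (tagged i < y (tag i))%N].

Variable F : comNzRingType.

Lemma prod_cells (G : 'I_n -> nat -> F) :
  \prod_(i : cells) G (tag i) (tagged i) = \prod_(k < n) \prod_(0 <= t < m k) G k t.
Proof.
rewrite -(sig_big_dep xpredT (fun k => xpredT) (fun (k : 'I_n) (t : 'I_(m k)) => G k t)) /=.
by apply: eq_bigr => k _; rewrite big_mkord.
Qed.

Lemma prod_cells_cond (Q : 'I_n -> nat -> bool) (G : 'I_n -> nat -> F) :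
  \prod_(i : cells | Q (tag i) (tagged i)) G (tag i) (tagged i)
  = \prod_(k < n) \prod_(0 <= t < m k | Q k t) G k t.
Proof.
rewrite big_mkcond (prod_cells (fun k t => if Q k t then G k t else 1)).
by apply: eq_bigr => k _; rewrite -big_mkcond.
Qed.

Lemma pairs_cells (f : cells -> cells -> F) (G : 'I_n -> nat -> 'I_n -> nat -> F) :
  (forall i j, f i j = G (tag i) (tagged i) (tag j) (tagged j)) ->
  pairs cell_lt setT f
  = \prod_(j < n) (\prod_(0 <= s < m j) \prod_(0 <= t < m j | (s < t)%N) G j s j t)
  * \prod_(j < n) \prod_(k < n | (j < k)%N)
      \prod_(0 <= s < m j) \prod_(0 <= t < m k) G j s k t.
Proof.
move=> fG; rewrite /pairs.
under eq_bigl do rewrite inE.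
have E i : \prod_(j in [set: cells] | cell_lt i j) f i j
   = \prod_(0 <= t < m (tag i) | (tagged i < t)%N) G (tag i) (tagged i) (tag i) t
   * \prod_(k < n | (tag i < k)%N) \prod_(0 <= t < m k) G (tag i) (tagged i) k t.
  under eq_bigl do rewrite inE /=.
  under eq_bigr do rewrite fG.
  rewrite (prod_cells_cond (fun k t => (tag i < k)%N || (tag i == k) && (tagged i < t)%N)
    (fun k t => G (tag i) (tagged i) k t)).
  rewrite (bigD1 (tag i)) //=; congr (_ * _).
    by apply: eq_bigl => t; rewrite ltnn eqxx.
  rewrite [RHS]big_mkcond [RHS](bigD1 (tag i)) //= ltnn mul1r.
  apply: eq_bigr => k ki; rewrite [tag i == k]eq_sym (negbTE ki) /=.
  by case: (tag i < k)%N => /=; rewrite ?big_pred0_eq.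
rewrite (eq_bigr _ (fun i _ => E i)).
rewrite (prod_cells (fun j s => \prod_(0 <= t < m j | (s < t)%N) G j s j t
   * \prod_(k < n | (j < k)%N) \prod_(0 <= t < m k) G j s k t)).
under eq_bigr do rewrite big_split /=.
rewrite big_split /=; congr (_ * _); apply: eq_bigr => j _.
by rewrite exchange_big /=.
Qed.

Lemma card_seg y : (forall k, y k <= m k)%N -> #|seg y| = (\sum_(k < n) y k)%N.
Proof.
move=> ym; rewrite -sum1_card; under eq_bigl do rewrite inE.
rewrite big_mkcond -(sig_big_dep xpredT (fun k => xpredT)
   (fun (k : 'I_n) (t : 'I_(m k)) => if (t < y k)%N then 1%N else 0%N)) /=.
apply: eq_bigr => k _; rewrite -big_mkcond /=.
by rewrite -(big_ord_widen _ (fun=> 1%N) (ym k)) sum_nat_const card_ord muln1.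
Qed.

Lemma seg_inj y y' : (forall k, y k <= m k)%N -> (forall k, y' k <= m k)%N ->
  seg y = seg y' -> y =1 y'.
Proof.
move=> ym ym' E k.
have lt_eq u v : (u <= m k)%N -> (v <= m k)%N ->
    (forall t : 'I_(m k), (t < u)%N = (t < v)%N) -> (u <= v)%N.
  move=> um vm H; rewrite leqNgt; apply/negP => vu.
  by have := H (Ordinal (leq_trans vu um)); rewrite /= vu ltnn.
have H (t : 'I_(m k)) : (t < y k)%N = (t < y' k)%N.
  by have := congr1 (fun S : {set cells} => Tagged (fun k => 'I_(m k)) t \in S) E; rewrite !inE.
by apply/eqP; rewrite eqn_leq; apply/andP; split; apply: lt_eq.
Qed.

(** Without such a gap every cluster would meet [S] in all positions before the first missing one
    and in none after it, and [S] would be a segment. *)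
Lemma not_seg S : (forall y, (forall k, y k <= m k)%N -> S <> seg y) ->
  exists i j : cells, [/\ i \in S, j \notin S, tag i = tag j
    & (tagged i : nat) = (tagged j).+1].
Proof.
move=> nS; pose inS k t := [exists t' : 'I_(m k), (t' == t :> nat) && (Tagged (fun k => 'I_(m k)) t' \in S)].
have inSE k (t : 'I_(m k)) : inS k t = (Tagged (fun k => 'I_(m k)) t \in S).
  apply/existsP/idP => [[t' /andP[/eqP/val_inj -> //]]|tS].
  by exists t; rewrite eqxx.
have [/existsP[k /existsP[t /andP[t0 /andP[tS tS']]]]|H] :=
  boolP [exists k, exists t : 'I_(m k), [&& (0 < t)%N, inS k t & ~~ inS k t.-1]].
  have tm : (t.-1 < m k)%N by have := ltn_ord t; lia.
  exists (Tagged (fun k => 'I_(m k)) t), (Tagged (fun k => 'I_(m k)) (Ordinal tm)).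
  rewrite -!inSE /=; split=> //; by rewrite prednK.
have down k t : (t.+1 < m k)%N -> inS k t.+1 -> inS k t.
  move=> tm tS; apply: contraNT H => tS'; apply/existsP; exists k.
  by apply/existsP; exists (Ordinal tm); rewrite /= tS tS'.
(* The first missing position of cluster [k], or [m k] when nothing is missing. *)
pose y k := find (fun t => ~~ inS k t) (iota 0 (m k)).
have ym k : (y k <= m k)%N by rewrite -[X in (_ <= X)%N](size_iota 0) find_size.
case: (nS y ym); apply/setP => -[k t]; rewrite inE /= -inSE.
have tm := ltn_ord t.
have [ty|yt] := ltnP t (y k).
  by have := before_find 0%N ty; rewrite nth_iota // add0n => /negbFE.
apply/negbTE/negP => tS.
have has_y : has (fun t => ~~ inS k t) (iota 0 (m k)).
  by rewrite has_find size_iota (leq_ltn_trans yt).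
have := nth_find 0%N has_y; rewrite -/(y k) nth_iota ?add0n; last first.
  exact: leq_ltn_trans yt tm.
apply/negP; rewrite negbK; move: tS; rewrite -(subnK yt).
have : (t - y k + y k < m k)%N by rewrite subnK.
elim: (t - y k)%N => [//|d IH]; rewrite addSn => dm /(down _ _ dm).
by apply: IH; apply: ltnW.
Qed.

Lemma sum_seg (G : {set cells} -> F) :
  (forall S, (exists i j : cells, [/\ i \in S, j \notin S, tag i = tag j
    & (tagged i : nat) = (tagged j).+1]) -> G S = 0) ->
  \sum_(S : {set cells}) G S
  = \sum_(y : {dffun forall k, 'I_(m k).+1}) G (seg (fun k => y k)).
Proof.
move=> G0; pose A := [set seg (fun k => (y : {dffun forall k, 'I_(m k).+1}) k) | y in {dffun forall k, 'I_(m k).+1}].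
rewrite (bigID (mem A)) /= [X in _ + X]big1 ?addr0 => [|S SA]; last first.
  apply/G0/not_seg => y ym SE; move/negP: SA; apply.
  have ym' k : (y k < (m k).+1)%N by rewrite ltnS.
  apply/imsetP; exists (finfun (fun k => Ordinal (ym' k))) => //.
  by rewrite SE; apply/setP => i; rewrite !inE ffunE.
rewrite big_imset //= => y y' _ _ E; apply/ffunP => k; apply: val_inj.
by apply: (seg_inj _ _ E) => l; rewrite -ltnS.
Qed.
End InitialSegments.

(** * The term of the left side at an initial segment *)

Section Clusters.
Variables (F : numFieldType) (s : F -> F) (eta : F).
Hypothesis sN : forall u, s (- u) = - s u.
Variables (n : nat) (m : 'I_n -> nat) (c : 'I_n -> F).
Local Notation cells := {k : 'I_n & 'I_(m k)}.
Local Notation spoch := (shifted_poch s eta).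
Local Notation generic := (generic s eta).
Local Notation P := (pair_factor s eta).

Hypothesis gcc : forall j k, generic (c j + c k).
Hypothesis nzd : forall j k i, (1 <= i <= m k)%N -> s (c k - c j + i%:R * eta) != 0.
Hypothesis nzd0 : forall j k, j != k -> s (c k - c j) != 0.
Variable y : 'I_n -> nat.
Hypothesis ym : forall k, (y k <= m k)%N.

Lemma diff_neq0 j k u v : j != k -> (u <= m k)%N -> (v <= m j)%N ->
  s (c k - c j + u%:R * eta - v%:R * eta) != 0.
Proof.
move=> jk um vm; have [uv|vu|uv] := ltngtP u v.
- have -> : c k - c j + u%:R * eta - v%:R * eta = - (c j - c k + (v - u)%:R * eta).
    by rewrite natrB ?(ltnW uv) //; ring.
  by rewrite sN oppr_eq0 nzd //; lia.
- have -> : c k - c j + u%:R * eta - v%:R * eta = c k - c j + (u - v)%:R * eta.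
    by rewrite natrB ?(ltnW vu) //; ring.
  by rewrite nzd //; lia.
- by rewrite uv addrK nzd0.
Qed.

Lemma diff_neq0_diag j u v : (v < u)%N -> (u <= m j)%N ->
  s (u%:R * eta - v%:R * eta) != 0.
Proof.
move=> vu um; have := @nzd j j (u - v)%N; rewrite subrr add0r natrB ?(ltnW vu) // mulrBl.
by apply; lia.
Qed.

Lemma spoch_neq0 u k : generic u -> spoch u k != 0.
Proof. by move=> gu; apply/prodf_neq0 => i _; apply: generic_nat. Qed.

Lemma spochD u k l : spoch u (k + l) = spoch u k * spoch (u + k%:R * eta) l.
Proof.
rewrite /shifted_poch big_split_ord /=; congr (_ * _); apply: eq_bigr => i _.
by congr s; rewrite natrD; ring.
Qed.

Lemma rng_spoch x f a k : (forall i, f i = s (x + i%:R * eta)) ->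
  rng f a (a + k) = spoch (x + a%:R * eta) k.
Proof.
move=> fE; rewrite -(@rng_shift _ f (fun i => f (a + i)%N) a k) //.
by apply: eq_bigr => i _; rewrite fE natrD; congr s; ring.
Qed.

(** With c_k the logarithm of z_k times a square root of aq, this is the quotient of Vandermonde
    determinants up to an exponential factor. In the same sense [ablock] holds the symbols in z_k /
    z_j, and [cblock] the factors in a z_j z_k. *)
Definition vand := \prod_(j < n) \prod_(k < n | (j < k)%N)
  (s (c k - c j + (y k)%:R * eta - (y j)%:R * eta) / s (c k - c j)).

Definition ablock := \prod_(j < n) \prod_(k < n)
  (spoch (c k - c j - (m j)%:R * eta) (y k) / spoch (c k - c j + eta) (y k)).

Definition cblock :=
  (\prod_(j < n) \prod_(k < n | (j <= k)%N)
     (s (c j + c k - eta + (y j + y k)%:R * eta) / s (c j + c k - eta)))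
  * \prod_(j < n) \prod_(k < n)
     (spoch (c j + c k - eta) (y k) / spoch (c j + c k + (m j)%:R * eta) (y k)).

(** This is how the factors in the differences of the [c k] come out of telescoping, on both sides
    of the identity; [prod_araw] regroups them. *)
Definition araw j k := \prod_(0 <= i < y j)
  (s (c k - c j + (m k)%:R * eta - i%:R * eta) / s (c k - c j + (y k)%:R * eta - i%:R * eta)).

Let sgnM k : ((-1) ^+ k * (-1) ^+ k : F) = 1.
Proof. by rewrite -expr2 sqrr_sign. Qed.

Lemma prodN k (g : nat -> F) : \prod_(i < k) - g i = (-1) ^+ k * \prod_(i < k) g i.
Proof.
elim: k => [|k IH]; first by rewrite !big_ord0 mulr1.
by rewrite !big_ord_recr /= IH exprS; ring.
Qed.

Lemma araw_num j k : \prod_(i < y j) s (c k - c j + (m k)%:R * eta - i%:R * eta)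
  = (-1) ^+ y j * spoch (c j - c k - (m k)%:R * eta) (y j).
Proof.
rewrite -(prodN (y j) (fun i => s (c j - c k - (m k)%:R * eta + i%:R * eta))).
by apply: eq_bigr => i _; rewrite -sN; congr s; ring.
Qed.

Lemma spoch_diff_neq0 j k : spoch (c k - c j + eta) (y k) != 0.
Proof.
apply/prodf_neq0 => i _; have := @nzd j k i.+1; rewrite -natr1 mulrDl mul1r.
rewrite addrA addrAC; apply; have := ym k; have := ltn_ord i; lia.
Qed.

(** The two denominators together form the left side of [block_vandermonde], which trades them for
    the Vandermonde quotient and the symbols in the denominator of [ablock]. *)
Lemma araw_pair (j k : 'I_n) : (j < k)%N ->
  araw j k * araw k j
  = s (c k - c j + (y k)%:R * eta - (y j)%:R * eta) / s (c k - c j)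
  * ((spoch (c k - c j - (m j)%:R * eta) (y k) / spoch (c k - c j + eta) (y k))
  * (spoch (c j - c k - (m k)%:R * eta) (y j) / spoch (c j - c k + eta) (y j))).
Proof.
move=> ltjk; have jk : j != k by apply: contraTneq ltjk => ->; rewrite ltnn.
have kj : k != j by rewrite eq_sym.
have := block_vandermonde eta sN (c k - c j) (y j) (y k); rewrite opprB.
rewrite /araw !big_mkord !big_split /= !prodfV !araw_num.
have n1 : \prod_(i < y j) s (c k - c j + (y k)%:R * eta - i%:R * eta) != 0.
  apply/prodf_neq0 => i _; apply: diff_neq0 => //.
  by have := ym j; have := ltn_ord i; lia.
have n2 : \prod_(i < y k) s (c j - c k + (y j)%:R * eta - i%:R * eta) != 0.
  apply/prodf_neq0 => i _; apply: diff_neq0 => //.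
  by have := ym k; have := ltn_ord i; lia.
move: n1 n2 (nzd0 jk) (spoch_diff_neq0 j k) (spoch_diff_neq0 k j).
have n3 := diff_neq0 jk (ym k) (ym j); move: n3 (sgnM (y j)) (sgnM (y k)).
set X1 := \prod_(i < y j) _; set X2 := \prod_(i < y k) _.
set X3 := s (c k - c j + _ - _); set X4 := s (c k - c j).
set Y1 := spoch (c k - c j + eta) _; set Y2 := spoch (c j - c k + eta) _.
set e1 := (-1) ^+ y j; set e2 := (-1) ^+ y k.
move: (spoch _ _) (spoch _ _) => Z1 Z2.
move=> x3 s1 s2 x1 x2 x4 y1 y2 E.
have e10 : e1 != 0 by rewrite signr_eq0.
have e20 : e2 != 0 by rewrite signr_eq0.
have -> : X4 = X1 * X2 * X3 * e1 * e2 / (Y1 * Y2).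
  apply: (mulIf (mulf_neq0 y1 y2)); rewrite mulfVK ?mulf_neq0 // E.
  by rewrite -[LHS]mul1r -s2; ring.
rewrite -[RHS]mul1r -s1 -[RHS]mul1r -s2.
by field; rewrite ?x1 ?x2 ?x3 ?y1 ?y2 ?e10 ?e20.
Qed.

Lemma araw_diag j : araw j j = (-1) ^+ y j
  * (spoch (c j - c j - (m j)%:R * eta) (y j) / spoch (c j - c j + eta) (y j)).
Proof.
rewrite /araw big_mkord big_split /= prodfV araw_num -mulrA; congr (_ * (_ * _^-1)).
rewrite /shifted_poch (reindex_inj rev_ord_inj) /=; apply: eq_bigr => i _; congr s.
by rewrite subrr natrB // -natr1; ring.
Qed.

Lemma prod_araw : \prod_(j < n) \prod_(k < n) araw j k
  = (-1) ^+ (\sum_(k < n) y k) * vand * ablock.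
Proof.
pose ab j k := spoch (c k - c j - (m j)%:R * eta) (y k) / spoch (c k - c j + eta) (y k).
rewrite prod_square /ablock (prod_square ab).
have -> : \prod_(j < n) araw j j = (-1) ^+ (\sum_(k < n) y k) * \prod_(j < n) ab j j.
  by rewrite -prodrXr -big_split; apply: eq_bigr => j _; rewrite araw_diag.
have -> : \prod_(j < n) \prod_(k < n | (j < k)%N) (araw j k * araw k j)
   = vand * \prod_(j < n) \prod_(k < n | (j < k)%N) (ab j k * ab k j).
  rewrite /vand -big_split; apply: eq_bigr => j _; rewrite -big_split.
  by apply: eq_bigr => k jk; rewrite araw_pair.
by ring.
Qed.

Definition wcell (i : cells) := c (tag i) + (tagged i)%:R * eta.

Let wf j t := if (t < y j)%N then - (c j + t%:R * eta) else c j + t%:R * eta.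

(** The value at y = 0 of the pair factors and of the diagonal factors, when no point is
    reversed. *)
Definition c0block :=
  \prod_(j < n) (spoch (c j + c j) (m j))^-1
  * \prod_(j < n) \prod_(k < n | (j < k)%N)
      (spoch (c j + c k + (m k)%:R * eta) (m j) / spoch (c j + c k) (m j)).

Lemma prod_wf b j : generic (c j + b) ->
  \prod_(0 <= t < m j) s (wf j t + b)
  = (-1) ^+ y j * (spoch (c j - b) (y j) / spoch (c j + b) (y j)) * spoch (c j + b) (m j).
Proof.
move=> gb; rewrite (big_cat_nat _ (n := y j)) //=.
have -> : \prod_(0 <= t < y j) s (wf j t + b) = (-1) ^+ y j * spoch (c j - b) (y j).
  rewrite -(prodN (y j) (fun i => s (c j - b + i%:R * eta))) big_mkord.
  by apply: eq_bigr => i _; rewrite /wf ltn_ord -sN; congr s; ring.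
have -> : spoch (c j + b) (m j) = spoch (c j + b) (y j) * \prod_(y j <= t < m j) s (wf j t + b).
  rewrite /shifted_poch -!(big_mkord xpredT (fun i => s (c j + b + i%:R * eta))).
  rewrite (big_cat_nat _ (n := y j)) //=; congr (_ * _); apply: eq_big_nat => t /andP[yt _].
  by rewrite /wf ltnNge yt /=; congr s; ring.
by field; apply: spoch_neq0.
Qed.

Lemma cterm_seg g :
  cterm s eta (@cell_lt n m) g setT wcell (seg m y)
  = (-1) ^+ (\sum_(k < n) y k) * (\prod_(j < n) \prod_(k < n) araw j k)
    * (c0block * cblock) * \prod_(j < n) \prod_(0 <= t < m j) g (wf j t).
Proof.
have fl i : flip wcell (seg m y) i = wf (tag i) (tagged i) by rewrite /flip inE.
pose G j t k t' := P (wf j t) (wf k t').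
rewrite /cterm (pairs_cells (G := G)); last by move=> i j; rewrite !fl.
have -> : \prod_(k in [set: cells]) (g (flip wcell (seg m y) k)
      / s (flip wcell (seg m y) k + flip wcell (seg m y) k))
  = \prod_(j < n) \prod_(0 <= t < m j) (g (wf j t) / s (wf j t + wf j t)).
  rewrite -(@prod_cells n m _ (fun j t => g (wf j t) / s (wf j t + wf j t))).
  by apply: eq_big => [i|i _]; rewrite ?inE ?fl.
have -> : \prod_(j < n) \prod_(0 <= t < m j) (g (wf j t) / s (wf j t + wf j t))
  = \prod_(j < n) (\prod_(0 <= t < m j) (s (wf j t + wf j t))^-1)
    * \prod_(j < n) \prod_(0 <= t < m j) g (wf j t).
  rewrite -big_split; apply: eq_bigr => j _; rewrite -big_split.
  by apply: eq_bigr => t _; rewrite mulrC.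
rewrite mulrA; congr (_ * _).
pose f j k i := s (c j + c k - eta + i%:R * eta).
have f0 j k i : f j k i != 0.
  by apply: (generic_at (i := i%:Z - 1) _ (gcc j k)); rewrite intrD -pmulrn; ring.
(* The shares of a single cluster, [Cd], and of a pair of clusters, [Cp], in [c0block * cblock]. *)
pose Cd j := (spoch (c j + c j) (m j))^-1 * (f j j (y j + y j)%N / f j j 0%N
   * (spoch (c j + c j - eta) (y j) / spoch (c j + c j + (m j)%:R * eta) (y j))).
pose Cp j k := spoch (c j + c k + (m k)%:R * eta) (m j) / spoch (c j + c k) (m j)
   * (f j k (y j + y k)%N / f j k 0%N
   * (spoch (c j + c k - eta) (y k) * spoch (c j + c k - eta) (y j)
      / (spoch (c j + c k + (m j)%:R * eta) (y k) * spoch (c j + c k + (m k)%:R * eta) (y j)))).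
have rE j k a l : rng (f j k) a (a + l) = spoch (c j + c k - eta + a%:R * eta) l.
  exact: rng_spoch.
have r0E j k l : rng (f j k) 0 l = spoch (c j + c k - eta) l.
  by have := rE j k 0%N l; rewrite add0n mul0r addr0.
have r1E j k l a : rng (f j k) (1 + a) (1 + a + l) = spoch (c j + c k + a%:R * eta) l.
  by rewrite rE; congr spoch; rewrite natrD; ring.
have r11E j k l : rng (f j k) 1 (1 + l) = spoch (c j + c k) l.
  by have := r1E j k l 0%N; rewrite mul0r addr0.
have dg j : (\prod_(0 <= i < m j) \prod_(0 <= j0 < m j | (i < j0)%N) G j i j j0)
    * \prod_(0 <= t < m j) (s (wf j t + wf j t))^-1 = (-1) ^+ y j * araw j j * Cd j.
  rewrite (diag_block sN (ym j) (f0 j j)); last by move=> k l lk km; apply: diff_neq0_diag km.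
  rewrite (block_diag (ym j) (f0 j j)) -/(f j j) r11E r0E r1E; congr (_ * _ * _).
  by apply: eq_bigr => i _; rewrite subrr !add0r.
have pr (j k : 'I_n) : (j < k)%N ->
    \prod_(0 <= i < m j) \prod_(0 <= i' < m k) G j i k i'
    = araw j k * araw k j * Cp j k.
  move=> ltjk; have jk : j != k by apply: contraTneq ltjk => ->; rewrite ltnn.
  rewrite (pair_block sN (ym j) (ym k) (f0 j k)); first last.
  - by move=> u v um vm; rewrite opprB; apply: diff_neq0; rewrite ?(ltnW vm) // eq_sym.
  - by move=> u v um vm; apply: diff_neq0; rewrite ?(ltnW vm).
  by rewrite (block_pair (ym j) (ym k) (f0 j k)) -/(f j k) r11E !r0E !r1E !opprB.
rewrite mulrAC -big_split /=.
rewrite (eq_bigr _ (fun j _ => dg j)).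
have -> : \prod_(j < n) \prod_(k < n | (j < k)%N) \prod_(0 <= i < m j) \prod_(0 <= i' < m k) G j i k i'
   = \prod_(j < n) \prod_(k < n | (j < k)%N) (araw j k * araw k j)
     * \prod_(j < n) \prod_(k < n | (j < k)%N) Cp j k.
  rewrite -big_split; apply: eq_bigr => j _; rewrite -big_split.
  by apply: eq_bigr => k jk; rewrite pr.
have -> : \prod_(j < n) ((-1) ^+ y j * araw j j * Cd j)
   = (-1) ^+ (\sum_(k < n) y k) * \prod_(j < n) araw j j * \prod_(j < n) Cd j.
  by rewrite -prodrXr -!big_split.
rewrite (prod_square araw).
pose u j k := f j k (y j + y k)%N / f j k 0%N.
pose v j k := spoch (c j + c k - eta) (y k) / spoch (c j + c k + (m j)%:R * eta) (y k).
have -> : c0block * cblock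
   = \prod_(j < n) Cd j * \prod_(j < n) \prod_(k < n | (j < k)%N) Cp j k.
  have -> : cblock = (\prod_(j < n) \prod_(k < n | (j <= k)%N) u j k)
      * \prod_(j < n) \prod_(k < n) v j k.
    congr (_ * _); apply: eq_bigr => j _; apply: eq_bigr => k _.
    by rewrite /u /f mul0r addr0.
  have -> : \prod_(j < n) Cd j
      = \prod_(j < n) (spoch (c j + c j) (m j))^-1 * (\prod_(j < n) u j j * \prod_(j < n) v j j).
    by rewrite -!big_split.
  have -> : \prod_(j < n) \prod_(k < n | (j < k)%N) Cp j k
      = \prod_(j < n) \prod_(k < n | (j < k)%N)
        (spoch (c j + c k + (m k)%:R * eta) (m j) / spoch (c j + c k) (m j))
      * (\prod_(j < n) \prod_(k < n | (j < k)%N) u j k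
        * \prod_(j < n) \prod_(k < n | (j < k)%N) (v j k * v k j)).
    rewrite -!big_split; apply: eq_bigr => j _; rewrite -!big_split.
    apply: eq_bigr => k _ /=; rewrite /Cp /u /v [c k + c j]addrC; congr (_ * (_ * _)).
    by rewrite mulf_div.
  rewrite (prod_triangle u) (prod_square v) /c0block; ring.
ring.
Qed.
End Clusters.

(** Again one interval, from 0 to 1 + m + r, cut in two ways. Here [r] will be the total |y|, which
    enters the denominators of [rterm] through [#|T|]. *)
Lemma block_shifted (F : fieldType) (h : nat -> F) r y m : (y <= m)%N ->
  (forall i, h i != 0) ->
  (rng h r (r + y))^-1 / rng h (r + y).+1 (r + m).+1
  = h (y + r)%N / h 0%N * (rng h 0 r / rng h (1 + m) (1 + m + r)) / rng h 1 (1 + m).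
Proof.
move=> ym h0; have R a b := rng_neq0 a b h0.
have e2 : h 0%N * rng h 1 (1 + m) * rng h (1 + m) (1 + m + r)
   = rng h 0 r * rng h r (r + y) * h (y + r)%N * rng h (r + y).+1 (r + m).+1.
  have -> : ((r + m).+1 = 1 + m + r)%N by lia.
  by rewrite [(y + r)%N]addnC -(rng1 h 0) -(rng1 h (r + y)) -!rng_cat //; lia.
have -> : rng h (1 + m) (1 + m + r) = rng h 0 r * rng h r (r + y) * h (y + r)%N
    * rng h (r + y).+1 (r + m).+1 / (h 0%N * rng h 1 (1 + m)).
  by rewrite -e2; field; rewrite R h0.
by field; rewrite ?R ?h0.
Qed.

Section Segments.
Variables (F : comNzRingType) (n : nat) (m y : 'I_n -> nat).
Hypothesis ym : forall k, (y k <= m k)%N.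
Local Notation cells := {k : 'I_n & 'I_(m k)}.

Lemma prod_seg (G : 'I_n -> nat -> F) :
  \prod_(i in seg m y) G (tag i) (tagged i) = \prod_(j < n) \prod_(0 <= t < y j) G j t.
Proof.
transitivity (\prod_(j < n) \prod_(0 <= t < m j | (t < y j)%N) G j t).
  rewrite -(@prod_cells_cond n m F (fun j t => (t < y j)%N) G).
  by apply: eq_bigl => i; rewrite inE.
by apply: eq_bigr => j _; rewrite [RHS](big_nat_widen _ _ (m j)).
Qed.

Lemma prod_segC (G : 'I_n -> nat -> F) :
  \prod_(i in [set: cells] :\: seg m y) G (tag i) (tagged i)
  = \prod_(j < n) \prod_(y j <= t < m j) G j t.
Proof.
transitivity (\prod_(j < n) \prod_(0 <= t < m j | (y j <= t)%N) G j t).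
  rewrite -(@prod_cells_cond n m F (fun j t => (y j <= t)%N) G).
  by apply: eq_bigl => i; rewrite !inE andbT -leqNgt.
by apply: eq_bigr => j _; rewrite [RHS](big_nat_widenl _ 0).
Qed.
End Segments.

(** * The term of the right side at an initial segment *)

Section RightTerm.
Variables (F : numFieldType) (s : F -> F) (eta : F).
Hypothesis sN : forall u, s (- u) = - s u.
Variables (n : nat) (m : 'I_n -> nat) (c : 'I_n -> F).
Local Notation cells := {k : 'I_n & 'I_(m k)}.
Local Notation spoch := (shifted_poch s eta).
Local Notation generic := (generic s eta).

Hypothesis nzd : forall j k i, (1 <= i <= m k)%N -> s (c k - c j + i%:R * eta) != 0.
Hypothesis nzd0 : forall j k, j != k -> s (c k - c j) != 0.
Variable y : 'I_n -> nat.
Hypothesis ym : forall k, (y k <= m k)%N.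
Variables b1 b2 b3 b4 b5 b6 : F.
Let B := b1 + b2 + b3.
Hypothesis g1 : forall k, generic (c k + b1).
Hypothesis g2 : forall k, generic (c k + b2).
Hypothesis g3 : forall k, generic (c k + b3).
Hypothesis gB : forall k, generic (c k + B).
Hypothesis g4 : generic (B + b4).
Hypothesis g5 : generic (B + b5).
Hypothesis g6 : generic (B + b6).
Let N := (\sum_(k < n) m k)%N.
Let r := (\sum_(k < n) y k)%N.

Let rN : (r <= N)%N. Proof. exact: leq_sum. Qed.

Definition rconst := spoch (B + b4) N * spoch (B + b5) N * spoch (B + b6) N
  * \prod_(j < n) (spoch (c j + b1) (m j) * spoch (c j + b2) (m j) * spoch (c j + b3) (m j)
          / spoch (c j + B) (m j)).

(** The logarithm of lambda b / a is [B - b1 = b2 + b3], and similarly for c and d, whence the sums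
    of two parameters. *)
Definition rsummand := vand s eta c y
  * (\prod_(k < n) (s (c k + B - eta + (y k + r)%:R * eta) / s (c k + B - eta)))
  * (spoch (b2 + b3) r * spoch (b1 + b3) r * spoch (b1 + b2) r
     / (spoch (B + b4) r * spoch (B + b5) r * spoch (B + b6) r))
  * (\prod_(j < n) (spoch (c j + B - eta) r / spoch (c j + B + (m j)%:R * eta) r))
  * (\prod_(k < n) (spoch (c k - b4) (y k) * spoch (c k - b5) (y k) * spoch (c k - b6) (y k)
     / (spoch (c k + b1) (y k) * spoch (c k + b2) (y k) * spoch (c k + b3) (y k))))
  * ablock s eta m c y.

Lemma prod_upper x u k : (u <= k)%N -> generic x ->
  \prod_(u <= l < k) s (x + l%:R * eta) = spoch x k / spoch x u.
Proof.
move=> uk gx; have nz : spoch x u != 0 by exact: spoch_neq0.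
apply: (mulIf nz); rewrite mulfVK // mulrC /shifted_poch.
rewrite -!(big_mkord xpredT (fun i => s (x + i%:R * eta))).
by rewrite [RHS](big_cat_nat _ (n := u)).
Qed.

(** For a fixed element of [T] in cluster [j] the factors telescope along the positions of cluster
    [k] outside [T], including the case [k = j]. *)
Lemma rterm_mixed :
  \prod_(j in seg m y) \prod_(k in [set: cells] :\: seg m y)
     (s (wcell eta c k - wcell eta c j + eta) / s (wcell eta c k - wcell eta c j))
  = \prod_(j < n) \prod_(k < n) araw s eta m c y j k.
Proof.
have inner (j : cells) : \prod_(k in [set: cells] :\: seg m y)
     (s (wcell eta c k - wcell eta c j + eta) / s (wcell eta c k - wcell eta c j))
   = \prod_(k < n) \prod_(y k <= t < m k)
       (s (c k + t%:R * eta - (c (tag j) + (tagged j)%:R * eta) + eta)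
        / s (c k + t%:R * eta - (c (tag j) + (tagged j)%:R * eta))).
  rewrite -(@prod_segC _ n m y (fun k t => s (c k + t%:R * eta - (c (tag j) + (tagged j)%:R * eta) + eta)
        / s (c k + t%:R * eta - (c (tag j) + (tagged j)%:R * eta)))).
  by apply: eq_bigr.
rewrite (eq_bigr _ (fun j _ => inner j)).
rewrite (prod_seg ym (fun j i => \prod_(k < n) \prod_(y k <= t < m k)
       (s (c k + t%:R * eta - (c j + i%:R * eta) + eta) / s (c k + t%:R * eta - (c j + i%:R * eta))))).
apply: eq_bigr => j _; rewrite exchange_big /=; apply: eq_bigr => k _.
rewrite /araw; apply: eq_big_nat => i /andP[_ iy].
have im : (i < m j)%N by apply: leq_trans (ym j).
rewrite -(telescope_prod (f := fun t => s (c k - c j + t%:R * eta - i%:R * eta)) (ym k)).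
  by apply: eq_big_nat => t _; congr (s _ / s _); rewrite -?natr1; ring.
move=> t /andP[yt tm]; have [jk|jk] := eqVneq j k.
  rewrite jk subrr add0r; rewrite -jk in tm yt *.
  by apply: (@diff_neq0_diag _ _ _ _ m c nzd j); rewrite // (leq_trans iy).
by apply: (@diff_neq0 _ _ _ sN _ m c nzd nzd0 j k); rewrite // ltnW.
Qed.

Lemma rterm_seg :
  rterm s eta b1 b2 b3 N b4 b5 b6 [set: cells] (wcell eta c) (seg m y) = rconst * rsummand.
Proof.
rewrite /rterm (card_seg ym) -/r rterm_mixed (prod_araw sN nzd nzd0 ym) -/r /wcell.
rewrite (prod_seg ym (fun j t => s (b4 - (c j + t%:R * eta)) * s (b5 - (c j + t%:R * eta))
  * s (b6 - (c j + t%:R * eta)) / s (c j + t%:R * eta + B - eta + r%:R * eta))).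
rewrite (@prod_segC _ n m y (fun j t => s (c j + t%:R * eta + b1) * s (c j + t%:R * eta + b2)
  * s (c j + t%:R * eta + b3) / s (c j + t%:R * eta + B + r%:R * eta))).
have -> : \prod_(l < r) (s (b1 + b2 + l%:R * eta) * s (b1 + b3 + l%:R * eta)
          * s (b2 + b3 + l%:R * eta))
   = spoch (b1 + b2) r * spoch (b1 + b3) r * spoch (b2 + b3) r.
  by rewrite !big_split.
have -> : \prod_(r <= l < N) (s (B + b4 + l%:R * eta) * s (B + b5 + l%:R * eta)
          * s (B + b6 + l%:R * eta))
   = spoch (B + b4) N / spoch (B + b4) r * (spoch (B + b5) N / spoch (B + b5) r)
     * (spoch (B + b6) N / spoch (B + b6) r).
  by rewrite !big_split /= !prod_upper.
pose h j i := s (c j + B - eta + i%:R * eta).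
have h0 j i : h j i != 0.
  by apply: (generic_at (i := i%:Z - 1) _ (gB j)); rewrite intrD -pmulrn; ring.
have rE j a l : rng (h j) a (a + l) = spoch (c j + B - eta + a%:R * eta) l.
  exact: rng_spoch.
have lowE j b : \prod_(0 <= t < y j) s (b - (c j + t%:R * eta)) = (-1) ^+ y j * spoch (c j - b) (y j).
  rewrite -(prodN (y j) (fun i => s (c j - b + i%:R * eta))) big_mkord.
  by apply: eq_bigr => i _; rewrite -sN; congr s; ring.
(* The factors of cluster [j] inside and outside [T] must be taken together: only jointly do their
   denominators fill the intervals of [block_shifted]. The sign cancels against that of
   [prod_araw]. *)
have key j : \prod_(0 <= t < y j) (s (b4 - (c j + t%:R * eta)) * s (b5 - (c j + t%:R * eta))
     * s (b6 - (c j + t%:R * eta)) / s (c j + t%:R * eta + B - eta + r%:R * eta))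
   * \prod_(y j <= t < m j) (s (c j + t%:R * eta + b1) * s (c j + t%:R * eta + b2)
     * s (c j + t%:R * eta + b3) / s (c j + t%:R * eta + B + r%:R * eta))
   = (-1) ^+ y j
     * (spoch (c j + b1) (m j) * spoch (c j + b2) (m j) * spoch (c j + b3) (m j) / spoch (c j + B) (m j))
     * (s (c j + B - eta + (y j + r)%:R * eta) / s (c j + B - eta))
     * (spoch (c j + B - eta) r / spoch (c j + B + (m j)%:R * eta) r)
     * (spoch (c j - b4) (y j) * spoch (c j - b5) (y j) * spoch (c j - b6) (y j)
     / (spoch (c j + b1) (y j) * spoch (c j + b2) (y j) * spoch (c j + b3) (y j))).
  rewrite !big_split /= !prodfV !lowE.
  have up b : generic (c j + b) -> \prod_(y j <= t < m j) s (c j + t%:R * eta + b)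
      = spoch (c j + b) (m j) / spoch (c j + b) (y j).
    move=> gb; rewrite -prod_upper //; apply: eq_big_nat => t _; congr s; ring.
  rewrite !up //.
  have -> : \prod_(0 <= t < y j) s (c j + t%:R * eta + B - eta + r%:R * eta) = rng (h j) r (r + y j).
    rewrite -(@rng_shift _ (h j) (fun i => h j (r + i)%N)) // big_mkord.
    by apply: eq_bigr => t _; rewrite /h natrD; congr s; ring.
  have -> : \prod_(y j <= t < m j) s (c j + t%:R * eta + B + r%:R * eta)
      = rng (h j) (r + y j).+1 (r + m j).+1.
    have sh a : \prod_(y j <= i < m j) h j (a + i)%N = rng (h j) (a + y j) (a + m j).
      by rewrite /rng [(a + y j)%N]addnC big_addn addKn; apply: eq_bigr => i _; rewrite addnC.
    rewrite -!addSn -sh; apply: eq_big_nat => t _.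
    by rewrite /h addSn -natr1 natrD; congr s; ring.
  have bs := block_shifted r (ym j) (h0 j).
  have -> : spoch (c j + B - eta) r = rng (h j) 0 r.
    by rewrite -[X in rng _ _ X]add0n rE mul0r addr0.
  have -> : spoch (c j + B + (m j)%:R * eta) r = rng (h j) (1 + m j) (1 + m j + r).
    by rewrite rE natrD; congr spoch; ring.
  have -> : spoch (c j + B) (m j) = rng (h j) 1 (1 + m j).
    by rewrite rE; congr spoch; ring.
  have -> : s (c j + B - eta) = h j 0%N by rewrite /h mul0r addr0.
  rewrite -/(h j (y j + r)%N).
  move: bs; set D1 := (rng (h j) r _)^-1; set D2 := (rng (h j) (r + y j).+1 _)^-1.
  set H := h j (y j + r)%N; set H0 := (h j 0%N)^-1; set D3 := rng (h j) 0 r.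
  set D4 := (rng (h j) (1 + m j) _)^-1; set D5 := (rng (h j) 1 _)^-1 => bs.
  set e := (-1) ^+ y j.
  have e2 : e * e = 1 by rewrite /e -expr2 sqrr_sign.
  rewrite !invfM.
  move: (spoch _ _)^-1 (spoch _ _)^-1 (spoch _ _)^-1 => w1 w2 w3.
  move: (spoch _ _) (spoch _ _) (spoch _ _) (spoch _ _) (spoch _ _) (spoch _ _) => z1 z2 z3 z4 z5 z6.
  transitivity ((e * e) * e * (D1 * D2) * (z1 * z2 * z3) * (z4 * z5 * z6) * (w1 * w2 * w3)).
    by ring.
  by rewrite e2 bs; ring.
set PX := \prod_(j < n) \prod_(0 <= t < y j) _.
set PY := \prod_(j < n) \prod_(y j <= t < m j) _.
have PXY : PX * PY = (-1) ^+ r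
    * \prod_(j < n) (spoch (c j + b1) (m j) * spoch (c j + b2) (m j) * spoch (c j + b3) (m j)
          / spoch (c j + B) (m j))
    * \prod_(j < n) (s (c j + B - eta + (y j + r)%:R * eta) / s (c j + B - eta))
    * \prod_(j < n) (spoch (c j + B - eta) r / spoch (c j + B + (m j)%:R * eta) r)
    * \prod_(j < n) (spoch (c j - b4) (y j) * spoch (c j - b5) (y j) * spoch (c j - b6) (y j)
     / (spoch (c j + b1) (y j) * spoch (c j + b2) (y j) * spoch (c j + b3) (y j))).
  by rewrite -prodrXr -!big_split; apply: eq_bigr => j _; exact: key.
rewrite -mulrA PXY /rconst /rsummand {PX PY PXY key}.
set k1 := \prod_(j < n) _; set k2 := \prod_(j < n) _; set k3 := \prod_(j < n) _.
set k4 := \prod_(j < n) _; set e := (-1) ^+ r.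
have e2 : e * e = 1 by rewrite /e -expr2 sqrr_sign.
rewrite !invfM.
transitivity ((e * e) * (spoch (b1 + b2) r * spoch (b1 + b3) r * spoch (b2 + b3) r *
 (spoch (B + b4) N / spoch (B + b4) r * (spoch (B + b5) N / spoch (B + b5) r)
     * (spoch (B + b6) N / spoch (B + b6) r)) * (vand s eta c y * ablock s eta m c y)
  * (k1 * k2 * k3 * k4))); first by ring.
by rewrite e2; ring.
Qed.
End RightTerm.

(** * The identity for an odd function with a three-term relation *)

Section OddForm.
Variables (F : numFieldType) (s : F -> F) (eta : F).
Hypothesis sN : forall u, s (- u) = - s u.
Hypothesis s_plucker : forall x y u v,
  hs s x y * hs s u v - hs s x u * hs s y v + hs s x v * hs s y u = 0.
Variables (n : nat) (m : 'I_n -> nat) (c : 'I_n -> F).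
Local Notation cells := {k : 'I_n & 'I_(m k)}.
Local Notation spoch := (shifted_poch s eta).
Local Notation generic := (generic s eta).
Hypothesis nzd : forall j k i, (1 <= i <= m k)%N -> s (c k - c j + i%:R * eta) != 0.
Hypothesis nzd0 : forall j k, j != k -> s (c k - c j) != 0.
Variables b1 b2 b3 b4 b5 b6 : F.
Let B := b1 + b2 + b3.
Let N := (\sum_(k < n) m k)%N.
Hypothesis bal : B + b4 + b5 + b6 + N%:R * eta = eta.
Hypothesis gcc : forall j k, generic (c j + c k).
Hypothesis gb : forall k b, b \in [:: b1; b2; b3; b4; b5; b6] -> generic (c k + b).
Hypothesis gB : forall k, generic (c k + B).
Hypothesis gBb : forall b, b \in [:: b4; b5; b6] -> generic (B + b).
Hypothesis g12 : forall j k, generic (c j + c k - (b1 + b2)).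
Hypothesis g12' : forall j k, generic (c j - c k - (b1 + b2)).
Hypothesis g45 : forall j k, generic (c j + c k - (b4 + b5)).

Local Notation plus6 k l := (spoch (c k + b1) l * spoch (c k + b2) l * spoch (c k + b3) l
  * spoch (c k + b4) l * spoch (c k + b5) l * spoch (c k + b6) l).
Local Notation minus6 k l := (spoch (c k - b1) l * spoch (c k - b2) l * spoch (c k - b3) l
  * spoch (c k - b4) l * spoch (c k - b5) l * spoch (c k - b6) l).

Definition lsummand y := vand s eta c y * cblock s eta m c y * ablock s eta m c y
  * \prod_(k < n)
   (minus6 k (y k) / (plus6 k (y k))).

Definition lconst := c0block s eta m c * \prod_(k < n)
   (plus6 k (m k)).

Lemma cterm_seg_six y : (forall k, (y k <= m k)%N) ->
  cterm s eta (@cell_lt n m) (fun x => s (x + b4) * (s (x + b5) * (s (x + b6)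
          * (s (x + b1) * s (x + b2) * s (x + b3)))))
     setT (wcell eta c) (seg m y) = lconst * lsummand y.
Proof.
move=> ym; have G b k : b \in [:: b1; b2; b3; b4; b5; b6] -> generic (c k + b) by exact: gb.
rewrite (cterm_seg sN gcc nzd nzd0 ym) (prod_araw sN nzd nzd0 ym).
set r := (\sum_(k < n) y k)%N.
have -> : \prod_(j < n) \prod_(0 <= t < m j)
   (let x := if (t < y j)%N then - (c j + t%:R * eta) else c j + t%:R * eta in
    s (x + b4) * (s (x + b5) * (s (x + b6) * (s (x + b1) * s (x + b2) * s (x + b3)))))
  = \prod_(k < n)
   (plus6 k (m k))
   * \prod_(k < n)
   (minus6 k (y k) / (plus6 k (y k))).
  rewrite -big_split; apply: eq_bigr => j _ /=.
  rewrite !big_split /= !(prod_wf sN ym); do ?[by apply: G; rewrite !inE eqxx ?orbT].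
  set e := (-1) ^+ y j; have e2 : e * e = 1 by rewrite /e -expr2 sqrr_sign.
  rewrite !invfM.
  move: (spoch _ _)^-1 (spoch _ _)^-1 (spoch _ _)^-1 (spoch _ _)^-1 (spoch _ _)^-1 (spoch _ _)^-1 => w1 w2 w3 w4 w5 w6.
  move: (spoch _ _) (spoch _ _) (spoch _ _) (spoch _ _) (spoch _ _) (spoch _ _) => z1 z2 z3 z4 z5 z6.
  move: (spoch _ _) (spoch _ _) (spoch _ _) (spoch _ _) (spoch _ _) (spoch _ _) => t1 t2 t3 t4 t5 t6.
  transitivity ((e * e) * (e * e) * (e * e) * (z1 * z2 * z3 * z4 * z5 * z6) * (t1 * t2 * t3 * t4 * t5 * t6) * (w1 * w2 * w3 * w4 * w5 * w6)).
    by ring.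
  by rewrite e2; ring.
rewrite /lconst /lsummand.
set e := (-1) ^+ r; have e2 : e * e = 1 by rewrite /e -expr2 sqrr_sign.
transitivity ((e * e) * (vand s eta c y * ablock s eta m c y * (c0block s eta m c * cblock s eta m c y) *
  (\prod_(k < n)
   (plus6 k (m k))
   * \prod_(k < n)
   (minus6 k (y k) / (plus6 k (y k)))))).
  by ring.
by rewrite e2; ring.
Qed.

(** If a point is reversed and its predecessor is not, their pair factor has numerator [s 0]. *)
Lemma cterm_not_seg g (S : {set cells}) : (exists i j : cells, [/\ i \in S, j \notin S, tag i = tag j
    & (tagged i : nat) = (tagged j).+1]) ->
  cterm s eta (@cell_lt n m) g setT (wcell eta c) S = 0.
Proof.
move=> [i [j [iS jS tij st]]].
have tij' : tag i == tag j by rewrite tij.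
have ct : c (tag i) = c (tag j) by rewrite tij.
rewrite /cterm /pairs (bigD1 j) ?inE //=.
rewrite (bigD1 i) /=; last by rewrite inE /cell_lt [tag j == _]eq_sym tij' st ltnSn orbT.
rewrite /flip iS (negbTE jS) /wcell ct st -natr1.
have -> : c (tag j) + (tagged j)%:R * eta + - (c (tag j) + ((tagged j)%:R + 1) * eta) + eta = 0.
  by ring.
by rewrite (s_zero sN) !mul0r.
Qed.

(** As on the left, a gap produces a mixed factor with numerator [s 0]. *)
Lemma rterm_not_seg (S : {set cells}) : (exists i j : cells, [/\ i \in S, j \notin S, tag i = tag j
    & (tagged i : nat) = (tagged j).+1]) ->
  rterm s eta b1 b2 b3 N b4 b5 b6 [set: cells] (wcell eta c) S = 0.
Proof.
move=> [i [j [iS jS tij st]]].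
have tij' : tag i == tag j by rewrite tij.
have ct : c (tag i) = c (tag j) by rewrite tij.
rewrite /rterm [X in _ * X * _ * _](bigD1 i) //=.
rewrite [X in _ * (X * _) * _ * _](bigD1 j) /=; last by rewrite !inE jS.
rewrite /wcell ct st -natr1.
have -> : c (tag j) + (tagged j)%:R * eta - (c (tag j) + ((tagged j)%:R + 1) * eta) + eta = 0.
  by ring.
by rewrite (s_zero sN) !(mul0r, mulr0).
Qed.

Definition prefactor :=
  (\prod_(j < n) \prod_(k < n) spoch (c j + c k) (m k))
  / (\prod_(j < n) \prod_(k < n | (j < k)%N) spoch (c j + c k) (m j + m k))
  * (spoch (B + b4) N * spoch (B + b5) N * spoch (b4 + b5) N
     / \prod_(k < n) (spoch (c k + B) (m k) * spoch (c k + b4) (m k) * spoch (c k + b5) (m k)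
          * spoch (eta - (m k)%:R * eta - (c k + b6)) (m k))).

(** The constants of the two sides are compared by reversing Pochhammer symbols, [rv], by balancing
    for the symbol in [b4 + b5], and by [E1], which identifies [c0block] as the inverse of the
    quotient of symbols in [c j + c k]. *)
Lemma prefactorE : lconst * prefactor = rconst s eta m c b1 b2 b3 b4 b5 b6.
Proof.
have G b k l : b \in [:: b1; b2; b3; b4; b5; b6] -> spoch (c k + b) l != 0.
  by move=> hb; apply/spoch_neq0/gb.
have Gc j k l : spoch (c j + c k) l != 0 by apply/spoch_neq0/gcc.
have Gc' j k a l : spoch (c j + c k + a%:R * eta) l != 0.
  by apply: spoch_neq0; apply: (generic_shift (i := a%:Z) _ (gcc j k)); rewrite -pmulrn.
have rv x k : spoch (eta - k%:R * eta - x) k = (-1) ^+ k * spoch x k.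
  rewrite -(prodN k (fun i => s (x + i%:R * eta))) /shifted_poch (reindex_inj rev_ord_inj) /=.
  by apply: eq_bigr => i _; rewrite -sN natrB // -natr1; congr s; ring.
have e45 : spoch (b4 + b5) N = (-1) ^+ N * spoch (B + b6) N.
  by rewrite -rv; congr spoch; apply: (eq_lin bal); ring.
have E1 : c0block s eta m c * ((\prod_(j < n) \prod_(k < n) spoch (c j + c k) (m k))
  / (\prod_(j < n) \prod_(k < n | (j < k)%N) spoch (c j + c k) (m j + m k))) = 1.
  rewrite (prod_square (fun j k => spoch (c j + c k) (m k))) /c0block prodfV.
  have -> : \prod_(j < n) \prod_(k < n | (j < k)%N) spoch (c j + c k) (m j + m k)
    = \prod_(j < n) \prod_(k < n | (j < k)%N)
        (spoch (c j + c k + (m k)%:R * eta) (m j) / spoch (c j + c k) (m j))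
      * \prod_(j < n) \prod_(k < n | (j < k)%N)
        (spoch (c j + c k) (m k) * spoch (c k + c j) (m j)).
    rewrite -big_split; apply: eq_bigr => j _; rewrite -big_split.
    apply: eq_bigr => k _ /=; rewrite addnC spochD [c k + c j]addrC.
    by field.
  set X := \prod_(j < n) spoch _ _; set Y := \prod_(j < n) _; set Z := \prod_(j < n) _.
  have X0 : X != 0 by apply/prodf_neq0 => j _.
  have Y0 : Y != 0.
    by apply/prodf_neq0 => j _; apply/prodf_neq0 => k _; rewrite mulf_neq0 ?invr_eq0.
  have Z0 : Z != 0.
    by apply/prodf_neq0 => j _; apply/prodf_neq0 => k _; rewrite mulf_neq0.
  by field; rewrite X0 Y0 Z0.
rewrite /lconst /prefactor /rconst e45.
set D := \prod_(k < n) (spoch (c k + B) _ * _ * _ * _).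
have D0 : D != 0.
  apply/prodf_neq0 => k _; rewrite rv.
  have h4 : spoch (c k + b4) (m k) != 0 by apply: G; rewrite !inE eqxx ?orbT.
  have h5 : spoch (c k + b5) (m k) != 0 by apply: G; rewrite !inE eqxx ?orbT.
  have h6 : spoch (c k + b6) (m k) != 0 by apply: G; rewrite !inE eqxx ?orbT.
  have hB : spoch (c k + B) (m k) != 0 by apply: spoch_neq0; apply: gB.
  by rewrite (mulf_neq0 (mulf_neq0 (mulf_neq0 hB h4) h5)) // mulf_neq0 ?signr_eq0.
have -> : \prod_(k < n)
   (plus6 k (m k))
  = D * ((-1) ^+ N * \prod_(j < n) (spoch (c j + b1) (m j) * spoch (c j + b2) (m j) * spoch (c j + b3) (m j)
          / spoch (c j + B) (m j))).
  rewrite -prodrXr -!big_split; apply: eq_bigr => k _ /=; rewrite rv.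
  have e2 : (-1) ^+ m k * (-1) ^+ m k = 1 :> F by rewrite -expr2 sqrr_sign.
  have nB : spoch (c k + B) (m k) != 0 by exact/spoch_neq0/gB.
  set e := (-1) ^+ m k in e2 *; rewrite -[LHS]mul1r -[X in X * _]e2; clearbody e.
  by field.
set X := \prod_(j < n) (_ / _).
set E := (\prod_(j < n) _) / _ in E1 *.
have e2 : (-1) ^+ N * (-1) ^+ N = 1 :> F by rewrite -expr2 sqrr_sign.
transitivity ((c0block s eta m c * E) * ((-1) ^+ N * (-1) ^+ N)
  * (spoch (B + b4) N * spoch (B + b5) N * spoch (B + b6) N * X)); last first.
  by rewrite E1 e2; ring.
by field.
Qed.

Lemma lconst_neq0 : lconst != 0.
Proof.
rewrite /lconst /c0block !mulf_neq0 //.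
- by apply/prodf_neq0 => j _; rewrite invr_eq0; apply/spoch_neq0/gcc.
- apply/prodf_neq0 => j _; apply/prodf_neq0 => k _; rewrite mulf_neq0 ?invr_eq0 //.
    apply: spoch_neq0; apply: (generic_shift (i := (m k)%:Z) _ (gcc j k)).
    by rewrite -pmulrn.
  exact/spoch_neq0/gcc.
- apply/prodf_neq0 => k _; rewrite !mulf_neq0 //; apply/spoch_neq0/gb;
  by rewrite !inE eqxx ?orbT.
Qed.

(** After multiplication by [lconst] both sides are sums over all sets of cells, the sets with a gap
    contributing zero, and [bailey_C] applies. Its conditions on single points reduce to conditions
    on [c], since a point differs from its [c k] by a multiple of [eta]. *)
Theorem corollary_s :
  \sum_(y : {dffun forall k, 'I_(m k).+1}) lsummand (fun k => y k)
  = prefactor * \sum_(y : {dffun forall k, 'I_(m k).+1})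
       rsummand s eta m c (fun k => y k) b1 b2 b3 b4 b5 b6.
Proof.
apply: (mulfI lconst_neq0); rewrite mulrA prefactorE !mulr_sumr.
have yle (y : {dffun forall k, 'I_(m k).+1}) k : (y k <= m k)%N by rewrite -ltnS.
have -> : \sum_(y : {dffun forall k, 'I_(m k).+1}) lconst * lsummand (fun k => y k)
  = csum s eta (@cell_lt n m) (fun x => s (x + b4) * (s (x + b5) * (s (x + b6)
          * (s (x + b1) * s (x + b2) * s (x + b3))))) setT (wcell eta c).
  rewrite /csum; under [RHS]eq_bigl do rewrite subsetT.
  rewrite sum_seg; last by move=> S; exact: cterm_not_seg.
  by apply: eq_bigr => y _; rewrite cterm_seg_six.
have -> : \sum_(y : {dffun forall k, 'I_(m k).+1})
      rconst s eta m c b1 b2 b3 b4 b5 b6 * rsummand s eta m c (fun k => y k) b1 b2 b3 b4 b5 b6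
  = rsum s eta b1 b2 b3 N b4 b5 b6 [set: cells] (wcell eta c).
  rewrite /rsum; under [RHS]eq_bigl do rewrite subsetT.
  rewrite sum_seg; last by move=> S; exact: rterm_not_seg.
  apply: eq_bigr => y _; rewrite rterm_seg //; do ?[exact: gB
    |by apply: gBb; rewrite !inE eqxx ?orbT
    |by move=> k; apply: gb; rewrite !inE eqxx ?orbT].
have gw (i j : cells) : exists z : int, wcell eta c i + wcell eta c j = c (tag i) + c (tag j) + z%:~R * eta.
  exists ((tagged i)%:Z + (tagged j)%:Z); rewrite /wcell intrD -!pmulrn; ring.
have gw' (i j : cells) : exists z : int, wcell eta c i - wcell eta c j = c (tag i) - c (tag j) + z%:~R * eta.
  exists ((tagged i)%:Z - (tagged j)%:Z); rewrite /wcell intrB -!pmulrn; ring.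
have shift u b v z : u = v + z%:~R * eta -> generic (v + b) -> generic (u + b).
  by move=> -> gu; apply: (generic_shift (i := z) _ gu); ring.
apply: (bailey_C (@cell_lt_irr n m) (@cell_lt_tour n m) sN s_plucker).
- rewrite cardsT /N -(card_seg (m := m) (y := m)) //; apply: eq_card => i.
  by rewrite !inE ltn_ord.
- move=> i j _ _ ij; rewrite /wcell.
  have [tij|tij] := eqVneq (tag i) (tag j); last first.
    have -> : c (tag i) + (tagged i)%:R * eta - (c (tag j) + (tagged j)%:R * eta)
      = c (tag i) - c (tag j) + (tagged i)%:R * eta - (tagged j)%:R * eta by ring.
    apply: (@diff_neq0 _ _ _ sN _ m c nzd nzd0); rewrite 1?eq_sym //;
    by apply: ltnW.
  have : (tagged i : nat) != tagged j.
    apply: contraNneq ij => st; apply/eqP; case: i j tij st => [k s1] [l s2] /= tij.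
    by move: s1 s2; rewrite tij => s1 s2 st; congr existT; apply: val_inj.
  have ct : c (tag i) = c (tag j) by rewrite tij.
  have mt : m (tag i) = m (tag j) by rewrite tij.
  have := ltn_ord (tagged i); rewrite {2}mt; have := ltn_ord (tagged j); rewrite ct.
  have -> : c (tag j) + (tagged i)%:R * eta - (c (tag j) + (tagged j)%:R * eta)
      = (tagged i)%:R * eta - (tagged j)%:R * eta by ring.
  move: (tagged i : nat) (tagged j : nat) => u v vm um; rewrite neq_ltn => /orP[uv|vu].
    rewrite -opprB sN oppr_eq0.
    by apply: (@diff_neq0_diag _ _ _ _ m c nzd (tag j)); rewrite // ltnW.
  by apply: (@diff_neq0_diag _ _ _ _ m c nzd (tag j)); rewrite // ltnW.
- by move=> i j _ _; have [z e] := gw i j; exact: (generic_at e (gcc _ _)).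
- by move=> i j _ _; have [z e] := gw i j; exact: (shift _ _ _ _ e (g12 _ _)).
- by move=> i j _ _; have [z e] := gw' i j; exact: (shift _ _ _ _ e (g12' _ _)).
- by move=> i j _ _; have [z e] := gw i j; exact: (shift _ _ _ _ e (g45 _ _)).
- move=> i _; apply: (shift _ _ _ (tagged i)%:Z _ (gB (tag i))).
  by rewrite /wcell -pmulrn.
- move=> i _; apply: (generic_at (i := (tagged i)%:Z) (u := c (tag i) + b6)).
    by rewrite /wcell -pmulrn addrAC.
  by apply: gb; rewrite !inE eqxx ?orbT.
- exact: bal.
Qed.
End OddForm.

From mathcomp Require Import complex all_classical all_reals all_analysis.
Import numFieldNormedType.Exports.

Local Open Scope classical_set_scope.
Local Open Scope ring_scope.
Local Open Scope complex_scope.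

(** * The theta function *)

Section ComplexConvergence.
Variable R : realType.
Local Notation C := (R[i]).
Local Notation normc := (@ComplexField.Normc.normc R).

Lemma le_of_eq (x y : R) : x = y -> x <= y. Proof. by move=> ->. Qed.

Lemma normrE (x : C) : `|x| = (normc x)%:C. Proof. by []. Qed.

Lemma normc_ge0 (x : C) : 0 <= normc x.
Proof. by have := normr_ge0 x; rewrite normrE ler0c. Qed.

Lemma normcM (x y : C) : normc (x * y) = normc x * normc y.
Proof. exact: ComplexField.Normc.normcM. Qed.

Lemma normcX (x : C) n : normc (x ^+ n) = normc x ^+ n.
Proof.
elim: n => [|n IH]; first by rewrite !expr0 ComplexField.Normc.normc1.
by rewrite !exprS normcM IH.
Qed.

Lemma normcN (x : C) : normc (- x) = normc x.
Proof. by apply: complexI; rewrite -!normrE normrN. Qed.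

Lemma normcD_le (x y : C) : normc (x + y) <= normc x + normc y.
Proof. by have := ler_normD x y; rewrite !normrE -rmorphD lecR. Qed.

Lemma normcV (x : C) : normc x^-1 = (normc x)^-1.
Proof. exact: ComplexField.Normc.normcV. Qed.

Lemma normc_eq0 (x : C) : (normc x == 0) = (x == 0).
Proof. by rewrite -(normr_eq0 x) normrE -(inj_eq (@complexI R)). Qed.

Lemma normc1 : normc 1 = 1. Proof. exact: ComplexField.Normc.normc1. Qed.

(** Turns a complex limit into a real one, where squeezing is available. *)
Lemma cvgC_normc T (F : set_system T) (FF : Filter F) (f : T -> C) (l : C) :
  (f : T -> C^o) @ F --> (l : C^o) <-> normc (l - f x) @[x --> F] --> (0 : R).
Proof.
split=> [/cvgrPdist_lt fl|/cvgrPdist_lt fl].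
  apply/cvgrPdist_lt => e e0; have e0' : 0 < e%:C by rewrite ltcR.
  have := fl _ e0'; apply: filterS => x.
  by rewrite sub0r normrN normrE ltcR ger0_norm ?normc_ge0.
apply/cvgrPdist_lt => e e0; have eR : e \is Num.real by rewrite gtr0_real.
rewrite -(RRe_real eR) in e0 *; rewrite ltcR in e0.
have := fl _ e0; apply: filterS => x.
by rewrite sub0r normrN normrE ltcR ger0_norm ?normc_ge0.
Qed.

Lemma cvgC_V T (F : set_system T) (FF : Filter F) (f : T -> C) (l : C) :
  l != 0 -> (f : T -> C^o) @ F --> (l : C^o) ->
  (fun t => (f t)^-1 : C^o) @ F --> (l^-1 : C^o).
Proof.
move=> l0 fl.
exact: (@cvgV C T F FF f l l0 fl).
Qed.

Lemma cvgC_M T (F : set_system T) (FF : Filter F) (f g : T -> C) (k l : C) :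
  (f : T -> C^o) @ F --> (k : C^o) -> (g : T -> C^o) @ F --> (l : C^o) ->
  (fun t => f t * g t : C^o) @ F --> (k * l : C^o).
Proof.
move=> fk gl.
exact: (@cvgM C T F FF f g k l fk gl).
Qed.

Lemma cvgC_D T (F : set_system T) (FF : Filter F) (f g : T -> C) (k l : C) :
  (f : T -> C^o) @ F --> (k : C^o) -> (g : T -> C^o) @ F --> (l : C^o) ->
  (fun t => f t + g t : C^o) @ F --> (k + l : C^o).
Proof.
move=> fk gl.
exact: (@cvgD C C^o T F FF f g k l fk gl).
Qed.

Lemma cvgC_B T (F : set_system T) (FF : Filter F) (f g : T -> C) (k l : C) :
  (f : T -> C^o) @ F --> (k : C^o) -> (g : T -> C^o) @ F --> (l : C^o) ->
  (fun t => f t - g t : C^o) @ F --> (k - l : C^o).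
Proof.
move=> fk gl.
exact: (@cvgB C C^o T F FF f g k l fk gl).
Qed.

Lemma cvgC_cst T (F : set_system T) (FF : Filter F) (k : C) :
  (fun _ : T => k : C^o) @ F --> (k : C^o).
Proof. exact: cvg_cst. Qed.

Lemma normc_leRI (x : C) : normc x <= `|complex.Re x| + `|complex.Im x|.
Proof.
have -> : x = (complex.Re x)%:C + 'i * (complex.Im x)%:C by rewrite -complexE.
apply: (le_trans (normcD_le _ _)); rewrite normcM.
have nr (y : R) : normc y%:C = `|y|.
  by rewrite /= expr0n /= addr0 sqrtr_sqr.
rewrite !nr /=; simpc => /=; rewrite expr0n expr1n add0r sqrtr1 mul1r.
by rewrite lexx.
Qed.

Lemma normc_geRe (x : C) : `|complex.Re x| <= normc x.
Proof.
case: x => a b /=; rewrite -sqrtr_sqr ler_wsqrtr // lerDl; exact: sqr_ge0.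
Qed.

Lemma normc_geIm (x : C) : `|complex.Im x| <= normc x.
Proof.
case: x => a b /=; rewrite -sqrtr_sqr ler_wsqrtr // lerDr; exact: sqr_ge0.
Qed.

(** The increments of the real and of the imaginary part are dominated by the modulus, hence by a
    geometric series, so completeness is used over the reals only. *)
Lemma cvgC_geometric (u : nat -> C) (K r : R) : 0 <= r < 1 -> 0 <= K ->
  (forall n, normc (u n.+1 - u n) <= K * r ^+ n) ->
  exists l : C, (u : nat -> C^o) @ \oo --> (l : C^o).
Proof.
move=> /andP[r0 r1] K0 hu.
have gcv : cvgn (series (geometric K r)).
  by apply: is_cvg_geometric_series; rewrite ger0_norm.
have cvf (f : C -> R) : (forall x y, f (x - y) = f x - f y) ->
    (forall x, `|f x| <= normc x) -> exists l : R, f (u n) @[n --> \oo] --> l.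
  move=> fB fn.
  have : cvgn [normed series (fun n => f (u n.+1) - f (u n))].
    apply: series_le_cvg gcv => n //=; first by rewrite mulr_ge0 ?exprn_ge0.
    by rewrite -fB (le_trans (fn _)).
  move=> /normed_cvg/cvg_ex[l /= hl]; exists (l + f (u 0%N)).
  have -> : (fun n => f (u n)) = (fun n => series (fun n => f (u n.+1) - f (u n)) n + f (u 0%N)).
    by apply/funext => n; rewrite /series /= telescope_sumr // subrK.
  by apply: cvgD => //; exact: cvg_cst.
have [a ha] := cvf (@complex.Re R) (fun x y => raddfB _ x y) normc_geRe.
have [b hb] := cvf (@complex.Im R) (fun x y => raddfB _ x y) normc_geIm.
exists (a +i* b); apply/cvgC_normc.
have hab : `|a - complex.Re (u n)| + `|b - complex.Im (u n)| @[n --> \oo] --> (0 : R).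
  have -> : 0 = `|a - a| + `|b - b| by rewrite !subrr normr0 addr0.
  by apply: cvgD; apply: cvg_norm; apply: cvgB => //; exact: cvg_cst.
apply: (squeeze_cvgr _ (cvg_cst 0) hab).
near=> n; rewrite normc_ge0 /= (le_trans (normc_leRI _)) //.
by case: (u n).
Unshelve. all: by end_near.
Qed.
Lemma normc_lim_le (u : nat -> C) (l : C) (K : R) :
  (u : nat -> C^o) @ \oo --> (l : C^o) -> (forall n, normc (u n) <= K) ->
  normc l <= K.
Proof.
move=> /cvgC_normc ul uK; apply/ler_addgt0Pr => e e0.
move/cvgrPdist_le : ul => /(_ e e0)[N _ /(_ N (leqnn N))].
rewrite sub0r normrN ger0_norm ?normc_ge0 // => h.
have -> : l = u N + (l - u N) by ring.
by rewrite (le_trans (normcD_le _ _)) // lerD.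
Qed.

Lemma normc_lim_ge (u : nat -> C) (l : C) (K : R) :
  (u : nat -> C^o) @ \oo --> (l : C^o) -> (forall n, K <= normc (u n)) ->
  K <= normc l.
Proof.
move=> /cvgC_normc ul uK; apply/ler_addgt0Pr => e e0.
move/cvgrPdist_le : ul => /(_ e e0)[N _ /(_ N (leqnn N))].
rewrite sub0r normrN ger0_norm ?normc_ge0 // => h.
rewrite (le_trans (uK N)) //; have -> : u N = l + - (l - u N) by ring.
by rewrite (le_trans (normcD_le _ _)) // normcN lerD.
Qed.
End ComplexConvergence.

(** * Convergence, zeros and continuity of the theta product *)

Section InfiniteProduct.
Variables (R : realType) (p : R[i]).
Local Notation C := (R[i]).
Local Notation normc := (@ComplexField.Normc.normc R).
Local Notation r := (normc p).
Hypothesis r1 : r < 1.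

Let r0 : 0 <= r. Proof. exact: normc_ge0. Qed.
Let r1' : 0 < 1 - r. Proof. by rewrite subr_gt0. Qed.

Lemma geometric_le N : \sum_(j < N) r ^+ j <= (1 - r)^-1.
Proof.
rewrite -[leRHS]mul1r ler_pdivlMr //.
have := subrX1 r N; rewrite -opprB -[r - 1]opprB mulNr => /oppr_inj.
by rewrite mulrC => <-; rewrite lerBlDr lerDl exprn_ge0.
Qed.

Lemma prod_geometric_le (K : R) N : 0 <= K ->
  \prod_(j < N) (1 + K * r ^+ j) <= expR (K / (1 - r)).
Proof.
move=> K0; apply: (@le_trans _ _ (expR (\sum_(j < N) K * r ^+ j))).
  rewrite expR_sum; apply: ler_prod => j _; rewrite expR_ge1Dx andbT.
  by rewrite addr_ge0 // mulr_ge0 // exprn_ge0.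
by rewrite ler_expR -mulr_sumr ler_wpM2l // geometric_le.
Qed.

(** The symbol (y; p)_N. Theta at x is the product of the limits for x and for p / x, so all
    analysis is done for this one factor. *)
Definition qpoch (y : C) N := \prod_(j < N) (1 - p ^+ j * y).

Lemma qpochS y N : qpoch y N.+1 = qpoch y N * (1 - p ^+ N * y).
Proof. by rewrite /qpoch big_ord_recr. Qed.

Lemma qpochSl y N : qpoch y N.+1 = (1 - y) * qpoch (p * y) N.
Proof.
rewrite /qpoch big_ord_recl /= expr0 mul1r; congr (_ * _).
by apply: eq_bigr => i _; rewrite /bump add1n exprSr mulrA.
Qed.

Lemma qpochD y N M : qpoch y (N + M) = qpoch y N * qpoch (p ^+ N * y) M.
Proof.
rewrite /qpoch big_split_ord /=; congr (_ * _).
by apply: eq_bigr => i _; rewrite exprD mulrCA mulrA.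
Qed.

Lemma normc_factor (y : C) N : normc (1 - p ^+ N * y) <= 1 + normc y * r ^+ N.
Proof.
by rewrite (le_trans (normcD_le _ _)) // normc1 normcN normcM normcX mulrC.
Qed.

Lemma qpoch_le_prod y N X : normc y <= X ->
  normc (qpoch y N) <= \prod_(j < N) (1 + X * r ^+ j).
Proof.
move=> yX; elim: N => [|N IH]; first by rewrite /qpoch !big_ord0 normc1.
rewrite qpochS big_ord_recr /= normcM ler_pM ?normc_ge0 //.
by rewrite (le_trans (normc_factor _ _)) // lerD2l ler_wpM2r // exprn_ge0.
Qed.

Lemma qpoch_le y N X : normc y <= X -> normc (qpoch y N) <= expR (X / (1 - r)).
Proof.
move=> yX; rewrite (le_trans (qpoch_le_prod N yX)) // prod_geometric_le //.
by rewrite (le_trans (normc_ge0 _) yX).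
Qed.

(** The constant is independent of [N], so the bound passes to the infinite product and proves its
    continuity. *)
Lemma qpoch_lip x y N X : normc x <= X -> normc y <= X ->
  normc (qpoch x N - qpoch y N) <= expR (X / (1 - r)) / (1 - r) * normc (x - y).
Proof.
move=> xX yX; have X0 := le_trans (normc_ge0 _) xX.
suff H : normc (qpoch x N - qpoch y N)
    <= \prod_(j < N) (1 + X * r ^+ j) * (\sum_(j < N) r ^+ j) * normc (x - y).
  rewrite (le_trans H) // ler_wpM2r ?normc_ge0 // ler_pM ?geometric_le //.
  - by apply: prodr_ge0 => j _; rewrite addr_ge0 // mulr_ge0 ?exprn_ge0.
  - by apply: sumr_ge0 => j _; rewrite exprn_ge0.
  - exact: prod_geometric_le.
elim: N => [|N IH].
  by rewrite /qpoch !big_ord0 subrr ComplexField.Normc.normc0 mulr0 mul0r.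
have -> : qpoch x N.+1 - qpoch y N.+1 = (qpoch x N - qpoch y N) * (1 - p ^+ N * x)
    - qpoch y N * p ^+ N * (x - y) by rewrite !qpochS; ring.
rewrite (le_trans (normcD_le _ _)) // normcN !normcM normcX !big_ord_recr /=.
set Pr := \prod_(i < N) _; set Sm := \sum_(i < N) _.
have rN : 0 <= r ^+ N by rewrite exprn_ge0.
have F1 : 1 <= 1 + X * r ^+ N by rewrite lerDl mulr_ge0.
have Pr0 : 0 <= Pr.
  by apply: prodr_ge0 => j _; rewrite addr_ge0 // mulr_ge0 ?exprn_ge0.
have fx : normc (1 - p ^+ N * x) <= 1 + X * r ^+ N.
  by rewrite (le_trans (normc_factor _ _)) // lerD2l ler_wpM2r.
have h1 : normc (qpoch x N - qpoch y N) * normc (1 - p ^+ N * x)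
   <= Pr * Sm * normc (x - y) * (1 + X * r ^+ N) by rewrite ler_pM ?normc_ge0.
have h2 : normc (qpoch y N) * r ^+ N * normc (x - y)
   <= Pr * (1 + X * r ^+ N) * r ^+ N * normc (x - y).
  rewrite ler_wpM2r ?normc_ge0 // ler_wpM2r // -[leLHS]mulr1.
  by rewrite ler_pM ?normc_ge0 // qpoch_le_prod.
by rewrite (le_trans (lerD h1 h2)) //; apply: le_of_eq; ring.
Qed.

Lemma qpoch_cvg y : exists l : C, (qpoch y : nat -> C^o) @ \oo --> (l : C^o).
Proof.
pose K := expR (normc y / (1 - r)) * normc y.
apply: (@cvgC_geometric _ _ K r); first by rewrite r0.
  by rewrite mulr_ge0 ?expR_ge0 ?normc_ge0.
move=> n; have -> : qpoch y n.+1 - qpoch y n = - (qpoch y n * y * p ^+ n).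
  by rewrite qpochS; ring.
rewrite normcN !normcM normcX ler_wpM2r ?exprn_ge0 // ler_wpM2r ?normc_ge0 //.
exact: qpoch_le.
Qed.

Definition qinf y : C := sval (cid (qpoch_cvg y)).

Lemma qinfP y : (qpoch y : nat -> C^o) @ \oo --> (qinf y : C^o).
Proof. exact: svalP (cid (qpoch_cvg y)). Qed.

Lemma cvgC_unique (u : nat -> C) (k l : C) : (u : nat -> C^o) @ \oo --> (k : C^o) ->
  (u : nat -> C^o) @ \oo --> (l : C^o) -> k = l.
Proof. by move=> uk ul; apply: (@cvg_unique C^o _ _ _ _ _ uk ul). Qed.

Lemma qinfE y : qinf y = (1 - y) * qinf (p * y).
Proof.
apply: (@cvgC_unique (fun n => qpoch y n.+1)).
  by rewrite (cvg_shiftS (qpoch y : nat -> C^o)); exact: qinfP.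
under eq_fun do rewrite qpochSl.
by apply: cvgC_M; [exact: cvgC_cst|exact: qinfP].
Qed.

Lemma thetaE x : theta p x = qinf x * qinf (p / x).
Proof.
rewrite /theta; apply: (@cvg_lim (C^o)) => //.
have -> : (fun N => \prod_(0 <= j < N) ((1 - p ^+ j * x) * (1 - p ^+ j.+1 / x)) : C^o)
   = (fun N => qpoch x N * qpoch (p / x) N : C^o).
  apply/funext => N; rewrite /qpoch -big_split big_mkord.
  by apply: eq_bigr => j _; rewrite exprSr mulrA.
by apply: cvgC_M; exact: qinfP.
Qed.

Lemma thetaV x : x != 0 -> theta p x^-1 = - x^-1 * theta p x.
Proof.
move=> x0; rewrite !thetaE invrK (qinfE x^-1) (qinfE x).
by move: (qinf _) (qinf _) => A B; field.
Qed.

Lemma qinf_lip x y X : normc x <= X -> normc y <= X ->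
  normc (qinf x - qinf y) <= expR (X / (1 - r)) / (1 - r) * normc (x - y).
Proof.
move=> xX yX.
apply: (@normc_lim_le _ (fun n => qpoch x n - qpoch y n)).
  by apply: cvgC_B; exact: qinfP.
by move=> n; apply: qpoch_lip.
Qed.

(** Weierstrass's inequality: a product of factors 1 - x_j has modulus at least 1 minus the sum of
    the |x_j|. A nonpositive bound is trivial and is set apart because the induction multiplies
    lower bounds. *)
Lemma qpoch_tail y N : normc y / (1 - r) <= 2^-1 -> 2^-1 <= normc (qpoch y N).
Proof.
move=> hy; suff H : 1 - normc y * \sum_(j < N) r ^+ j <= normc (qpoch y N).
  apply: le_trans H; rewrite lerBrDl -lerBrDr.
  have -> : 1 - 2^-1 = 2^-1 :> R by field.
  by rewrite (le_trans _ hy) // ler_wpM2l ?normc_ge0 // geometric_le.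
elim: N => [|N IH]; first by rewrite /qpoch !big_ord0 normc1 mulr0 subr0.
have [neg|pos] := lerP (1 - normc y * \sum_(j < N.+1) r ^+ j) 0.
  by rewrite (le_trans neg) ?normc_ge0.
rewrite qpochS normcM; move: pos; rewrite big_ord_recr /= => pos.
set Sm := \sum_(i < N) _ in IH pos *; set t := normc y * r ^+ N.
have t0 : 0 <= t by rewrite mulr_ge0 ?normc_ge0 ?exprn_ge0.
have h1 : 1 - t <= normc (1 - p ^+ N * y).
  have := normcD_le (1 - p ^+ N * y) (p ^+ N * y).
  by rewrite subrK normc1 normcM normcX [r ^+ N * _]mulrC lerBlDr.
have S0 : 0 <= normc y * Sm.
  by rewrite mulr_ge0 ?normc_ge0 // sumr_ge0 // => i _; rewrite exprn_ge0.
have e : 1 - normc y * (Sm + r ^+ N) = 1 - normc y * Sm - t by rewrite /t; ring.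
rewrite e in pos *.
have le1 : 1 - normc y * Sm - t <= (1 - normc y * Sm) * (1 - t).
  have : 0 <= normc y * Sm * t by rewrite mulr_ge0.
  by move: (normc y * Sm) => w; nra.
apply: (le_trans le1); apply: ler_pM => //; lra.
Qed.

(** Beyond some [J] the remaining factors are small perturbations of 1 and [qpoch_tail] applies; the
    finitely many others are nonzero. *)
Lemma qpoch_lower y : (forall j, 1 - p ^+ j * y != 0) ->
  exists2 dlt : R, 0 < dlt & forall N, dlt <= normc (qpoch y N).
Proof.
move=> ny; have [J hJ] : exists J, normc (p ^+ J * y) / (1 - r) <= 2^-1.
  have : (normc y / (1 - r)) * r ^+ n @[n --> \oo] --> (0 : R).
    by apply: cvg_geometric; rewrite ger0_norm.
  move=> /cvgrPdist_le /(_ 2^-1) []; first by rewrite invr_gt0.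
  move=> J _ /(_ J (leqnn _)); rewrite sub0r normrN => h; exists J.
  rewrite (le_trans _ h) // (le_trans _ (ler_norm _)) // normcM normcX.
  by apply: le_of_eq; move: (1 - r)^-1 => i; ring.
have qn0 N : qpoch y N != 0 by apply/prodf_neq0 => j _; exact: ny.
pose M := expR (normc y / (1 - r)).
have M1 : 1 <= M.
  by rewrite -expR0 ler_expR divr_ge0 ?normc_ge0 // ltW.
have q0 : 0 < normc (qpoch y J) by rewrite lt0r normc_eq0 qn0 normc_ge0.
have M0 : 0 < M by rewrite (lt_le_trans _ M1).
(* One constant for both cases: if [J <= N] the extra factors have modulus at least 1/2, and if
   [N < J] the missing ones have modulus at most [M]. *)
exists (normc (qpoch y J) / (M + M)).
  by rewrite divr_gt0 // addr_gt0.
move=> N; rewrite ler_pdivrMr ?addr_gt0 //.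
have [JN|NJ] := leqP J N.
  rewrite -(subnKC JN) qpochD normcM -mulrA ler_peMr ?normc_ge0 //.
  have := qpoch_tail (N - J) hJ; set t := normc _ => ht.
  clearbody M; have {}ht : 1 / 2 <= t by rewrite div1r.
  by nra.
rewrite -(subnKC (ltnW NJ)) qpochD normcM ler_wpM2l ?normc_ge0 //.
apply: (@le_trans _ _ M); last by lra.
apply: qpoch_le; rewrite normcM normcX ler_piMl ?normc_ge0 //.
by rewrite exprn_ile1 // ltW.
Qed.

(** An infinite product could tend to zero without a vanishing factor; the uniform lower bound
    excludes this. *)
Lemma qinf_eq0 y : qinf y = 0 -> exists j, p ^+ j * y = 1.
Proof.
move=> qy; apply: contrapT => /forallNP ny.
have [|d d0 hd] := @qpoch_lower y.
  by move=> j; rewrite subr_eq0 eq_sym; apply/eqP.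
have := normc_lim_ge (@qinfP y) hd.
by rewrite qy ComplexField.Normc.normc0 leNgt d0.
Qed.

(** Only the moduli of the zeros are recorded: being countably many, they can be avoided by scaling
    with a real number. *)
Lemma theta_eq0 x : x != 0 -> theta p x = 0 ->
  exists j, r ^+ j * normc x = 1 \/ normc x = r ^+ j.
Proof.
move=> x0 /eqP; rewrite thetaE mulf_eq0 => /orP[/eqP/qinf_eq0|/eqP/qinf_eq0] [j hj].
  by exists j; left; rewrite -normcX -normcM hj normc1.
exists j.+1; right; rewrite -normcX exprSr; congr normc.
by rewrite -[LHS]mul1r -hj mulrA mulfVK.
Qed.

Lemma qinf_cont T (F : set_system T) (FF : Filter F) (f : T -> C) (l : C) :
  (f : T -> C^o) @ F --> (l : C^o) ->
  (fun t => qinf (f t) : C^o) @ F --> (qinf l : C^o).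
Proof.
move=> fl; apply/cvgC_normc; move/cvgC_normc : (fl) => fl'.
pose L := expR ((normc l + 1) / (1 - r)) / (1 - r).
have hL : L * normc (l - f x) @[x --> F] --> (0 : R).
  by rewrite -(mulr0 L); apply: cvgM => //; exact: cvg_cst.
apply: (squeeze_cvgr _ (cvg_cst 0) hL).
have near1 : \forall x \near F, normc (l - f x) <= 1.
  move/cvgrPdist_le : fl' => /(_ 1 ltr01); apply: filterS => x.
  by rewrite sub0r normrN ger0_norm ?normc_ge0.
apply: filterS near1 => x hx; rewrite normc_ge0 /=.
apply: qinf_lip; first by rewrite lerDl.
have -> : f x = l + - (l - f x) by ring.
by rewrite (le_trans (normcD_le _ _)) // normcN lerD2l.
Qed.

Lemma theta_cont T (F : set_system T) (FF : Filter F) (f : T -> C) (l : C) :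
  l != 0 -> (f : T -> C^o) @ F --> (l : C^o) ->
  (fun t => theta p (f t) : C^o) @ F --> (theta p l : C^o).
Proof.
move=> l0 fl; rewrite thetaE.
under eq_fun do rewrite thetaE.
have h1 := qinf_cont FF fl.
have hV : (fun t => (f t)^-1 : C^o) @ F --> (l^-1 : C^o) by exact: cvgC_V.
have hp : (fun t => p / f t : C^o) @ F --> (p / l : C^o).
  by apply: cvgC_M hV; exact: cvgC_cst.
have h2 := qinf_cont FF hp.
exact: (cvgC_M FF h1 h2).
Qed.
End InfiniteProduct.

(** * The three-term relation *)

Section Tannery.
Variable R : realType.
Local Notation C := (R[i]).
Local Notation normc := (@ComplexField.Normc.normc R).

Lemma normc_sum (I : Type) (s : seq I) (P : pred I) (f : I -> C) :
  normc (\sum_(i <- s | P i) f i) <= \sum_(i <- s | P i) normc (f i).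
Proof.
elim/big_rec2: _ => [|i y1 y2 _ h]; first by rewrite ComplexField.Normc.normc0.
by rewrite (le_trans (normcD_le _ _)) // lerD2l.
Qed.

Lemma cvgC_sum T (F : set_system T) (FF : Filter F) (I : Type) (s : seq I)
  (a : T -> I -> C) (l : I -> C) :
  (forall i, (a ^~ i : T -> C^o) @ F --> (l i : C^o)) ->
  (fun t => \sum_(i <- s) a t i : C^o) @ F --> (\sum_(i <- s) l i : C^o).
Proof.
move=> al; elim: s => [|i s IH].
  by rewrite big_nil; under eq_fun do rewrite big_nil; exact: cvgC_cst.
rewrite big_cons; under eq_fun do rewrite big_cons.
exact: (cvgC_D FF (al i) IH).
Qed.

Lemma near_all_in (I : eqType) (F : seq I) (A : nat -> seq I) :
  (forall i, \forall N \near \oo, i \in A N) ->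
  \forall N \near \oo, {subset F <= A N}.
Proof.
move=> h; elim: F => [|i F IH]; first by near=> N => j.
near=> N => j; rewrite inE => /predU1P[->|jF].
  by near: N; exact: h.
suff /(_ j jF) : {subset F <= A N} by [].
by near: N.
Unshelve. all: by end_near. Qed.

(** Dominated convergence without infinite sums. Two exhaustions [A] and [B] of the index set may be
    compared, so a double sum can be rearranged; bounded finite sums of [b] express summability. *)
Lemma tannery (I : eqType) (A B : nat -> seq I) (a : nat -> I -> C) (l : I -> C)
   (b : I -> R) (K : R) :
  (forall N, uniq (A N)) -> (forall N, uniq (B N)) ->
  (forall i, \forall N \near \oo, i \in A N) ->
  (forall i, \forall N \near \oo, i \in B N) ->
  (forall N i, normc (a N i) <= b i) -> (forall i, normc (l i) <= b i) ->
  (forall i, (a ^~ i : nat -> C^o) @ \oo --> (l i : C^o)) ->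
  (forall s, uniq s -> \sum_(i <- s) b i <= K) ->
  (fun N => \sum_(i <- A N) a N i - \sum_(i <- B N) l i : C^o) @ \oo --> (0 : C^o).
Proof.
move=> uA uB eA eB ab lb al bK; apply/cvgC_normc/cvgrPdist_le => e e0.
pose E := [set x : R | exists2 s : seq I, uniq s & x = \sum_(i <- s) b i].
have supE : has_sup E.
  split; first by exists 0, [::]; rewrite ?big_nil.
  by exists K => x [s us ->]; exact: bK.
have e3 : 0 < e / 3 by rewrite divr_gt0.
(* Outside [F] every finite sum of [b] is at most [e / 3], and on [F] convergence is termwise. *)
have [_ [F uF ->] hF] := sup_adherent e3 supE.
have split_sum (T : nmodType) (s : seq I) (f : I -> T) : uniq s -> {subset F <= s} ->
    \sum_(i <- s) f i = \sum_(i <- F) f i + \sum_(i <- s | i \notin F) f i.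
  move=> us Fs; rewrite (bigID (fun i => i \in F)) /=; congr (_ + _).
  rewrite -big_filter; apply: perm_big; apply: uniq_perm; rewrite ?filter_uniq //.
  move=> i; rewrite mem_filter; apply/andP/idP => [[]//|iF]; split=> //.
  exact: Fs.
have tail (s : seq I) : uniq s -> {subset F <= s} ->
    \sum_(i <- s | i \notin F) b i <= e / 3.
  move=> us Fs; have := sup_upper_bound supE; move=> /(_ (\sum_(i <- s) b i)).
  rewrite (split_sum _ _ _ us Fs) => /(_ (ex_intro2 _ _ s us _)) h.
  have {}h := h (esym (split_sum _ _ _ us Fs)).
  by move: hF h; lra.
have cF : \forall N \near \oo, normc (\sum_(i <- F) l i - \sum_(i <- F) a N i) <= e / 3.
  have cS : (fun N => \sum_(i <- F) a N i : C^o) @ \oo --> (\sum_(i <- F) l i : C^o).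
    exact: cvgC_sum.
  move/cvgC_normc/cvgrPdist_le: cS => /(_ _ e3).
  by apply: filterS => N; rewrite sub0r normrN ger0_norm // normc_ge0.
near=> N.
have FA : {subset F <= A N} by near: N; exact: near_all_in.
have FB : {subset F <= B N} by near: N; exact: near_all_in.
have h1 : normc (\sum_(i <- F) l i - \sum_(i <- F) a N i) <= e / 3 by near: N.
rewrite sub0r normrN ger0_norm ?normc_ge0 // sub0r normcN.
rewrite (split_sum _ _ _ (uA N) FA) (split_sum _ _ _ (uB N) FB).
set a1 := \sum_(i <- F) a N i in h1 *; set a2 := \sum_(i <- A N | _) _.
set l1 := \sum_(i <- F) l i in h1 *; set l2 := \sum_(i <- B N | _) _.
have -> : a1 + a2 - (l1 + l2) = - (l1 - a1) + (a2 + - l2) by ring.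
have h2 : normc a2 <= e / 3.
  by rewrite (le_trans (normc_sum _ _ _)) // (le_trans _ (tail _ (uA N) FA)) // ler_sum.
have h3 : normc l2 <= e / 3.
  by rewrite (le_trans (normc_sum _ _ _)) // (le_trans _ (tail _ (uB N) FB)) // ler_sum.
have := normcD_le (- (l1 - a1)) (a2 + - l2); have := normcD_le a2 (- l2).
by rewrite !normcN; lra.
Unshelve. all: by end_near. Qed.
End Tannery.

(** * The q-binomial theorem in base p *)

Section JacobiTriple.
Variables (R : realType) (p : R[i]).
Local Notation C := (R[i]).
Local Notation normc := (@ComplexField.Normc.normc R).
Local Notation r := (normc p).
Hypotheses (r1 : r < 1) (p0 : p != 0).

Let phi N := qpoch p p N.

Lemma phi_neq0 N : phi N != 0.
Proof.
apply/prodf_neq0 => j _; rewrite subr_eq0 -exprSr; apply/negP => /eqP h.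
have := congr1 normc h; rewrite normc1 normcX => h1.
have : r ^+ j.+1 < 1 by rewrite exprn_ilt1 // normc_ge0.
by rewrite -h1 ltxx.
Qed.

Let phiS N : phi N.+1 = phi N * (1 - p ^+ N.+1).
Proof. by rewrite /phi qpochS exprSr. Qed.

Let fac_neq0 N : 1 - p ^+ N.+1 != 0.
Proof. by have := phi_neq0 N.+1; rewrite phiS mulf_eq0 negb_or => /andP[]. Qed.

Definition gbin M k := phi M / (phi k * phi (M - k)).

Lemma qpoch_binomial z M : qpoch p z M =
  \sum_(k < M.+1) (-1) ^+ k * p ^+ 'C(k, 2) * gbin M k * z ^+ k.
Proof.
have g0 N : gbin N 0 = 1.
  by rewrite /gbin subn0 {2}/phi /qpoch big_ord0 mul1r divff // phi_neq0.
have gN N : gbin N N = 1.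
  by rewrite /gbin subnn /phi {3}/qpoch big_ord0 mulr1 divff // phi_neq0.
elim: M => [|M IH].
  by rewrite /qpoch big_ord0 big_ord_recl big_ord0 addr0 /= g0 bin0n !expr0 !mulr1.
rewrite qpochS mulrBr mulr1 [LHS]addrC {1}IH big_ord_recr /= [X in _ + X]IH big_ord_recl /=.
rewrite [RHS]big_ord_recl big_ord_recr /= !g0 !gN.
(* Pascal's rule in base [p] for the inner coefficients; the two extreme ones are split off. *)
have -> : \sum_(i < M) (-1) ^+ bump 0 (widen_ord (leqnSn M) i)
       * p ^+ 'C(bump 0 (widen_ord (leqnSn M) i), 2)
       * gbin M.+1 (bump 0 (widen_ord (leqnSn M) i)) * z ^+ bump 0 (widen_ord (leqnSn M) i)
  = \sum_(i < M) (-1) ^+ bump 0 i * p ^+ 'C(bump 0 i, 2) * gbin M (bump 0 i) * z ^+ bump 0 i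
  - (\sum_(i < M) (-1) ^+ i * p ^+ 'C(i, 2) * gbin M i * z ^+ i) * (p ^+ M * z).
  rewrite mulr_suml -sumrB; apply: eq_bigr => i _ /=.
  rewrite /bump leq0n add1n; have iM := ltn_ord i.
  have e1 : (M - i = (M - i.+1).+1)%N by rewrite subnSK.
  have e2 : (M = i + (M - i.+1).+1)%N by rewrite subnSK // subnKC // ltnW.
  rewrite binS bin1 exprD /gbin subSS e1 phiS [phi i.+1]phiS [phi _.+1]phiS.
  set d := (M - i.+1)%N in e1 e2 *.
  have -> : p ^+ M.+1 = p ^+ i.+1 * p ^+ d.+1 by rewrite -exprD; congr (_ ^+ _); lia.
  have -> : p ^+ M = p ^+ i * p ^+ d.+1 by rewrite -exprD -e2.
  rewrite !exprS; move: (phi_neq0 i) (phi_neq0 d) (fac_neq0 i) (fac_neq0 d).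
  rewrite !exprS; move: (phi i) (phi d) (phi M) (p ^+ i) (p ^+ d) (p ^+ 'C(i, 2)) => a b c u v w a0 b0 u0 v0.
  by field; rewrite ?a0 ?b0 ?u0 ?v0.
rewrite /bump leq0n add1n binS bin1 exprD !exprS; ring.
Qed.
End JacobiTriple.

(** * Summability of Gaussian terms *)

Section GaussianSums.
Variable R : realType.

(** The number m(m - 1)/2, which is nonnegative for every integer m; as a natural number it can be
    an exponent of [p] without inverses. *)
Definition tri (m : int) : nat :=
  match m with Posz n => 'C(n, 2) | Negz n => 'C(n.+2, 2) end.

Lemma bin2_double n : ('C(n, 2) * 2 = n * n.-1)%N.
Proof.
elim: n => [//|n IH]; rewrite binS bin1 mulnDl IH; case: n {IH} => // n.
by rewrite /=; lia.
Qed.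

Lemma tri_double (m : int) : (tri m)%:Z * 2 = m * (m - 1).
Proof.
case: m => [[|n]|n] //=; rewrite -PoszM bin2_double /=.
  by rewrite PoszM; congr (_ * _); rewrite -addn1 PoszD addrK.
by rewrite NegzE; lia.
Qed.

(** A quadratic exponent beats geometric growth: the ratio of consecutive terms of [f] is r^k times
    a constant and is eventually at most 1. *)
Lemma gauss_term_bounded (r Y : R) : 0 <= r < 1 -> 0 <= Y ->
  exists K : R, forall k, r ^+ 'C(k, 2) * Y ^+ k <= K * 2^-1 ^+ k.
Proof.
move=> /andP[r0 r1] Y0; pose f k := r ^+ 'C(k, 2) * (2 * Y) ^+ k.
have f0 k : 0 <= f k by rewrite mulr_ge0 // exprn_ge0 // mulr_ge0.
have fS k : f k.+1 = f k * (r ^+ k * (2 * Y)).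
  by rewrite /f binS bin1 exprD exprS; ring.
have [k0 hk0] : exists k0, forall k, (k0 <= k)%N -> r ^+ k * (2 * Y) <= 1.
  have : (2 * Y) * r ^+ n @[n --> \oo] --> (0 : R).
    by apply: cvg_geometric; rewrite ger0_norm.
  move=> /cvgrPdist_le /(_ 1 ltr01)[k0 _ h]; exists k0 => k kk.
  have := h k kk; rewrite sub0r normrN => {}h.
  by rewrite mulrC (le_trans (ler_norm _)).
exists (\sum_(i < k0.+1) f i) => k.
have fb : f k <= \sum_(i < k0.+1) f i.
  have [kk|kk] := leqP k k0.
    rewrite (bigD1 (Ordinal (kk : (k < k0.+1)%N))) //=.
    by rewrite lerDl sumr_ge0.
  rewrite (@le_trans _ _ (f k0)) //; last first.
    by rewrite big_ord_recr /= lerDr sumr_ge0.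
  rewrite -(subnKC (ltnW kk)); elim: (k - k0)%N => [|j IH]; first by rewrite addn0.
  by rewrite addnS fS (le_trans _ IH) // ler_piMr // hk0 // leq_addr.
have -> : r ^+ 'C(k, 2) * Y ^+ k = f k * 2^-1 ^+ k.
  by rewrite /f -mulrA -exprMn; congr (_ * _ ^+ k); field.
by rewrite ler_wpM2r // exprn_ge0.
Qed.

Lemma half_sum_le (s : seq nat) : uniq s -> \sum_(k <- s) (2^-1 : R) ^+ k <= 2.
Proof.
move=> us; pose M := (\max_(k <- s) k).+1.
apply: (@le_trans _ _ (\sum_(k < M) (2^-1 : R) ^+ k)); last first.
  have := subrX1 (2^-1 : R) M => h.
  have : 0 <= (2^-1 : R) ^+ M by rewrite exprn_ge0.
  move: (\sum_(i < M) _) ((2^-1 : R) ^+ M) h => a b; lra.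
rewrite -(big_mkord xpredT (fun k => (2^-1 : R) ^+ k)).
rewrite [leRHS](bigID (fun k => k \in s)) /= -[leLHS]addr0 lerD //; last first.
  by rewrite sumr_ge0 // => i _; rewrite exprn_ge0.
apply: le_of_eq; rewrite -[RHS]big_filter; apply: perm_big; apply: uniq_perm => //.
  by rewrite filter_uniq // iota_uniq.
move=> k; rewrite mem_filter mem_index_iota /=; apply/idP/andP => [ks|[]//].
by split=> //; rewrite ltnS (leq_bigmax_seq _ ks).
Qed.

(** At m = -k the exponent is C(k + 1, 2) = C(k, 2) + k, so the negative indices give terms of the
    same kind with r / X in place of X. *)
Lemma gauss_sum_le (r X : R) : 0 <= r < 1 -> 0 < X ->
  exists K : R, forall s : seq int, uniq s -> \sum_(m <- s) r ^+ tri m * X ^ m <= K.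
Proof.
move=> r01 X0; have /andP[r0 r1] := r01.
have [K1 h1] := gauss_term_bounded r01 (ltW X0).
have [K2 h2] : exists K : R, forall k, r ^+ 'C(k.+1, 2) * X ^- k <= K * 2^-1 ^+ k.
  have Y0 : 0 <= r / X by rewrite divr_ge0 // ltW.
  have [K hK] := gauss_term_bounded r01 Y0; exists K => k; rewrite (le_trans _ (hK k)) //.
  by rewrite binS bin1 exprD exprMn exprVn mulrA.
have half0 k : 0 <= (2^-1 : R) ^+ k by rewrite exprn_ge0.
have K10 : 0 <= K1.
  by have := h1 0%N; rewrite bin0n !expr0 !mulr1 => /(le_trans ler01).
have K20 : 0 <= K2.
  by have := h2 0%N; rewrite binS bin0n bin1 !expr0 invr1 !mulr1 => /(le_trans ler01).
exists (K1 * 2 + K2 * 2) => s us.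
rewrite (bigID (fun m : int => 0 <= m)) /= lerD //.
  rewrite -big_filter (@le_trans _ _ (\sum_(m <- [seq m <- s | 0 <= m]) K1 * 2^-1 ^+ `|m|%N)) //.
    rewrite !big_filter; apply: ler_sum => -[n|//] _; exact: h1.
  rewrite -mulr_sumr ler_wpM2l // -(big_map (fun m : int => `|m|%N) xpredT (fun k => (2^-1 : R) ^+ k)).
  apply: half_sum_le; rewrite map_inj_in_uniq ?filter_uniq //.
  by move=> [m|m] [k|k]; rewrite !mem_filter //= => _ _ ->.
rewrite -big_filter (@le_trans _ _ (\sum_(m <- [seq m <- s | ~~ (0 <= m)]) K2 * 2^-1 ^+ `|m|%N)) //.
  rewrite !big_filter; apply: ler_sum => -[//|n] _; exact: h2.
rewrite -mulr_sumr ler_wpM2l // -(big_map (fun m : int => `|m|%N) xpredT (fun k => (2^-1 : R) ^+ k)).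
apply: half_sum_le; rewrite map_inj_in_uniq ?filter_uniq //.
by move=> [m|m] [k|k]; rewrite !mem_filter //= => _ _ [->].
Qed.

Lemma pair_sum_le (I J : eqType) (b : I -> R) (c : J -> R) (K L : R) :
  (forall i, 0 <= b i) -> (forall j, 0 <= c j) ->
  (forall s, uniq s -> \sum_(i <- s) b i <= K) ->
  (forall s, uniq s -> \sum_(j <- s) c j <= L) ->
  forall s : seq (I * J), uniq s -> \sum_(ij <- s) b ij.1 * c ij.2 <= K * L.
Proof.
move=> b0 c0 hb hc s us.
pose s1 := undup (map fst s); pose s2 := undup (map snd s).
apply: (@le_trans _ _ (\sum_(ij <- [seq (i, j) | i <- s1, j <- s2]) b ij.1 * c ij.2)).
  rewrite [leRHS](bigID (fun k => k \in s)) /= -[leLHS]addr0 lerD //; last first.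
    by rewrite sumr_ge0 // => i _; rewrite mulr_ge0.
  apply: le_of_eq; rewrite -[RHS]big_filter; apply: perm_big; apply: uniq_perm => //.
    by rewrite filter_uniq // allpairs_uniq ?undup_uniq // => -[? ?] [? ?].
  move=> [i j]; rewrite mem_filter; apply/idP/andP => [ks|[]//]; split=> //.
  by apply: allpairs_f; rewrite mem_undup; [apply: (map_f fst ks)|apply: (map_f snd ks)].
rewrite big_allpairs /=; under eq_bigr do rewrite -mulr_sumr.
rewrite -mulr_suml ler_pM ?sumr_ge0 ?hb ?hc ?undup_uniq //.
Qed.
End GaussianSums.

(** Pairs of exponents with even sum are (u + v, u - v), those with odd sum (u + v, u - v + 1). In
    the coordinates u, v the monomial separates into a power of x and a power of y. *)
Lemma exprz_even (K : fieldType) (x y : K) (u v : int) : x != 0 -> y != 0 ->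
  (x * y) ^ (u + v) * (x / y) ^ (u - v) = x ^ (u + u) * y ^ (v + v).
Proof.
move=> x0 y0; rewrite !expfzMl exprz_inv mulrACA -!expfzDr //.
by congr (_ ^ _ * _ ^ _); lia.
Qed.

Lemma exprz_odd (K : fieldType) (x y : K) (u v : int) : x != 0 -> y != 0 ->
  (x * y) ^ (u + v) * (x / y) ^ (u - v + 1) = x ^ (u + u) * y ^ (v + v) * (x / y).
Proof.
move=> x0 y0; rewrite [(x / y) ^ _]expfzDr ?mulf_neq0 ?invr_eq0 // expr1z.
by rewrite mulrA exprz_even.
Qed.

(** [G a b] is k times the determinant of the vectors (U a / a, V a) and (U b / b, V b). *)
Lemma rank2_plucker (K : fieldType) (U V : K -> K) (k x y u v : K) :
  x != 0 -> y != 0 -> u != 0 -> v != 0 ->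
  let G a b := k * (U a * V b - a / b * (V a * U b)) / a in
  G x y * G u v - G x u * G y v + G x v * G y u = 0.
Proof. by move=> x0 y0 u0 v0 G; rewrite /G; field; rewrite x0 y0 u0 v0. Qed.

(** * Theta as a limit of Laurent polynomials *)

Section ThreeTerm.
Variables (R : realType) (p : R[i]).
Local Notation C := (R[i]).
Local Notation normc := (@ComplexField.Normc.normc R).
Local Notation r := (normc p).
Hypotheses (r1 : r < 1) (p0 : p != 0).
Local Notation phi := (qpoch p p).

Lemma normcXz (x : C) (m : int) : normc (x ^ m) = normc x ^ m.
Proof. by case: m => n; rewrite ?NegzE -?exprnN -?exprnP ?normcV normcX. Qed.

Definition gauss (m : int) : C := (-1) ^ m * p ^+ tri m.

(** For |m| <= N this is [gauss m] times a binomial coefficient in base [p]. For larger |m| the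
    absolute values give an arbitrary number, which still obeys the bound that [tannery] asks for
    all indices. *)
Definition lcoef N (m : int) : C :=
  gauss m * (phi (N + N) / (phi (absz (N%:Z + m)%R) * phi (absz (N%:Z - m)%R))).

Definition zrange N := [seq k%:Z - N%:Z | k <- iota 0 (N + N).+1].

Lemma mem_zrange N m : (m \in zrange N) = (`|m| <= N)%N.
Proof.
apply/mapP/idP => [[k]|mN]; first by rewrite mem_iota => ? ->; lia.
by exists (absz (m + N%:Z)); rewrite ?mem_iota; lia.
Qed.

Lemma zrange_uniq N : uniq (zrange N).
Proof. by rewrite map_inj_uniq ?iota_uniq // => i j; lia. Qed.

Lemma shift_prod N x : x != 0 ->
  qpoch p (p / x) N = qpoch p (p ^- N * x) N * ((-1) ^+ N * p ^+ 'C(N.+1, 2) * x ^- N).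
Proof.
move=> x0; have -> : (-1) ^+ N * p ^+ 'C(N.+1, 2) * x ^- N = \prod_(i < N) (- (p ^+ i.+1 / x)).
  elim: N => [|N IH]; first by rewrite big_ord0 bin_small // !expr0 invr1 !mulr1.
  by rewrite big_ord_recr /= -IH binS bin1 exprD !exprS; field; rewrite x0 expf_neq0.
rewrite /qpoch [X in _ = X * _](reindex_inj rev_ord_inj) /= -big_split.
apply: eq_bigr => i _ /=.
have -> : p ^+ (N - i.+1) * (p ^- N * x) = (p ^+ i.+1)^-1 * x.
  rewrite mulrA; congr (_ * _).
  have -> : p ^+ N = p ^+ (N - i.+1) * p ^+ i.+1 by rewrite -exprD subnK.
  by rewrite invfM mulrA divff ?mul1r // expf_neq0.
by rewrite exprS; field; rewrite x0 p0 expf_neq0.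
Qed.

(** A finite form of the Jacobi triple product: up to a monomial the left side is (p^-N x; p)_2N, to
    which the q-binomial theorem applies. *)
Lemma theta_laurent N x : x != 0 ->
  qpoch p x N * qpoch p (p / x) N = \sum_(m <- zrange N) lcoef N m * x ^ m.
Proof.
move=> x0; have pN0 n : p ^+ n != 0 by rewrite expf_neq0.
have xN0 n : x ^+ n != 0 by rewrite expf_neq0.
have := qpochD p (p ^- N * x) N N; rewrite mulrA mulfV // mul1r => h.
rewrite shift_prod // mulrA [qpoch p x N * _]mulrC -h qpoch_binomial //.
rewrite mulr_suml big_map -(big_mkord xpredT (fun k => (-1) ^+ k * p ^+ 'C(k, 2)
  * gbin p (N + N) k * (p ^- N * x) ^+ k * ((-1) ^+ N * p ^+ 'C(N.+1, 2) * x ^- N))).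
apply: eq_big_seq => k; rewrite mem_index_iota => /andP[_ kN].
rewrite /lcoef /gauss /gbin.
have -> : absz (N%:Z + (k%:Z - N%:Z))%R = k by lia.
have -> : absz (N%:Z - (k%:Z - N%:Z))%R = (N + N - k)%N by lia.
have -> : x ^ (k%:Z - N%:Z) = x ^+ k / x ^+ N.
  by rewrite expfzDr // -exprnN.
have -> : (-1) ^ (k%:Z - N%:Z) = (-1) ^+ k * (-1) ^+ N :> C.
  by rewrite expfzDr ?oppr_eq0 ?oner_eq0 // -exprnN invr_sign.
rewrite exprMn exprVn -exprM.
have : p ^+ 'C(k, 2) * p ^+ 'C(N.+1, 2) = p ^+ tri (k%:Z - N%:Z) * p ^+ (N * k).
  rewrite -!exprD; congr (_ ^+ _).
  have := tri_double (k%:Z - N%:Z); have := bin2_double k; have := bin2_double N.+1.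
  by move: (tri _) 'C(k, 2) 'C(N.+1, 2) => t u v /=; case: k {kN} => [|k] /=; nia.
move=> hp; move: (phi (N + N) / _) => G.
have -> : (-1) ^+ k * p ^+ 'C(k, 2) * G * (p ^- (N * k) * x ^+ k)
   * ((-1) ^+ N * p ^+ 'C(N.+1, 2) * x ^- N)
   = (-1) ^+ k * (-1) ^+ N * (p ^+ 'C(k, 2) * p ^+ 'C(N.+1, 2)) * G
     * (p ^- (N * k) * x ^+ k) * x ^- N by ring.
by rewrite hp; field; rewrite xN0 pN0.
Qed.

Let expz n : p ^+ n = p ^ n%:Z. Proof. by []. Qed.

Let sign_even (u : int) : (-1) ^ (u + u) = 1 :> C.
Proof.
have -> : u + u = 2%:Z * u by lia.
by rewrite -exprz_exp -exprnP sqrrN expr1n exp1rz.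
Qed.

(** The quadratic exponents add up to a function of u plus a function of v; together with
    [gauss_odd], where these two functions trade places, this gives rank two. *)
Lemma gauss_even (u v : int) :
  gauss (u + v) * gauss (u - v) = p ^ (u * u - u) * p ^ (v * v).
Proof.
rewrite /gauss !expz mulrACA -!expfzDr ?oppr_eq0 ?oner_eq0 //.
have -> : u + v + (u - v) = u + u by lia.
have -> : (tri (u + v))%:Z + (tri (u - v))%:Z = u * u - u + v * v.
  by have := tri_double (u + v); have := tri_double (u - v); nia.
by rewrite sign_even mul1r expfzDr.
Qed.

Lemma gauss_odd (u v : int) :
  gauss (u + v) * gauss (u - v + 1) = - (p ^ (u * u) * p ^ (v * v - v)).
Proof.
rewrite /gauss !expz mulrACA -!expfzDr ?oppr_eq0 ?oner_eq0 //.
have -> : u + v + (u - v + 1) = u + u + 1 by lia.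
have -> : (tri (u + v))%:Z + (tri (u - v + 1))%:Z = u * u + (v * v - v).
  by have := tri_double (u + v); have := tri_double (u - v + 1); nia.
rewrite [(-1) ^ _]expfzDr ?oppr_eq0 ?oner_eq0 // sign_even expr1z mul1r.
by rewrite expfzDr // mulN1r.
Qed.

Definition sumU N (x : C) := \sum_(u <- zrange N) p ^ (u * u - u) * x ^ (u + u).
Definition sumV N (x : C) := \sum_(u <- zrange N) p ^ (u * u) * x ^ (u + u).

(** An exhaustion of the pairs of integers by boxes in the coordinates u, v, one for each parity of
    the sum. On it the double sum factorises exactly at every finite stage. *)
Definition diag_pairs N := [seq (u + v, u - v) | u <- zrange N, v <- zrange N]
   ++ [seq (u + v, u - v + 1) | u <- zrange N, v <- zrange N].

Lemma diag_pairs_uniq N : uniq (diag_pairs N).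
Proof.
rewrite /diag_pairs cat_uniq; apply/and3P; split.
- apply: allpairs_uniq; rewrite ?zrange_uniq // => -[u v] [u' v'] _ _ [e1 e2].
  by congr pair; lia.
- apply/hasPn => k /allpairsP[[u v] [_ _ ->]] {k}.
  apply/negP => /allpairsP[[u1 v1] [_ _ []]]; rewrite /fst /snd; lia.
- apply: allpairs_uniq; rewrite ?zrange_uniq // => -[u v] [u' v'] _ _ [e1 e2].
  by congr pair; lia.
Qed.

Lemma diag_pairs_exhaust i : \forall N \near \oo, i \in diag_pairs N.
Proof.
case: i => m n; near=> N.
have hN : (absz m + absz n + 2 <= N)%N by near: N; exact: nbhs_infty_ge.
rewrite mem_cat; apply/orP.
have [k [hk|hk]] : exists k : int, m + n = k * 2 \/ m + n = k * 2 + 1.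
  exists ((m + n) %/ 2)%Z; have := divz_eq (m + n) 2.
  have := modz_ge0 (m + n) (isT : (2 : int) != 0).
  have := ltz_pmod (m + n) (isT : (0 < 2 :> int)); lia.
- left; apply/allpairsP; exists (k, m - k); rewrite /= !mem_zrange; split; [lia|lia|].
  by congr pair; lia.
- right; apply/allpairsP; exists (k, m - k); rewrite /= !mem_zrange; split; [lia|lia|].
  by congr pair; lia.
Unshelve. all: by end_near. Qed.

Lemma sum_diag_pairs N x y : x != 0 -> y != 0 ->
  \sum_(i <- diag_pairs N) gauss i.1 * gauss i.2 * ((x * y) ^ i.1 * (x / y) ^ i.2)
  = sumU N x * sumV N y - x / y * (sumV N x * sumU N y).
Proof.
move=> x0 y0; rewrite big_cat !big_allpairs_dep /=; congr (_ + _).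
  rewrite mulr_suml; apply: eq_bigr => u _; rewrite mulr_sumr; apply: eq_bigr => v _.
  by rewrite gauss_even exprz_even //; ring.
rewrite mulr_suml mulr_sumr -sumrN; apply: eq_bigr => u _.
rewrite !mulr_sumr -sumrN; apply: eq_bigr => v _.
by rewrite gauss_odd exprz_odd //; move: (x / y) => t; ring.
Qed.

Lemma cvg_absz_shift (g : nat -> nat) (c : nat) (f : nat -> C) (l : C) :
  (forall n, (n <= g n + c)%N) -> (f : nat -> C^o) @ \oo --> (l : C^o) ->
  (fun n => f (g n) : C^o) @ \oo --> (l : C^o).
Proof.
move=> hg fl; apply: (@cvg_comp _ _ _ g (f : nat -> C^o) _ \oo) => //.
move=> P [M _ hP]; exists (M + c)%N => // n /= hn; apply: hP => /=.
by have := hg n; lia.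
Qed.

Lemma lcoef_cvg (m : int) :
  (fun N => lcoef N m : C^o) @ \oo --> (gauss m / qinf r1 p : C^o).
Proof.
have ph := @qinfP _ _ r1 p.
have ph0 : qinf r1 p != 0.
  apply/eqP => /qinf_eq0[j hj].
  have := phi_neq0 r1 j.+1; rewrite /qpoch big_ord_recr /= hj subrr mulr0.
  by rewrite eqxx.
rewrite /lcoef; apply: cvgC_M; first exact: cvgC_cst.
have -> : (qinf r1 p)^-1 = qinf r1 p / (qinf r1 p * qinf r1 p).
  by field.
apply: cvgC_M.
  by apply: (@cvg_absz_shift (fun N => N + N)%N 0); [move=> n; lia|exact: ph].
apply: cvgC_V; first by rewrite mulf_neq0.
apply: cvgC_M.
  by apply: (@cvg_absz_shift (fun N => absz (N%:Z + m)%R) `|m|%N); [move=> n; lia|exact: ph].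
by apply: (@cvg_absz_shift (fun N => absz (N%:Z - m)%R) `|m|%N); [move=> n; lia|exact: ph].
Qed.

Lemma normc_gauss m : normc (gauss m) = r ^+ tri m.
Proof. by rewrite normcM normcXz normcN normc1 exp1rz mul1r normcX. Qed.

(** The numerator is bounded above and the two denominators are bounded away from zero, uniformly in
    their lengths. *)
Lemma lcoef_bound : exists2 K : R, 0 <= K & forall N m, normc (lcoef N m) <= K * r ^+ tri m.
Proof.
have [|d d0 hd] := qpoch_lower r1 (y := p).
  move=> j; have := phi_neq0 r1 j.+1; rewrite /qpoch big_ord_recr /= mulf_eq0.
  by rewrite negb_or => /andP[].
pose M := expR (normc p / (1 - r)).
exists (M / (d * d)); first by rewrite divr_ge0 ?expR_ge0 // mulr_ge0 // ltW.
move=> N m; rewrite /lcoef normcM normc_gauss mulrC ler_wpM2r ?exprn_ge0 ?normc_ge0 //.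
rewrite normcM normcV normcM ler_pM ?normc_ge0 ?invr_ge0 ?mulr_ge0 ?normc_ge0 ?qpoch_le //.
rewrite lef_pV2 ?posrE ?mulr_gt0 // ?(lt_le_trans d0) //.
by rewrite ler_pM // ltW.
Qed.

(** Along square boxes the double sum is the product of two truncated theta functions, along
    [diag_pairs] it is the determinant of [sumU] and [sumV]; [tannery] shows that the two become
    equal in the limit. *)
Lemma theta_pair_lim x y : x != 0 -> y != 0 ->
  (fun N => (qinf r1 p)^-1 ^+ 2
     * (sumU N x * sumV N y - x / y * (sumV N x * sumU N y)) : C^o) @ \oo
  --> (theta p (x * y) * theta p (x / y) : C^o).
Proof.
move=> x0 y0; have xy0 : x * y != 0 by rewrite mulf_neq0.
have xy1 : x / y != 0 by rewrite mulf_neq0 ?invr_eq0.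
have [K K0 hK] := lcoef_bound.
have r01 : 0 <= r < 1 by rewrite normc_ge0.
have pos z : z != 0 -> 0 < normc z by rewrite lt0r normc_eq0 normc_ge0 => ->.
have [K1 h1] := gauss_sum_le r01 (pos _ xy0).
have [K2 h2] := gauss_sum_le r01 (pos _ xy1).
pose a N (i : int * int) := lcoef N i.1 * (x * y) ^ i.1 * (lcoef N i.2 * (x / y) ^ i.2).
pose l (i : int * int) := gauss i.1 / qinf r1 p * (x * y) ^ i.1
   * (gauss i.2 / qinf r1 p * (x / y) ^ i.2).
pose b (i : int * int) := (K * (r ^+ tri i.1 * normc (x * y) ^ i.1))
   * (K * (r ^+ tri i.2 * normc (x / y) ^ i.2)).
have b0 z i : z != 0 -> 0 <= K * (r ^+ tri i * normc z ^ i).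
  move=> z0; rewrite mulr_ge0 // mulr_ge0 ?exprn_ge0 ?normc_ge0 //.
  by rewrite exprz_ge0 // normc_ge0.
have al i : (a ^~ i : nat -> C^o) @ \oo --> (l i : C^o).
  by apply: cvgC_M; apply: cvgC_M; try exact: cvgC_cst; exact: lcoef_cvg.
have ab N i : normc (a N i) <= b i.
  rewrite /a (normcM (lcoef N i.1 * _)) (normcM (lcoef N i.1)) (normcM (lcoef N i.2)).
  rewrite (normcXz (x * y)) (normcXz (x / y)) /b ler_pM ?mulr_ge0 ?normc_ge0 ?exprz_ge0 ?normc_ge0 //.
    by rewrite mulrA ler_wpM2r ?exprz_ge0 ?normc_ge0.
  by rewrite mulrA ler_wpM2r ?exprz_ge0 ?normc_ge0.
have := @tannery R _ (fun N => [seq (i, j) | i <- zrange N, j <- zrange N]) diag_pairs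
  a l b (K * K1 * (K * K2)).
move=> /(_ _ (fun N => diag_pairs_uniq N) _ diag_pairs_exhaust ab _ al _) T.
have {T} : (fun N => \sum_(i <- [seq (i, j) | i <- zrange N, j <- zrange N]) a N i
   - \sum_(i <- diag_pairs N) l i : C^o) @ \oo --> (0 : C^o).
  apply: T.
  - by move=> N; rewrite allpairs_uniq ?zrange_uniq // => -[? ?] [? ?].
  - move=> [i j]; near=> N; apply: allpairs_f; rewrite mem_zrange.
      by near: N; exact: nbhs_infty_ge.
    by near: N; exact: nbhs_infty_ge.
  - by move=> i; apply: normc_lim_le (al i) (ab ^~ i).
  - move=> s us; apply: (@pair_sum_le _ _ _ (fun i => K * (r ^+ tri i * normc (x * y) ^ i))
       (fun i => K * (r ^+ tri i * normc (x / y) ^ i))) us => [i|i|t ut|t ut].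
    + exact: b0.
    + exact: b0.
    + by rewrite -mulr_sumr ler_wpM2l // h1.
    + by rewrite -mulr_sumr ler_wpM2l // h2.
have eA N : \sum_(i <- [seq (i, j) | i <- zrange N, j <- zrange N]) a N i
   = qpoch p (x * y) N * qpoch p (p / (x * y)) N
     * (qpoch p (x / y) N * qpoch p (p / (x / y)) N).
  rewrite !theta_laurent // big_allpairs mulr_suml; apply: eq_bigr => i _.
  by rewrite mulr_sumr; apply: eq_bigr.
have eB N : \sum_(i <- diag_pairs N) l i = (qinf r1 p)^-1 ^+ 2
     * (sumU N x * sumV N y - x / y * (sumV N x * sumU N y)).
  rewrite -sum_diag_pairs // mulr_sumr; apply: eq_bigr => i _; rewrite /l; ring.
under eq_fun do rewrite eA eB.
have hth : (fun N => qpoch p (x * y) N * qpoch p (p / (x * y)) N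
     * (qpoch p (x / y) N * qpoch p (p / (x / y)) N) : C^o) @ \oo
     --> (theta p (x * y) * theta p (x / y) : C^o).
  rewrite !(thetaE r1).
  by apply: cvgC_M; apply: cvgC_M; exact: qinfP.
move=> h0; have := cvgC_B _ hth h0; rewrite subr0 => hh.
suff -> : (fun N => (qinf r1 p)^-1 ^+ 2
     * (sumU N x * sumV N y - x / y * (sumV N x * sumU N y)) : C^o) = (fun N => qpoch p (x * y) N * qpoch p (p / (x * y)) N
     * (qpoch p (x / y) N * qpoch p (p / (x / y)) N)
     - (qpoch p (x * y) N * qpoch p (p / (x * y)) N
     * (qpoch p (x / y) N * qpoch p (p / (x / y)) N)
     - (qinf r1 p)^-1 ^+ 2
     * (sumU N x * sumV N y - x / y * (sumV N x * sumU N y))) : C^o).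
  exact: hh.
by apply/funext => N; rewrite opprB addrCA subrr addr0.
Unshelve. all: by end_near. Qed.

(* By the Jacobi triple product for [theta (x * y)] and [theta (x / y)], after
   splitting the double sum by parity, [theta_pair x y] is up to a constant
   [(U x * V y - (x / y) * V x * U y) / x]: a rank-two alternating form, whence
   the three-term relation. The truncations of [U] and [V] satisfy it exactly. *)
Definition theta_pair (x y : C) := theta p (x * y) * theta p (x / y) / x.

Lemma theta_pair_plucker x y u v : x != 0 -> y != 0 -> u != 0 -> v != 0 ->
  theta_pair x y * theta_pair u v - theta_pair x u * theta_pair y v
  + theta_pair x v * theta_pair y u = 0.
Proof.
move=> x0 y0 u0 v0.
pose G N (x y : C) := (qinf r1 p)^-1 ^+ 2
     * (sumU N x * sumV N y - x / y * (sumV N x * sumU N y)) / x.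
have hG a b : a != 0 -> b != 0 ->
    (fun N => G N a b : C^o) @ \oo --> (theta_pair a b : C^o).
  by move=> a0 b0; apply: cvgC_M; [exact: theta_pair_lim|exact: cvgC_cst].
apply: (@cvgC_unique R (fun N => G N x y * G N u v - G N x u * G N y v + G N x v * G N y u)).
  apply: cvgC_D; first apply: cvgC_B.
  - by apply: cvgC_M; apply: hG.
  - by apply: cvgC_M; apply: hG.
  - by apply: cvgC_M; apply: hG.
have -> : (fun N => G N x y * G N u v - G N x u * G N y v + G N x v * G N y u : C^o) = (fun=> 0 : C^o).
  by apply/funext => N; apply: (rank2_plucker (sumU N) (sumV N)).
exact: cvgC_cst.
Qed.
End ThreeTerm.

(** * Passage to theta Pochhammer symbols *)

Section ComplexExponential.
Variable R : realType.
Local Notation C := (R[i]).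
Local Notation normc := (@ComplexField.Normc.normc R).

Definition cexp (u : C) : C :=
  (expR (complex.Re u))%:C * (cos (complex.Im u) +i* sin (complex.Im u)).

Lemma cexpD u v : cexp (u + v) = cexp u * cexp v.
Proof.
case: u v => [a b] [a' b']; rewrite /cexp /= expRD rmorphM /= cosD sinD.
rewrite [RHS]mulrACA; congr (_ * _).
by apply/eqP; rewrite eq_complex /=; apply/andP; split; apply/eqP; ring.
Qed.

Lemma cexp0 : cexp 0 = 1.
Proof.
rewrite /cexp /= expR0 cos0 sin0; apply/eqP; rewrite eq_complex /=.
by apply/andP; split; apply/eqP; ring.
Qed.

Lemma cexp_neq0 u : cexp u != 0.
Proof.
have : cexp u * cexp (- u) = 1 by rewrite -cexpD subrr cexp0.
by apply: contra_eq_neq => ->; rewrite mul0r eq_sym oner_neq0.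
Qed.

Lemma cexpN u : cexp (- u) = (cexp u)^-1.
Proof.
apply: (mulfI (cexp_neq0 u)); rewrite -cexpD subrr cexp0 divff //.
exact: cexp_neq0.
Qed.

Lemma cexpB u v : cexp (u - v) = cexp u / cexp v.
Proof. by rewrite cexpD cexpN. Qed.

Lemma cexpMn (k : nat) u : cexp (k%:R * u) = cexp u ^+ k.
Proof.
elim: k => [|k IH]; first by rewrite mul0r cexp0 expr0.
by rewrite -natr1 mulrDl mul1r cexpD IH exprSr.
Qed.

Lemma cexpMz (k : int) u : cexp (k%:~R * u) = cexp u ^ k.
Proof.
case: k => k; first by rewrite -pmulrn cexpMn.
by rewrite NegzE mulrNz mulNr cexpN -pmulrn cexpMn exprnN.
Qed.

Lemma cexp_surj (x : C) : x != 0 -> exists u, cexp u = x.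
Proof.
move=> x0; pose t := normc x.
have t0 : 0 < t by rewrite lt0r normc_eq0 x0 normc_ge0.
case: x @t t0 x0 => a b t t0 x0.
have t2 : a ^+ 2 + b ^+ 2 = t ^+ 2.
  by rewrite /t /= sqr_sqrtr // addr_ge0 // sqr_ge0.
clearbody t; pose a' := a / t.
have a1 : -1 <= a' <= 1.
  have : a' ^+ 2 <= 1.
    rewrite /a' exprMn exprVn ler_pdivrMr ?exprn_gt0 // mul1r -t2 lerDl; exact: sqr_ge0.
  by clearbody a'; rewrite expr2 => h; apply/andP; split; nra.
(* The angle is [acos a'] or its opposite, according to the sign of the imaginary part. *)
have [y [hc hs]] : exists y, cos y = a' /\ sin y = b / t.
  have [/andP[p0 ppi] hc] := acos_def a1.
  have hs2 : sin (acos a') ^+ 2 = (b / t) ^+ 2.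
    rewrite sin2cos2 hc /a' !exprMn exprVn; have -> : b ^+ 2 = t ^+ 2 - a ^+ 2.
      by rewrite -t2; ring.
    by field; rewrite gt_eqF.
  move/eqP: hs2; rewrite eqf_sqr => /orP[/eqP hs|/eqP hs].
    by exists (acos a').
  by exists (- acos a'); rewrite cosN sinN hs opprK.
exists (ln t +i* y); rewrite /cexp /= lnK ?posrE // hc hs /a'.
apply/eqP; rewrite eq_complex /=; apply/andP; split; apply/eqP; field; by rewrite gt_eqF.
Qed.
End ComplexExponential.

(** The three-term relation at p = 0, where the argument by Laurent polynomials, which uses inverse
    powers of [p], does not apply. *)
Lemma rational_plucker (K : fieldType) (x y u v : K) :
  x != 0 -> y != 0 -> u != 0 -> v != 0 ->
  (1 - x * y) * (1 - x / y) / x * ((1 - u * v) * (1 - u / v) / u)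
  - (1 - x * u) * (1 - x / u) / x * ((1 - y * v) * (1 - y / v) / y)
  + (1 - x * v) * (1 - x / v) / x * ((1 - y * u) * (1 - y / u) / y) = 0.
Proof. by move=> x0 y0 u0 v0; field; rewrite x0 y0 u0 v0. Qed.

Section OddTheta.
Variables (R : realType) (p : R[i]).
Local Notation C := (R[i]).
Local Notation normc := (@ComplexField.Normc.normc R).
Hypothesis r1 : normc p < 1.

(* An odd function, unlike [u |-> theta p (cexp u)]. *)
Definition br (u : C) : C := cexp (- (u / 2)) * theta p (cexp u).

Lemma thetaE_br u : theta p (cexp u) = cexp (u / 2) * br u.
Proof. by rewrite /br mulrA -cexpD subrr cexp0 mul1r. Qed.

Lemma brN u : br (- u) = - br u.
Proof.
rewrite /br cexpN thetaV ?cexp_neq0 // -cexpN mulrA mulrN -cexpD mulNr.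
by congr (- (cexp _ * _)); field.
Qed.

Lemma br_eq0 u : (br u == 0) = (theta p (cexp u) == 0).
Proof. by rewrite mulf_eq0 (negbTE (cexp_neq0 _)). Qed.

Lemma theta_pair_plucker_all x y u v : x != 0 -> y != 0 -> u != 0 -> v != 0 ->
  theta_pair p x y * theta_pair p u v - theta_pair p x u * theta_pair p y v
  + theta_pair p x v * theta_pair p y u = 0.
Proof.
have [->|p0] := eqVneq p 0; last exact: theta_pair_plucker.
move=> x0 y0 u0 v0; rewrite /theta_pair !theta0.
exact: (@rational_plucker C).
Qed.

Lemma hs_br x y : hs br x y = theta_pair p (cexp x) (cexp y).
Proof.
rewrite /hs /br /theta_pair -cexpD -cexpB mulrACA -cexpD mulrC; congr (_ * _).
by rewrite -cexpN; congr cexp; field.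
Qed.

Lemma br_plucker x y u v :
  hs br x y * hs br u v - hs br x u * hs br y v + hs br x v * hs br y u = 0.
Proof. by rewrite !hs_br theta_pair_plucker_all ?cexp_neq0. Qed.
End OddTheta.

Lemma sum_triangle_lt (K : comPzRingType) n (x : 'I_n -> K) :
  \sum_(j < n) \sum_(k < n | (j < k)%N) (x j + x k) = (n%:R - 1) * \sum_k x k.
Proof.
have /= := big_square +%R (fun j k : 'I_n => x k).
under [X in _ = _ + X -> _]eq_bigr do under eq_bigr do rewrite addrC.
move=> /esym/(canRL (addKr _)) ->.
by rewrite sumr_const card_ord mulrBl mul1r mulr_natl addrC.
Qed.

Lemma sum_triangle_le (K : comPzRingType) n (x : 'I_n -> K) :
  \sum_(j < n) \sum_(k < n | (j <= k)%N) (x j + x k) = (n%:R + 1) * \sum_k x k.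
Proof.
rewrite (big_triangle +%R (fun j k => x j + x k)) /= sum_triangle_lt big_split /=.
ring.
Qed.

Lemma mulf_div3 (K : fieldType) (x y t x' y' t' : K) :
  x * (y * t) / (x' * (y' * t')) = x * y / (x' * y') * (t / t').
Proof. rewrite !invfM; move: x'^-1 y'^-1 t'^-1 => u v w; ring. Qed.

Lemma prod_split2 (K : comPzRingType) n (Q : 'I_n -> pred 'I_n) (G H : 'I_n -> 'I_n -> K) :
  \prod_(j < n) \prod_(k < n | Q j k) (G j k * H j k)
  = (\prod_(j < n) \prod_(k < n | Q j k) G j k) * (\prod_(j < n) \prod_(k < n | Q j k) H j k).
Proof. by rewrite -big_split; apply: eq_bigr => j _; rewrite -big_split. Qed.

(** The [e1], [e2], ... stand for the exponential factors by which theta products differ from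
    products of [br]; on each summand they multiply to 1. *)
Lemma regroup_lhs (K : fieldType) (e1 e2 e3 e4 e5 V T C A S : K) :
  e1 * e2 * e3 * e4 * e5 = 1 ->
  e1 * V * (e2 * T) * (e3 * (A * C)) * (e4 * S) * e5 = V * (T * C) * A * S.
Proof.
by move=> h; rewrite -[RHS]mul1r -[X in _ = X * _]h; ring.
Qed.

Lemma regroup_rhs (K : fieldType) (e1 e2 e3 e4 e5 e6 e7 V T L Z S A : K) :
  e1 * e2 * e3 * e4 * e5 * e6 * e7 = 1 ->
  e1 * V * (e2 * T) * (e3 * L) * (e4 * Z) * e5 * (e6 * S) * (e7 * A) = V * T * L * Z * S * A.
Proof.
by move=> h; rewrite -[RHS]mul1r -[X in _ = X * _]h; ring.
Qed.

Lemma regroup3 (K : fieldType) (e1 e2 e3 x y z : K) :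
  e1 * x * (e2 * y * (e3 * z)) = e1 * e2 * e3 * (x * y * z).
Proof. by ring. Qed.

Lemma regroup4 (K : fieldType) (e1 e2 e3 e4 x y z t : K) :
  e1 * x * (e2 * y * (e3 * z * (e4 * t))) = e1 * e2 * e3 * e4 * (x * y * z * t).
Proof. by ring. Qed.

Lemma regroup_prefactor (K : fieldType) (e1 e2 e3 e4 X Y Z T : K) :
  e2 != 0 -> e4 != 0 -> e1 * e3 = e2 * e4 ->
  e1 * X / (e2 * Y) * (e3 * Z / (e4 * T)) = X / Y * (Z / T).
Proof.
move=> h2 h4 e; rewrite !invfM; move: Y^-1 T^-1 => u v.
transitivity (e1 * e3 / (e2 * e4) * (X * u * (Z * v))); first by field; rewrite h2 h4.
by rewrite e; field; rewrite h2 h4.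
Qed.

(* The logarithm of the factor relating a theta Pochhammer symbol of length [k]
   to the one formed with the odd function [br]. *)
Definition pexp (K : numFieldType) (eta u k : K) := (k * u + (k ^+ 2 - k) / 2 * eta) / 2.

(** The exponential factors of the prefactor cancel between numerator and denominator. The lengths
    m_j + m_k contribute the cross terms collected in [P]; these match the square of [N], and
    balancing does the rest. *)
Lemma prefactor_exponent (K : numFieldType) n (x c : 'I_n -> K) (eta B b4 b5 b6 : K) :
  let N := \sum_k x k in B + b4 + b5 + b6 + N * eta = eta ->
  \sum_(j < n) \sum_(k < n) pexp eta (c j + c k) (x k)
  + (pexp eta (B + b4) N + pexp eta (B + b5) N + pexp eta (b4 + b5) N)
  = \sum_(j < n) \sum_(k < n | (j < k)%N) pexp eta (c j + c k) (x j + x k)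
  + \sum_(k < n) (pexp eta (c k + B) (x k) + pexp eta (c k + b4) (x k)
      + pexp eta (c k + b5) (x k) + pexp eta (eta - x k * eta - (c k + b6)) (x k)).
Proof.
move=> N bal; rewrite (big_square +%R (fun j k => pexp eta (c j + c k) (x k))) /=.
set P := \sum_(j < n) \sum_(k < n | (j < k)%N) x j * x k.
have -> : \sum_(j < n) \sum_(k < n | (j < k)%N)
    (pexp eta (c j + c k) (x k) + pexp eta (c k + c j) (x j))
  = \sum_(j < n) \sum_(k < n | (j < k)%N) pexp eta (c j + c k) (x j + x k) - P * eta / 2.
  rewrite !mulr_suml -sumrB; apply: eq_bigr => j _.
  rewrite !mulr_suml -sumrB; apply: eq_bigr => k _; by rewrite /pexp; field.
have N2 : N ^+ 2 = \sum_j x j ^+ 2 + 2 * P.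
  rewrite expr2 mulr_suml; under eq_bigr do rewrite mulr_sumr.
  rewrite (big_square +%R (fun j k => x j * x k)) /=.
  rewrite /P mulr_sumr; congr (_ + _); apply: eq_bigr => j _.
  by rewrite mulr_sumr; apply: eq_bigr => k _; ring.
have E : \sum_j pexp eta (c j + c j) (x j)
  = \sum_(k < n) (pexp eta (c k + B) (x k) + pexp eta (c k + b4) (x k)
      + pexp eta (c k + b5) (x k) + pexp eta (eta - x k * eta - (c k + b6)) (x k))
    + (eta / 2 - (B + b4 + b5 - b6)) / 2 * N - eta / 4 * \sum_j x j ^+ 2.
  rewrite /N !mulr_sumr -sumrN -!big_split; apply: eq_bigr => k _.
  by rewrite /pexp /=; field.
rewrite E; have -> : \sum_j x j ^+ 2 = N ^+ 2 - 2 * P by rewrite N2 addrK.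
have b6E : b6 = eta - N * eta - B - b4 - b5 by apply: (eq_lin bal); ring.
by rewrite b6E /pexp; field.
Qed.

(** * Multiplicative and logarithmic form of the summands *)

Section Summands.
Variables (R : realType) (p q : R[i]) (n : nat) (m : 'I_n -> nat).
Implicit Types (a b c d e f g lam : R[i]) (z : 'I_n -> R[i]) (y : 'I_n -> nat).

(** Both sides are named as functions of the parameters so that they can be evaluated at perturbed
    ones; [lam] is an argument of its own on the right because it is perturbed with its own
    exponent. *)
Definition lhs_summand a b c d e f g z y :=
  vandermonde p (fun k => z k * q ^+ y k) / vandermonde p z
     * (\prod_(j < n) \prod_(k < n | (j <= k)%N)
          (theta p (a * z j * z k * q ^+ (y j + y k)) / theta p (a * z j * z k)))
     * (\prod_(j < n) \prod_(k < n)
          (epochs p q [:: q ^- m j * z k / z j; a * z j * z k] (y k)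
           / epochs p q [:: q * z k / z j; a * q ^+ (1 + m j) * z j * z k]
          (y k)))
     * (\prod_(k < n)
          (epochs p q [:: b * z k; c * z k; d * z k; e * z k; f * z k; g * z k]
          (y k)
           / epochs p q [:: a * q * z k / b; a * q * z k / c; a * q * z k / d;
          a * q * z k / e; a * q * z k / f; a * q * z k / g]
          (y k)))
     * q ^+ wt y.

Definition rhs_prefactor a lam e f g z :=
  (\prod_(j < n) \prod_(k < n) epoch p q (a * q * z j * z k) (m k))
  / (\prod_(j < n) \prod_(k < n | (j < k)%N)
       epoch p q (a * q * z j * z k) (m j + m k))
  * (epochs p q [:: lam * q / e; lam * q / f; a * q / (e * f)] (wt m)
     / \prod_(k < n)
         epochs p q [:: lam * q * z k; a * q * z k / e; a * q * z k / f;
          q ^- m k * g / (a * z k)] (m k)).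

Definition rhs_summand a b c d e f g lam z y :=
  vandermonde p (fun k => z k * q ^+ y k) / vandermonde p z
       * (\prod_(k < n)
            (theta p (lam * z k * q ^+ (y k + wt y)) / theta p (lam * z k)))
       * (epochs p q [:: lam * b / a; lam * c / a; lam * d / a] (wt y)
          / epochs p q [:: lam * q / e; lam * q / f; lam * q / g] (wt y))
       * (\prod_(j < n)
            (epoch p q (lam * z j) (wt y)
          / epoch p q (lam * q ^+ (1 + m j) * z j) (wt y)))
       * q ^+ wt y
       * (\prod_(k < n)
            (epochs p q [:: e * z k; f * z k; g * z k] (y k)
          / epochs p q [:: a * q * z k / b; a * q * z k / c;
          a * q * z k / d] (y k)))
       * (\prod_(j < n) \prod_(k < n)
            (epoch p q (q ^- m j * z k / z j) (y k)
          / epoch p q (q * z k / z j) (y k))).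
End Summands.

Section Conversion.
Variables (R : realType) (p : R[i]).
Local Notation C := (R[i]).
Local Notation s := (br p).
Variables (n : nat) (m : 'I_n -> nat) (zeta : 'I_n -> C) (eta dl b1 b2 b3 b4 b5 b6 : C).
Local Notation spoch := (shifted_poch s eta).
Let q := cexp eta.
(** Thus [dl] is half the logarithm of aq. With b = exp(dl - b1) one has aq / b = exp(dl + b1), so
    numerator and denominator symbols acquire the opposite arguments [c k - b1] and [c k + b1]. *)
Let a := cexp (2 * dl - eta).
Let z k := cexp (zeta k).
Let c k := zeta k + dl.
Let N := (\sum_(k < n) m k)%N.
Let B := b1 + b2 + b3.
Let lam := cexp (dl + B - eta).
Hypothesis bal : B + b4 + b5 + b6 + N%:R * eta = eta.

Let eD := @cexpD R.
Let eB := @cexpB R.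
Let eN := @cexpN R.
Let eMn := @cexpMn R.

Lemma epoch_br u v k : v = cexp u ->
  epoch p q v k = cexp ((k%:R * u + (k%:R ^+ 2 - k%:R) / 2 * eta) / 2) * spoch u k.
Proof.
move=> ->; rewrite /epoch /shifted_poch; elim: k => [|k IH].
  by rewrite !big_ord0 mulr1 -[LHS]cexp0; congr cexp; field.
rewrite !big_ord_recr /= IH -cexpMn -cexpD thetaE_br mulrACA -cexpD.
by congr (cexp _ * _); rewrite -natr1; field.
Qed.

Lemma epoch_ratio u v x w k : x = cexp u -> w = cexp v ->
  epoch p q x k / epoch p q w k = cexp (k%:R * (u - v) / 2) * (spoch u k / spoch v k).
Proof.
move=> hx hw; rewrite (epoch_br _ hx) (epoch_br _ hw) invfM mulrACA -cexpB.
by congr (cexp _ * _); field.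
Qed.

Lemma prod_cexp (I : Type) (r : seq I) (Q : pred I) (F : I -> C) :
  \prod_(i <- r | Q i) cexp (F i) = cexp (\sum_(i <- r | Q i) F i).
Proof. by rewrite (big_morph _ (@cexpD R) (@cexp0 R)). Qed.

Lemma prod_pull (F G H : 'I_n -> C) : (forall k, F k = cexp (G k) * H k) ->
  \prod_(k < n) F k = cexp (\sum_(k < n) G k) * \prod_(k < n) H k.
Proof.
move=> e; under eq_bigr do rewrite e.
by rewrite big_split /= prod_cexp.
Qed.

Lemma prod_cexp2 (Q : 'I_n -> pred 'I_n) (F : 'I_n -> 'I_n -> C) :
  \prod_(j < n) \prod_(k < n | Q j k) cexp (F j k)
  = cexp (\sum_(j < n) \sum_(k < n | Q j k) F j k).
Proof. by under eq_bigr do rewrite prod_cexp; rewrite prod_cexp. Qed.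

Lemma vand_br y :
  vandermonde p (fun k => z k * q ^+ y k) / vandermonde p z
  = cexp ((n%:R - 1) * (wt y)%:R * eta / 2) * vand s eta c y.
Proof.
rewrite /vandermonde /vand -prodfV -big_split /=.
transitivity (\prod_(j < n) \prod_(k < n | (j < k)%N) (cexp ((y j)%:R * eta / 2 + (y k)%:R * eta / 2)
   * (s (c k - c j + (y k)%:R * eta - (y j)%:R * eta) / s (c k - c j)))).
  apply: eq_bigr => j _; rewrite -prodfV -big_split /=; apply: eq_bigr => k _.
  have -> : z k * q ^+ y k / (z j * q ^+ y j) = cexp (c k - c j + (y k)%:R * eta - (y j)%:R * eta).
    by rewrite /z /q /c -!cexpMn -!cexpD -cexpB; congr cexp; ring.
  have -> : z k / z j = cexp (c k - c j) by rewrite /z /c -cexpB; congr cexp; ring.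
  rewrite !thetaE_br /z /q -cexpMn -(eD (zeta j)) mulf_div3 -!eD -eB.
  by congr (cexp _ * _); field.
rewrite prod_split2 prod_cexp2; congr (cexp _ * _).
by rewrite sum_triangle_lt -!mulr_suml natr_sum; ring.
Qed.

(** With as many symbols above as below, the parts of the exponents that are quadratic in [k]
    cancel. *)
Lemma epochs_ratio (us vs xs ws : seq C) k : size us = size vs ->
  xs = map (@cexp R) us -> ws = map (@cexp R) vs ->
  epochs p q xs k / epochs p q ws k
  = cexp (k%:R * (\sum_(u <- us) u - \sum_(v <- vs) v) / 2)
    * (\prod_(u <- us) spoch u k / \prod_(v <- vs) spoch v k).
Proof.
move=> e -> ->; rewrite /epochs !big_map.
elim: us vs e => [|u us IH] [|v vs] //= => [_|[e]].
  by rewrite !big_nil subrr mulr0 mul0r cexp0 [RHS]mul1r.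
rewrite !big_cons !invfM mulrACA (epoch_ratio k erefl erefl).
rewrite IH // mulrACA -eD; congr (cexp _ * _); first by field. by rewrite mulrACA.
Qed.

Lemma box_monomials j k (y : 'I_n -> nat) :
  [/\ a * z j * z k = cexp (c j + c k - eta),
      a * z j * z k * q ^+ (y j + y k) = cexp (c j + c k - eta + (y j + y k)%:R * eta),
      a * q ^+ (1 + m j) * z j * z k = cexp (c j + c k + (m j)%:R * eta),
      q ^- m j * z k / z j = cexp (c k - c j - (m j)%:R * eta)
    & q * z k / z j = cexp (c k - c j + eta)].
Proof.
split; rewrite /a /q /z /c -?eMn -?eN -?eD; congr cexp; rewrite ?natrD; ring.
Qed.

Lemma row_monomials k (y : 'I_n -> nat) b :
  [/\ cexp (dl - b) * z k = cexp (c k - b),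
      a * q * z k / cexp (dl - b) = cexp (c k + b),
      lam * z k = cexp (c k + B - eta),
      lam * z k * q ^+ (y k + wt y) = cexp (c k + B - eta + (y k + wt y)%:R * eta)
    & lam * q ^+ (1 + m k) * z k = cexp (c k + B + (m k)%:R * eta)].
Proof.
split; rewrite /lam /a /q /z /c -?eMn -?eN -?eD; congr cexp; rewrite ?natrD; ring.
Qed.

Lemma lhs_summand_br (y : 'I_n -> nat) :
  lhs_summand p q m a (cexp (dl - b1)) (cexp (dl - b2)) (cexp (dl - b3))
    (cexp (dl - b4)) (cexp (dl - b5)) (cexp (dl - b6)) z y
  = lsummand s eta m c b1 b2 b3 b4 b5 b6 y.
Proof.
rewrite /lhs_summand vand_br /lsummand /cblock /ablock; set r := (\sum_(k < n) y k)%N.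
have -> : \prod_(j < n) \prod_(k < n | (j <= k)%N)
          (theta p (a * z j * z k * q ^+ (y j + y k)) / theta p (a * z j * z k))
  = cexp ((n%:R + 1) * r%:R * eta / 2) * \prod_(j < n) \prod_(k < n | (j <= k)%N)
      (s (c j + c k - eta + (y j + y k)%:R * eta) / s (c j + c k - eta)).
  transitivity (\prod_(j < n) \prod_(k < n | (j <= k)%N)
    (cexp ((y j)%:R * eta / 2 + (y k)%:R * eta / 2) *
      (s (c j + c k - eta + (y j + y k)%:R * eta) / s (c j + c k - eta)))).
    apply: eq_bigr => j _; apply: eq_bigr => k _.
    have [-> -> _ _ _] := box_monomials j k y.
    rewrite !thetaE_br invfM mulrACA -eB; congr (cexp _ * _).
    by rewrite natrD; field.
  rewrite prod_split2 prod_cexp2; congr (cexp _ * _).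
  by rewrite sum_triangle_le -!mulr_suml natr_sum; ring.
have -> : \prod_(j < n) \prod_(k < n)
          (epochs p q [:: q ^- m j * z k / z j; a * z j * z k] (y k)
           / epochs p q [:: q * z k / z j; a * q ^+ (1 + m j) * z j * z k] (y k))
  = cexp (- ((N + n)%:R * r%:R * eta)) *
   ((\prod_(j < n) \prod_(k < n)
       (spoch (c k - c j - (m j)%:R * eta) (y k) / spoch (c k - c j + eta) (y k))) *
    (\prod_(j < n) \prod_(k < n)
       (spoch (c j + c k - eta) (y k) / spoch (c j + c k + (m j)%:R * eta) (y k)))).
  rewrite -prod_split2.
  transitivity (\prod_(j < n) \prod_(k < n)
    (cexp (- ((m j + 1)%:R * (y k)%:R * eta)) *
      (spoch (c k - c j - (m j)%:R * eta) (y k) / spoch (c k - c j + eta) (y k)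
      * (spoch (c j + c k - eta) (y k) / spoch (c j + c k + (m j)%:R * eta) (y k))))).
    apply: eq_bigr => j _; apply: eq_bigr => k _.
    have [e1 _ e2 e3 e4] := box_monomials j k y.
    rewrite e1 e2 e3 e4 (@epochs_ratio [:: c k - c j - (m j)%:R * eta; c j + c k - eta]
      [:: c k - c j + eta; c j + c k + (m j)%:R * eta] _ _ _ erefl erefl erefl).
    rewrite !big_cons !big_nil !mulr1; congr (cexp _ * _).
      by rewrite natrD; field.
    by rewrite invfM mulrACA.
  rewrite (prod_split2 (fun _ => xpredT) (fun j k => cexp _)) /=; congr (_ * _).
  apply: etrans (prod_cexp2 (fun _ => xpredT) _) _; congr cexp.
  rewrite natrD -[n in RHS]card_ord -sum1_card !natr_sum.
  rewrite -big_split /= !mulr_suml -sumrN; apply: eq_bigr => j _.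
  by rewrite sumrN -mulr_suml -mulr_sumr natrD.
have -> : \prod_(k < n)
          (epochs p q [:: cexp (dl - b1) * z k; cexp (dl - b2) * z k; cexp (dl - b3) * z k;
          cexp (dl - b4) * z k; cexp (dl - b5) * z k; cexp (dl - b6) * z k] (y k)
           / epochs p q [:: a * q * z k / cexp (dl - b1); a * q * z k / cexp (dl - b2);
          a * q * z k / cexp (dl - b3); a * q * z k / cexp (dl - b4);
          a * q * z k / cexp (dl - b5); a * q * z k / cexp (dl - b6)] (y k))
  = cexp ((N%:R - 1) * r%:R * eta) * \prod_(k < n)
   (spoch (c k - b1) (y k) * spoch (c k - b2) (y k) * spoch (c k - b3) (y k)
   * spoch (c k - b4) (y k) * spoch (c k - b5) (y k) * spoch (c k - b6) (y k)
   / (spoch (c k + b1) (y k) * spoch (c k + b2) (y k) * spoch (c k + b3) (y k)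
   * spoch (c k + b4) (y k) * spoch (c k + b5) (y k) * spoch (c k + b6) (y k))).
  have -> : (N%:R - 1) * r%:R * eta = \sum_(k < n) (N%:R - 1) * (y k)%:R * eta.
    by rewrite -mulr_suml -mulr_sumr -natr_sum.
  apply: prod_pull => k.
  have em b : cexp (dl - b) * z k = cexp (c k - b) by have [] := row_monomials k y b.
  have ep b : a * q * z k / cexp (dl - b) = cexp (c k + b).
    by have [] := row_monomials k y b.
  rewrite (em b1) (em b2) (em b3) (em b4) (em b5) (em b6).
  rewrite (ep b1) (ep b2) (ep b3) (ep b4) (ep b5) (ep b6) (@epochs_ratio [:: c k - b1; c k - b2; c k - b3; c k - b4; c k - b5; c k - b6]
    [:: c k + b1; c k + b2; c k + b3; c k + b4; c k + b5; c k + b6] _ _ _ erefl erefl erefl).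
  rewrite !big_cons !big_nil !mulr1; congr (cexp _ * (_ / _)); rewrite ?mulrA //.
  have h : b1 + b2 + b3 + b4 + b5 + b6 = eta - N%:R * eta.
    by rewrite -[X in _ = X - _]bal /B; ring.
  transitivity (- ((y k)%:R * (b1 + b2 + b3 + b4 + b5 + b6))); first by field.
  by rewrite h; ring.
(* In units of r eta the exponents are (n - 1)/2, (n + 1)/2, -(N + n), N - 1 and, from q^|y|, 1;
   they add up to zero. *)
apply: regroup_lhs; rewrite /q -cexpMn -!eD -[RHS]cexp0; congr cexp.
by rewrite natrD; field.
Qed.

Lemma rhs_summand_br (y : 'I_n -> nat) :
  rhs_summand p q m a (cexp (dl - b1)) (cexp (dl - b2)) (cexp (dl - b3))
    (cexp (dl - b4)) (cexp (dl - b5)) (cexp (dl - b6)) lam z y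
  = rsummand s eta m c y b1 b2 b3 b4 b5 b6.
Proof.
rewrite /rhs_summand vand_br /rsummand /ablock; set r := (\sum_(k < n) y k)%N.
have h : b1 + b2 + b3 + b4 + b5 + b6 = eta - N%:R * eta.
  by rewrite -[X in _ = X - _]bal /B; ring.
have -> : \prod_(k < n) (theta p (lam * z k * q ^+ (y k + r)) / theta p (lam * z k))
  = cexp ((n%:R + 1) * r%:R * eta / 2) * \prod_(k < n)
     (s (c k + B - eta + (y k + r)%:R * eta) / s (c k + B - eta)).
  have -> : (n%:R + 1) * r%:R * eta / 2 = \sum_(k < n) ((y k)%:R + r%:R) * eta / 2.
    by rewrite -!mulr_suml big_split /= -natr_sum sumr_const card_ord -[r%:R *+ n]mulr_natl; ring.
  apply: prod_pull => k; have [_ _ e1 e2 _] := row_monomials k y b1.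
  rewrite -/r in e2; rewrite e2 e1 !thetaE_br invfM mulrACA -eB; congr (cexp _ * _).
  by rewrite natrD; field.
have -> : epochs p q [:: lam * cexp (dl - b1) / a; lam * cexp (dl - b2) / a;
      lam * cexp (dl - b3) / a] r
    / epochs p q [:: lam * q / cexp (dl - b4); lam * q / cexp (dl - b5);
      lam * q / cexp (dl - b6)] r
  = cexp ((N%:R - 1) * r%:R * eta / 2) *
    (spoch (b2 + b3) r * spoch (b1 + b3) r * spoch (b1 + b2) r
     / (spoch (B + b4) r * spoch (B + b5) r * spoch (B + b6) r)).
  have e1 b : lam * cexp (dl - b) / a = cexp (B - b).
    by rewrite /lam /a -eN -!eD; congr cexp; ring.
  have e2 b : lam * q / cexp (dl - b) = cexp (B + b).
    by rewrite /lam /q -eN -!eD; congr cexp; ring.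
  rewrite (e1 b1) (e1 b2) (e1 b3) (e2 b4) (e2 b5) (e2 b6).
  have -> : B - b1 = b2 + b3 by rewrite /B; ring.
  have -> : B - b2 = b1 + b3 by rewrite /B; ring.
  have -> : B - b3 = b1 + b2 by rewrite /B; ring.
  rewrite (@epochs_ratio [:: b2 + b3; b1 + b3; b1 + b2] [:: B + b4; B + b5; B + b6]
    _ _ _ erefl erefl erefl).
  rewrite !big_cons !big_nil !mulr1; congr (cexp _ * (_ / _)); rewrite ?mulrA //.
  transitivity (- (r%:R * (b1 + b2 + b3 + b4 + b5 + b6)) / 2); first by rewrite /B; field.
  by rewrite h; field.
have -> : \prod_(j < n) (epoch p q (lam * z j) r / epoch p q (lam * q ^+ (1 + m j) * z j) r)
  = cexp (- ((N + n)%:R * r%:R * eta) / 2) *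
    \prod_(j < n) (spoch (c j + B - eta) r / spoch (c j + B + (m j)%:R * eta) r).
  have -> : - ((N + n)%:R * r%:R * eta) / 2
     = \sum_(j < n) - ((m j + 1)%:R * r%:R * eta) / 2.
    rewrite -mulr_suml sumrN -!mulr_suml -natr_sum big_split /=.
    by rewrite sum1_card card_ord.
  apply: prod_pull => k; have [_ _ e1 _ e2] := row_monomials k y b1.
  rewrite e1 e2 (epoch_ratio r erefl erefl); congr (cexp _ * _).
  by rewrite natrD; field.
have -> : \prod_(k < n)
            (epochs p q [:: cexp (dl - b4) * z k; cexp (dl - b5) * z k; cexp (dl - b6) * z k] (y k)
          / epochs p q [:: a * q * z k / cexp (dl - b1); a * q * z k / cexp (dl - b2);
          a * q * z k / cexp (dl - b3)] (y k))
  = cexp ((N%:R - 1) * r%:R * eta / 2) * \prod_(k < n)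
     (spoch (c k - b4) (y k) * spoch (c k - b5) (y k) * spoch (c k - b6) (y k)
     / (spoch (c k + b1) (y k) * spoch (c k + b2) (y k) * spoch (c k + b3) (y k))).
  have -> : (N%:R - 1) * r%:R * eta / 2 = \sum_(k < n) (N%:R - 1) * (y k)%:R * eta / 2.
    by rewrite -!mulr_suml -mulr_sumr -natr_sum.
  apply: prod_pull => k.
  have em b : cexp (dl - b) * z k = cexp (c k - b) by have [] := row_monomials k y b.
  have ep b : a * q * z k / cexp (dl - b) = cexp (c k + b).
    by have [] := row_monomials k y b.
  rewrite (em b4) (em b5) (em b6) (ep b1) (ep b2) (ep b3).
  rewrite (@epochs_ratio [:: c k - b4; c k - b5; c k - b6]
    [:: c k + b1; c k + b2; c k + b3] _ _ _ erefl erefl erefl).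
  rewrite !big_cons !big_nil !mulr1; congr (cexp _ * (_ / _)); rewrite ?mulrA //.
  transitivity (- ((y k)%:R * (b1 + b2 + b3 + b4 + b5 + b6)) / 2); first by field.
  by rewrite h; field.
have -> : \prod_(j < n) \prod_(k < n)
     (epoch p q (q ^- m j * z k / z j) (y k) / epoch p q (q * z k / z j) (y k))
  = cexp (- ((N + n)%:R * r%:R * eta) / 2) * \prod_(j < n) \prod_(k < n)
       (spoch (c k - c j - (m j)%:R * eta) (y k) / spoch (c k - c j + eta) (y k)).
  have -> : - ((N + n)%:R * r%:R * eta) / 2
     = \sum_(j < n) - ((m j + 1)%:R * r%:R * eta) / 2.
    rewrite -mulr_suml sumrN -!mulr_suml -natr_sum big_split /=.
    by rewrite sum1_card card_ord.
  apply: prod_pull => j.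
  have -> : - ((m j + 1)%:R * r%:R * eta) / 2
     = \sum_(k < n) - ((m j + 1)%:R * (y k)%:R * eta) / 2.
    by rewrite -mulr_suml sumrN -!mulr_suml -mulr_sumr -natr_sum.
  apply: prod_pull => k; have [_ _ _ e1 e2] := box_monomials j k y.
  rewrite e1 e2 (epoch_ratio (y k) erefl erefl); congr (cexp _ * _).
  by rewrite natrD; field.
apply: regroup_rhs; rewrite /q -cexpMn -!eD -[RHS]cexp0; congr cexp.
by rewrite natrD; field.
Qed.

Lemma epoch_exp u k : epoch p q (cexp u) k = cexp (pexp eta u k%:R) * spoch u k.
Proof. exact: epoch_br. Qed.

Lemma rhs_prefactor_br :
  rhs_prefactor p q m a lam (cexp (dl - b4)) (cexp (dl - b5)) (cexp (dl - b6)) z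
  = prefactor s eta m c b1 b2 b3 b4 b5 b6.
Proof.
rewrite /rhs_prefactor /prefactor -/N -/B.
have ecc j k : a * q * z j * z k = cexp (c j + c k).
  by rewrite /a /q /z /c -!eD; congr cexp; ring.
have -> : \prod_(j < n) \prod_(k < n) epoch p q (a * q * z j * z k) (m k)
  = cexp (\sum_(j < n) \sum_(k < n) pexp eta (c j + c k) (m k)%:R)
    * \prod_(j < n) \prod_(k < n) spoch (c j + c k) (m k).
  by apply: prod_pull => j; apply: prod_pull => k; rewrite ecc epoch_exp.
have -> : \prod_(j < n) \prod_(k < n | (j < k)%N) epoch p q (a * q * z j * z k) (m j + m k)
  = cexp (\sum_(j < n) \sum_(k < n | (j < k)%N) pexp eta (c j + c k) ((m j)%:R + (m k)%:R))
    * \prod_(j < n) \prod_(k < n | (j < k)%N) spoch (c j + c k) (m j + m k).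
  rewrite -prod_cexp2 -prod_split2; apply: eq_bigr => j _; apply: eq_bigr => k _.
  by rewrite ecc epoch_exp natrD.
have -> : epochs p q [:: lam * q / cexp (dl - b4); lam * q / cexp (dl - b5);
      a * q / (cexp (dl - b4) * cexp (dl - b5))] N
  = cexp (pexp eta (B + b4) N%:R + pexp eta (B + b5) N%:R + pexp eta (b4 + b5) N%:R)
    * (spoch (B + b4) N * spoch (B + b5) N * spoch (b4 + b5) N).
  have e2 b : lam * q / cexp (dl - b) = cexp (B + b).
    by rewrite /lam /q -eN -!eD; congr cexp; ring.
  have e3 : a * q / (cexp (dl - b4) * cexp (dl - b5)) = cexp (b4 + b5).
    by rewrite /a /q -!eD -eN -!eD; congr cexp; ring.
  rewrite (e2 b4) (e2 b5) e3 /epochs !big_cons big_nil mulr1 !epoch_exp !eD.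
  exact: regroup3.
have -> : \prod_(k < n) epochs p q [:: lam * q * z k; a * q * z k / cexp (dl - b4);
      a * q * z k / cexp (dl - b5); q ^- m k * cexp (dl - b6) / (a * z k)] (m k)
  = cexp (\sum_(k < n) (pexp eta (c k + B) (m k)%:R + pexp eta (c k + b4) (m k)%:R
      + pexp eta (c k + b5) (m k)%:R
      + pexp eta (eta - (m k)%:R * eta - (c k + b6)) (m k)%:R))
    * \prod_(k < n) (spoch (c k + B) (m k) * spoch (c k + b4) (m k) * spoch (c k + b5) (m k)
          * spoch (eta - (m k)%:R * eta - (c k + b6)) (m k)).
  apply: prod_pull => k.
  have -> : lam * q * z k = cexp (c k + B).
    by rewrite /lam /q /z /c -!eD; congr cexp; ring.
  have ep b : a * q * z k / cexp (dl - b) = cexp (c k + b).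
    by have [] := row_monomials k m b.
  have -> : q ^- m k * cexp (dl - b6) / (a * z k) = cexp (eta - (m k)%:R * eta - (c k + b6)).
    rewrite /a /q /z /c -eMn -!eD -!eN -!eD; congr cexp; ring.
  rewrite (ep b4) (ep b5) /epochs !big_cons big_nil mulr1 !epoch_exp !eD.
  exact: regroup4.
apply: regroup_prefactor; do ?exact: cexp_neq0.
rewrite -!eD; congr cexp; rewrite /N natr_sum.
by apply: prefactor_exponent; rewrite -natr_sum.
Qed.

Hypothesis r1 : ComplexField.Normc.normc p < 1.

Lemma log_form :
  (forall j k i, (1 <= i <= m k)%N -> s (c k - c j + i%:R * eta) != 0) ->
  (forall j k, j != k -> s (c k - c j) != 0) ->
  (forall j k, generic s eta (c j + c k)) ->
  (forall k x, x \in [:: b1; b2; b3; b4; b5; b6] -> generic s eta (c k + x)) ->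
  (forall k, generic s eta (c k + B)) ->
  (forall x, x \in [:: b4; b5; b6] -> generic s eta (B + x)) ->
  (forall j k, generic s eta (c j + c k - (b1 + b2))) ->
  (forall j k, generic s eta (c j - c k - (b1 + b2))) ->
  (forall j k, generic s eta (c j + c k - (b4 + b5))) ->
  \sum_(y : box m) lhs_summand p q m a (cexp (dl - b1)) (cexp (dl - b2)) (cexp (dl - b3))
    (cexp (dl - b4)) (cexp (dl - b5)) (cexp (dl - b6)) z (fun k => y k)
  = rhs_prefactor p q m a lam (cexp (dl - b4)) (cexp (dl - b5)) (cexp (dl - b6)) z
  * \sum_(y : box m) rhs_summand p q m a (cexp (dl - b1)) (cexp (dl - b2)) (cexp (dl - b3))
      (cexp (dl - b4)) (cexp (dl - b5)) (cexp (dl - b6)) lam z (fun k => y k).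
Proof.
move=> nzd nzd0 gcc gb gB gBb g12 g12' g45; rewrite rhs_prefactor_br.
under eq_bigr do rewrite lhs_summand_br.
under [in RHS]eq_bigr do rewrite rhs_summand_br.
exact: (corollary_s (brN r1) (br_plucker r1) nzd nzd0 bal gcc gb gB gBb g12 g12' g45).
Qed.
End Conversion.

Section GenericParameters.
Variables (R : realType) (p q : R[i]) (n : nat) (m : 'I_n -> nat).
Local Notation C := (R[i]).
Hypothesis r1 : ComplexField.Normc.normc p < 1.
Hypothesis q0 : q != 0.

Definition theta_generic x := forall i : int, theta p (x * q ^ i) != 0.

Lemma generic_br eta u x : q = cexp eta -> x = cexp u -> theta_generic x ->
  generic (br p) eta u.
Proof. by move=> qe -> g i; rewrite br_eq0 cexpD cexpMz -qe. Qed.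

Lemma generic_corollary (a b c d e f g lam : C) (z : 'I_n -> C) :
  a != 0 -> b != 0 -> c != 0 -> d != 0 -> e != 0 -> f != 0 -> g != 0 ->
  (forall k, z k != 0) ->
  a ^+ 3 * q ^+ (2 + wt m) = b * c * d * e * f * g ->
  lam = a ^+ 2 * q / (b * c * d) ->
  (forall j k i, (1 <= i <= m k)%N -> theta p (z k / z j * q ^+ i) != 0) ->
  (forall j k, j != k -> theta p (z k / z j) != 0) ->
  (forall j k, theta_generic (a * q * z j * z k)) ->
  (forall k x, x \in [:: b; c; d; e; f; g] -> theta_generic (a * q * z k / x)) ->
  (forall k, theta_generic (lam * q * z k)) ->
  (forall x, x \in [:: e; f; g] -> theta_generic (lam * q / x)) ->
  (forall j k, theta_generic (b * c * z j * z k)) ->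
  (forall j k, theta_generic (b * c * z j / (a * q * z k))) ->
  (forall j k, theta_generic (e * f * z j * z k)) ->
  \sum_(y : box m) lhs_summand p q m a b c d e f g z (fun k => y k)
  = rhs_prefactor p q m a lam e f g z
  * \sum_(y : box m) rhs_summand p q m a b c d e f g lam z (fun k => y k).
Proof.
move=> a0 b0 c0 d0 e0 f0 g0 z0 bal lamE nzd nzd0 gcc gb gB gBb g12 g12' g45.
have [eta qE] := cexp_surj q0; have [al aE] := cexp_surj a0.
have [/= zeta zE] := boolp.choice (fun k => cexp_surj (z0 k)).
pose dl := (al + eta) / 2.
have lg x : x != 0 -> exists u, x = cexp (dl - u).
  by move=> /cexp_surj[u <-]; exists (dl - u); rewrite subKr.
have [b1 b1E] := lg b b0; have [b2 b2E] := lg c c0; have [b3 b3E] := lg d d0.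
have [b4 b4E] := lg e e0; have [b5 b5E] := lg f f0.
pose B := b1 + b2 + b3; pose N := (\sum_(k < n) m k)%N.
(* Logarithms are not unique, so a logarithm of [g] chosen freely could violate the additive
   balancing condition. [b6] is defined by that condition, and the multiplicative one then shows
   that it belongs to [g]. *)
pose b6 := eta - N%:R * eta - B - b4 - b5.
have zE' : z = fun k => cexp (zeta k) by apply/funext => k; rewrite zE.
have aE' : a = cexp (2 * dl - eta) by rewrite -aE /dl; congr cexp; field.
have b6E : g = cexp (dl - b6).
  apply: (mulfI (mulf_neq0 (mulf_neq0 (mulf_neq0 (mulf_neq0 b0 c0) d0) e0) f0)).
  rewrite -bal b1E b2E b3E b4E b5E -aE -qE -!cexpMn -!cexpD; congr cexp.
  by rewrite /b6 /B /dl natrD -/N; field.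
have lE : lam = cexp (dl + B - eta).
  rewrite lamE b1E b2E b3E aE' -qE -!cexpMn -!cexpD -cexpN -!cexpD; congr cexp.
  by rewrite /B; ring.
have balE : B + b4 + b5 + b6 + N%:R * eta = eta by rewrite /b6; ring.
have gE := fun u x => generic_br (u := u) (x := x) (esym qE).
rewrite lE aE' b1E b2E b3E b4E b5E b6E zE' -qE.
apply: log_form => //.
- move=> j k i hi; rewrite br_eq0.
  suff -> : cexp (zeta k + dl - (zeta j + dl) + i%:R * eta) = z k / z j * q ^+ i by exact: nzd.
  by rewrite zE' -qE -cexpMn -cexpB -cexpD; congr cexp; ring.
- move=> j k hjk; rewrite br_eq0.
  suff -> : cexp (zeta k + dl - (zeta j + dl)) = z k / z j by exact: nzd0.
  by rewrite zE' -cexpB; congr cexp; ring.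
- move=> j k; apply: gE (gcc j k); rewrite aE' -qE zE' -!cexpD; congr cexp; ring.
- move=> k x hx.
  have : cexp (dl - x) \in [:: b; c; d; e; f; g].
    move: hx; rewrite b1E b2E b3E b4E b5E b6E !inE.
    by do 5![case/orP => [/eqP->|]; first by rewrite eqxx ?orbT]; move/eqP->; rewrite eqxx !orbT.
  move/(gb k); apply: gE.
  by rewrite aE' -qE zE' -!cexpD -cexpN -!cexpD; congr cexp; ring.
- move=> k; apply: gE (gB k); rewrite lE -qE zE' -!cexpD; congr cexp; rewrite /B; ring.
- move=> x hx.
  have : cexp (dl - x) \in [:: e; f; g].
    move: hx; rewrite b4E b5E b6E !inE.
    by do 2![case/orP => [/eqP->|]; first by rewrite eqxx ?orbT]; move/eqP->; rewrite eqxx !orbT.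
  move/gBb; apply: gE.
  by rewrite lE -qE -!cexpD -cexpN -!cexpD; congr cexp; rewrite /B; ring.
- move=> j k; apply: gE (g12 j k); rewrite b1E b2E zE' -!cexpD; congr cexp; ring.
- move=> j k; apply: gE (g12' j k); rewrite b1E b2E aE' -qE zE' -!cexpD -cexpN -!cexpD; congr cexp; ring.
- move=> j k; apply: gE (g45 j k); rewrite b4E b5E zE' -!cexpD; congr cexp; ring.
Qed.
End GenericParameters.

(** * Removal of the genericity assumptions *)

Section GoodPerturbation.
Variables (R : realType) (p q : R[i]).
Local Notation C := (R[i]).
Local Notation normc := (@ComplexField.Normc.normc R).
Hypothesis r1 : normc p < 1.
Hypothesis q0 : q != 0.

Lemma normc_real (t : R) : 0 <= t -> normc t%:C = t.
Proof. by move=> t0; rewrite /= expr0n /= addr0 sqrtr_sqr ger0_norm. Qed.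

Lemma countable_power (k : int) (v : R) : k != 0 ->
  countable [set t : R | 0 < t /\ t ^ k = v].
Proof.
move=> k0; apply: finite_set_countable.
apply: (@sub_finite_set _ _ [set expR (ln v / k%:~R)]); last exact: finite_set1.
move=> t [t0 <-] /=.
rewrite -[t in LHS](lnK t0); congr expR.
have -> : ln (t ^ k) = k%:~R * ln t.
  case: k k0 => k k0; first by rewrite -exprnP lnXn // mulr_natl.
  by rewrite NegzE -exprnN lnV ?posrE ?exprn_gt0 // lnXn // mulrNz mulNr -mulr_natl.
by rewrite mulrAC mulfV ?mul1r ?intr_eq0.
Qed.

(** A zero of theta at x t^k q^i prescribes the modulus of t^k up to a power of |p|; for each power
    and each i at most one positive t remains, as k is nonzero. *)
Lemma countable_not_generic (w : C * int) : w.1 != 0 -> w.2 != 0 ->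
  countable [set t : R | 0 < t /\ ~ theta_generic p q (w.1 * t%:C ^ w.2)].
Proof.
case: w => x k /= x0 k0.
pose S (u : nat * int * bool) : set R :=
  [set t | 0 < t /\ t ^ k = (if u.2 then normc p ^+ u.1.1 else (normc p ^+ u.1.1)^-1)
      / (normc x * normc q ^ u.1.2)].
apply: (@sub_countable _ _ _ (\bigcup_(u in [set: nat * int * bool]) S u)); last first.
  by apply: bigcup_countable => // u _; exact: countable_power.
apply: subset_card_le => t [t0 /existsNP[i /negP]]; rewrite negbK => /eqP th.
have qi0 : q ^ i != 0 by rewrite expfz_neq0.
have tk0 : t%:C ^ k != 0 by rewrite expfz_neq0 // eq_complex /= eqxx andbT gt_eqF.
have := theta_eq0 r1 (mulf_neq0 (mulf_neq0 x0 tk0) qi0) th.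
have nx : normc x != 0 by rewrite normc_eq0.
have nq : normc q ^ i != 0 by rewrite expfz_neq0 // normc_eq0.
rewrite !normcM !normcXz normc_real ?ltW // => -[j [h|h]].
  exists (j, i, false) => //=; split=> //=.
  have pj : normc p ^+ j != 0.
    by apply: contra_eq_neq h => ->; rewrite mul0r eq_sym oner_neq0.
  move: h nq pj nx; move: (t ^ k) (normc q ^ i) (normc p ^+ j) (normc x) => s Q P X h nq pj nx.
  by transitivity (P * (X * s * Q) / (P * X * Q)); [|rewrite h]; field; rewrite nx nq pj.
exists (j, i, true) => //=; split=> //=.
rewrite -h; move: (t ^ k) (normc q ^ i) nq => s Q nq.
by field; rewrite nx nq.
Qed.

(** A countable set has Lebesgue measure zero and cannot cover the interval from 1 to 1 + e. *)
Lemma exists_generic (X : seq (C * int)) (e : R) : 0 < e ->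
  (forall w, w \in X -> w.1 != 0 /\ w.2 != 0) ->
  exists t : R, [/\ 1 < t, t < 1 + e
    & forall w, w \in X -> theta_generic p q (w.1 * t%:C ^ w.2)].
Proof.
move=> e0 X0; apply: contrapT => /forallNP H.
pose Bad := \bigcup_(w in [set` X]) [set t : R | 0 < t /\ ~ theta_generic p q (w.1 * t%:C ^ w.2)].
have cB : countable Bad.
  apply: bigcup_countable => [|w /= wX]; first exact/finite_set_countable/finite_seq.
  by have [w1 w2] := X0 w wX; exact: countable_not_generic.
have sub : `]1, 1 + e[%classic `<=` Bad.
  move=> t /=; rewrite in_itv /= => /andP[t1 t2].
  apply: contrapT => nB; apply: (H t); split=> // w wX.
  apply: contrapT => ng; apply: nB; exists w => //; split=> //.
  by rewrite (lt_trans _ t1).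
have := countable_lebesgue_measure0 (sub_countable (subset_card_le sub) cB).
rewrite lebesgue_measure_itv /= lte_fin ltrDl e0 => /eqP.
by rewrite -EFinB eqe addrAC subrr add0r gt_eqF.
Qed.
End GoodPerturbation.

(** * Continuity in the parameters *)

Section Continuity.
Variables (R : realType) (p q : R[i]).
Local Notation C := (R[i]).
Local Notation normc := (@ComplexField.Normc.normc R).
Hypothesis r1 : normc p < 1.
Hypothesis q0 : q != 0.

(* An inductive wrapper, so that applying the closure lemmas below does not
   unfold the inclusion of filters. *)
Variant tends (f : nat -> C) (l : C) : Prop := Tends of (f : nat -> C^o) @ \oo --> (l : C^o).

Lemma tends_cst l : tends (fun _ => l) l.
Proof. by split; exact: cvgC_cst. Qed.

Lemma tends_mul f g k l : tends f k -> tends g l -> tends (fun t => f t * g t) (k * l).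
Proof. by move=> [fk] [gl]; split; exact: cvgC_M. Qed.

Lemma tends_inv f l : l != 0 -> tends f l -> tends (fun t => (f t)^-1) l^-1.
Proof. by move=> l0 [fl]; split; exact: cvgC_V. Qed.

Lemma tends_div f g k l : l != 0 -> tends f k -> tends g l ->
  tends (fun t => f t / g t) (k / l).
Proof. by move=> l0 fk gl; exact: (tends_mul fk (tends_inv l0 gl)). Qed.

Lemma tends_add f g k l : tends f k -> tends g l -> tends (fun t => f t + g t) (k + l).
Proof. by move=> [fk] [gl]; split; exact: cvgC_D. Qed.

Lemma tends_sum (I : Type) (r : seq I) (Q : pred I) (f : I -> nat -> C) (l : I -> C) :
  (forall i, Q i -> tends (f i) (l i)) ->
  tends (fun t => \sum_(i <- r | Q i) f i t) (\sum_(i <- r | Q i) l i).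
Proof.
move=> h; elim: r => [|i r IH].
  by under eq_fun do rewrite big_nil; rewrite big_nil; exact: tends_cst.
under eq_fun do rewrite big_cons; rewrite big_cons.
case: ifP => [Qi|_]; [exact: (tends_add (h i Qi) IH)|exact: IH].
Qed.

Lemma tends_prod (I : Type) (r : seq I) (Q : pred I) (f : I -> nat -> C) (l : I -> C) :
  (forall i, Q i -> tends (f i) (l i)) ->
  tends (fun t => \prod_(i <- r | Q i) f i t) (\prod_(i <- r | Q i) l i).
Proof.
move=> h; elim: r => [|i r IH].
  by under eq_fun do rewrite big_nil; rewrite big_nil; exact: tends_cst.
under eq_fun do rewrite big_cons; rewrite big_cons.
case: ifP => [Qi|_]; [exact: (tends_mul (h i Qi) IH)|exact: IH].
Qed.

Lemma tends_theta f l : l != 0 -> tends f l -> tends (fun t => theta p (f t)) (theta p l).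
Proof. by move=> l0 [fl]; split; exact: theta_cont. Qed.

Lemma tends_epoch f l k : l != 0 -> tends f l ->
  tends (fun t => epoch p q (f t) k) (epoch p q l k).
Proof.
move=> l0 fl; apply: tends_prod => i _; apply: tends_theta.
  by rewrite mulf_neq0 // expf_neq0.
exact: (tends_mul fl (tends_cst _)).
Qed.

Lemma tends_epochs_nil k : tends (fun=> epochs p q [::] k) (epochs p q [::] k).
Proof. exact: tends_cst. Qed.

Lemma tends_epochs f l s ls k : l != 0 -> tends f l ->
  tends (fun t => epochs p q (s t) k) (epochs p q ls k) ->
  tends (fun t => epochs p q (f t :: s t) k) (epochs p q (l :: ls) k).
Proof.
move=> l0 fl sl; rewrite /epochs; under eq_fun do rewrite big_cons; rewrite big_cons.
exact: (tends_mul (tends_epoch k l0 fl) sl).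
Qed.
End Continuity.

(** Follows the syntax of the expression; what remains is the nonvanishing of the limits of
    denominators and of theta arguments. *)
Ltac tends_tac :=
  lazymatch goal with
  | |- tends (fun _ => ?x) _ => exact: tends_cst
  | |- tends (fun _ => \prod_(_ <- _ | _) _) _ =>
      apply: tends_prod => ? ?; tends_tac
  | |- tends (fun _ => theta _ _) _ => apply: tends_theta; [assumption| |tends_tac]
  | |- tends (fun _ => epoch _ _ _ _) _ => apply: tends_epoch; [assumption|assumption| |tends_tac]
  | |- tends (fun _ => epochs _ _ [::] _) _ => exact: tends_epochs_nil
  | |- tends (fun _ => epochs _ _ (_ :: _) _) _ =>
      apply: tends_epochs; [assumption|assumption| |tends_tac|tends_tac]
  | |- tends (fun _ => _ / _) _ => apply: tends_div; [|tends_tac|tends_tac]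
  | |- tends (fun _ => _ * _) _ => apply: tends_mul; tends_tac
  | |- _ => try eassumption
  end.

Ltac nonzero_tac :=
  lazymatch goal with
  | |- is_true (_ * _ != 0) => apply: mulf_neq0; nonzero_tac
  | |- is_true (_^-1 != 0) => rewrite invr_eq0; nonzero_tac
  | |- is_true (_ ^+ _ != 0) => apply: expf_neq0; nonzero_tac
  | |- _ => auto
  end.

Section SummandContinuity.
Variables (R : realType) (p q : R[i]) (n : nat) (m : 'I_n -> nat).
Local Notation C := (R[i]).
Hypothesis r1 : ComplexField.Normc.normc p < 1.
Hypothesis q0 : q != 0.
Variables (a_ b_ e_ g_ lam_ : nat -> C) (a b c d e f g lam : C) (z : 'I_n -> C).
Hypotheses (a_a : tends a_ a) (b_b : tends b_ b) (e_e : tends e_ e) (g_g : tends g_ g)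
  (lam_lam : tends lam_ lam).
Hypotheses (a0 : a != 0) (b0 : b != 0) (c0 : c != 0) (d0 : d != 0) (e0 : e != 0)
  (f0 : f != 0) (g0 : g != 0) (lam0 : lam != 0) (z0 : forall k, z k != 0).

Lemma tends_lhs y :
  (forall j k : 'I_n, (j <= k)%N -> theta p (a * z j * z k) != 0) ->
  (forall j k : 'I_n,
     epochs p q [:: q * z k / z j; a * q ^+ (1 + m j) * z j * z k] (y k) != 0) ->
  (forall k : 'I_n,
     epochs p q [:: a * q * z k / b; a * q * z k / c; a * q * z k / d;
          a * q * z k / e; a * q * z k / f; a * q * z k / g] (y k) != 0) ->
  tends (fun t => lhs_summand p q m (a_ t) (b_ t) c d (e_ t) f (g_ t) z y)
    (lhs_summand p q m a b c d e f g z y).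
Proof.
move=> nzA nzM nzB; rewrite /lhs_summand.
tends_tac; nonzero_tac.
Qed.

Lemma tends_rhs y :
  (forall k : 'I_n, theta p (lam * z k) != 0) ->
  epochs p q [:: lam * q / e; lam * q / f; lam * q / g] (wt y) != 0 ->
  (forall j : 'I_n, epoch p q (lam * q ^+ (1 + m j) * z j) (wt y) != 0) ->
  (forall k : 'I_n,
     epochs p q [:: a * q * z k / b; a * q * z k / c; a * q * z k / d] (y k) != 0) ->
  (forall j k : 'I_n, epoch p q (q * z k / z j) (y k) != 0) ->
  tends (fun t => rhs_summand p q m (a_ t) (b_ t) c d (e_ t) f (g_ t) (lam_ t) z y)
    (rhs_summand p q m a b c d e f g lam z y).
Proof.
by move=> nzL nzE nzF nzB nzM; rewrite /rhs_summand; tends_tac; nonzero_tac.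
Qed.

Lemma tends_prefactor :
  (forall j k : 'I_n, (j < k)%N -> epoch p q (a * q * z j * z k) (m j + m k) != 0) ->
  (forall k : 'I_n,
     epochs p q [:: lam * q * z k; a * q * z k / e; a * q * z k / f;
          q ^- m k * g / (a * z k)] (m k) != 0) ->
  tends (fun t => rhs_prefactor p q m (a_ t) (lam_ t) (e_ t) f (g_ t) z)
    (rhs_prefactor p q m a lam e f g z).
Proof.
move=> nzP nzQ; rewrite /rhs_prefactor; tends_tac; nonzero_tac.
- by apply/prodf_neq0 => j _; apply/prodf_neq0 => k; exact: nzP.
- by apply/prodf_neq0 => k _; exact: nzQ.
Qed.
End SummandContinuity.

Lemma epochs_cons_neq0 (R : realType) (p q : R[i]) x s k :
  epochs p q (x :: s) k != 0 -> epoch p q x k != 0 /\ epochs p q s k != 0.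
Proof. by rewrite /epochs big_cons mulf_eq0 negb_or => /andP. Qed.

Lemma epoch_factor_neq0 (R : realType) (p q : R[i]) x k i : (i < k)%N ->
  epoch p q x k != 0 -> theta p (x * q ^+ i) != 0.
Proof. by move=> ik /prodf_neq0 /(_ (Ordinal ik) isT). Qed.

Lemma vandermonde_neq0 (R : realType) (p : R[i]) n (z : 'I_n -> R[i]) :
  ComplexField.Normc.normc p < 1 -> (forall k, z k != 0) -> vandermonde p z != 0 ->
  forall j k, j != k -> theta p (z k / z j) != 0.
Proof.
move=> r1 z0 zV.
have lt (j k : 'I_n) : (j < k)%N -> theta p (z k / z j) != 0.
  move=> jk; have /prodf_neq0 /(_ j isT) /prodf_neq0 /(_ k jk) := zV.
  by rewrite mulf_eq0 negb_or => /andP[].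
move=> j k; rewrite neq_ltn => /orP[|kj]; first exact: lt.
have zz : z j / z k != 0 by rewrite mulf_neq0 ?invr_eq0.
rewrite -invf_div (thetaV r1 zz) mulf_neq0 ?lt //.
by rewrite oppr_eq0 invr_eq0.
Qed.

Lemma tends_unique (R : realType) (f : nat -> R[i]) k l : tends f k -> tends f l -> k = l.
Proof. by move=> [fk] [fl]; exact: cvgC_unique fk fl. Qed.

Lemma tends_real1 (R : realType) (t : nat -> R) :
  (forall n, 1 < t n /\ t n < 1 + n.+1%:R^-1) -> tends (fun n => (t n)%:C) 1.
Proof.
move=> ht; split; apply/cvgC_normc.
have -> : (fun n => ComplexField.Normc.normc (1 - (t n)%:C)) = (fun n => t n - 1).
  apply/funext => n; have [t1 _] := ht n.
  by rewrite -normcN opprB -rmorphB normc_real // subr_ge0 ltW.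
apply: (@squeeze_cvgr _ _ _ _ (fun=> 0) (fun n => n.+1%:R^-1)).
- near=> n; have [t1 t2] := ht n; rewrite subr_ge0 ltW //= lerBlDl; exact: ltW.
- exact: cvg_cst.
- exact: cvg_harmonic.
Unshelve. all: by end_near. Qed.

Section Perturbation.
Variables (K : fieldType) (T : K).
Hypothesis T0 : T != 0.

Lemma perturbed_balancing (a b c d e f g Q : K) : a ^+ 3 * Q = b * c * d * e * f * g ->
  (a * T) ^+ 3 * Q = b * T ^+ 3 * c * d * (e * T ^+ 3) * f * (g / T ^+ 3).
Proof.
move=> h; transitivity (a ^+ 3 * Q * T ^+ 3); first by ring.
by rewrite h; field.
Qed.

Lemma perturbed_lambda (a b c d q : K) : b != 0 -> c != 0 -> d != 0 ->
  a ^+ 2 * q / (b * c * d) / T = (a * T) ^+ 2 * q / (b * T ^+ 3 * c * d).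
Proof. by move=> b0 c0 d0; field; rewrite b0 c0 d0 T0. Qed.
End Perturbation.

Theorem corollary8p3 (R : realType) (p q : R[i]) (hp : `|p| < 1) (hq : q != 0)
  (n : nat) (hn : (1 <= n)%N) (m : 'I_n -> nat)
  (a b c d e f g : R[i]) (z : 'I_n -> R[i])
  (ha : a != 0) (hb : b != 0) (hc : c != 0) (hd : d != 0)
  (he : e != 0) (hf : f != 0) (hg : g != 0) (hz : forall k, z k != 0)
  (balancing : a ^+ 3 * q ^+ (2 + wt m) = b * c * d * e * f * g)
  (lam : R[i]) (hlam : lam = a ^+ 2 * q / (b * c * d))
  (* no denominator vanishes *)
  (nzV : vandermonde p z != 0)
  (nzA : forall j k : 'I_n, (j <= k)%N -> theta p (a * z j * z k) != 0)
  (nzM : forall (y : box m) (j k : 'I_n),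
     epochs p q [:: q * z k / z j; a * q ^+ (1 + m j) * z j * z k] (y k) != 0)
  (nzB : forall (y : box m) (k : 'I_n),
     epochs p q [:: a * q * z k / b; a * q * z k / c; a * q * z k / d;
                    a * q * z k / e; a * q * z k / f; a * q * z k / g] (y k)
       != 0)
  (nzP : forall j k : 'I_n, (j < k)%N ->
     epoch p q (a * q * z j * z k) (m j + m k) != 0)
  (nzQ : forall k : 'I_n,
     epochs p q [:: lam * q * z k; a * q * z k / e; a * q * z k / f;
                    q ^- m k * g / (a * z k)] (m k) != 0)
  (nzL : forall k : 'I_n, theta p (lam * z k) != 0)
  (nzE : forall y : box m,
     epochs p q [:: lam * q / e; lam * q / f; lam * q / g] (wt y) != 0)
  (nzF : forall (y : box m) (j : 'I_n),
     epoch p q (lam * q ^+ (1 + m j) * z j) (wt y) != 0) :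
  \sum_(y : box m)
    (vandermonde p (fun k => z k * q ^+ y k) / vandermonde p z
     * (\prod_(j < n) \prod_(k < n | (j <= k)%N)
          (theta p (a * z j * z k * q ^+ (y j + y k)) / theta p (a * z j * z k)))
     * (\prod_(j < n) \prod_(k < n)
          (epochs p q [:: q ^- m j * z k / z j; a * z j * z k] (y k)
           / epochs p q [:: q * z k / z j; a * q ^+ (1 + m j) * z j * z k]
               (y k)))
     * (\prod_(k < n)
          (epochs p q [:: b * z k; c * z k; d * z k; e * z k; f * z k; g * z k]
             (y k)
           / epochs p q [:: a * q * z k / b; a * q * z k / c; a * q * z k / d;
                            a * q * z k / e; a * q * z k / f; a * q * z k / g]
               (y k)))
     * q ^+ wt y)
  =
  (\prod_(j < n) \prod_(k < n) epoch p q (a * q * z j * z k) (m k))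
  / (\prod_(j < n) \prod_(k < n | (j < k)%N)
       epoch p q (a * q * z j * z k) (m j + m k))
  * (epochs p q [:: lam * q / e; lam * q / f; a * q / (e * f)] (wt m)
     / \prod_(k < n)
         epochs p q [:: lam * q * z k; a * q * z k / e; a * q * z k / f;
                        q ^- m k * g / (a * z k)] (m k))
  * \sum_(y : box m)
      (vandermonde p (fun k => z k * q ^+ y k) / vandermonde p z
       * (\prod_(k < n)
            (theta p (lam * z k * q ^+ (y k + wt y)) / theta p (lam * z k)))
       * (epochs p q [:: lam * b / a; lam * c / a; lam * d / a] (wt y)
          / epochs p q [:: lam * q / e; lam * q / f; lam * q / g] (wt y))
       * (\prod_(j < n)
            (epoch p q (lam * z j) (wt y)
             / epoch p q (lam * q ^+ (1 + m j) * z j) (wt y)))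
       * q ^+ wt y
       * (\prod_(k < n)
            (epochs p q [:: e * z k; f * z k; g * z k] (y k)
             / epochs p q [:: a * q * z k / b; a * q * z k / c;
                              a * q * z k / d] (y k)))
       * (\prod_(j < n) \prod_(k < n)
            (epoch p q (q ^- m j * z k / z j) (y k)
             / epoch p q (q * z k / z j) (y k)))).

Proof.
have r1 : ComplexField.Normc.normc p < 1 by move: hp; rewrite normrE ltcR.
have lam0 : lam != 0 by rewrite hlam; nonzero_tac.
(* At y = m the denominator contains all factors of the shorter symbols. *)
have nzqz j k : epoch p q (q * z k / z j) (m k) != 0.
  by have := nzM (finfun (fun k => ord_max)) j k; rewrite ffunE => /epochs_cons_neq0[].
(* The expressions which have to be generic, with their degree in the
   perturbation parameter; what matters is that no degree is zero. *)
pose G (j k : 'I_n) : seq (R[i] * int) :=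
  [:: (a * q * z j * z k, 1); (a * q * z k / b, - 2%:Z); (a * q * z k / c, 1);
      (a * q * z k / d, 1); (a * q * z k / e, - 2%:Z); (a * q * z k / f, 1);
      (a * q * z k / g, 4%:Z); (lam * q * z k, - 1); (lam * q / e, - 4%:Z);
      (lam * q / f, - 1); (lam * q / g, 2%:Z); (b * c * z j * z k, 3%:Z);
      (b * c * z j / (a * q * z k), 2%:Z); (e * f * z j * z k, 3%:Z)].
pose X := flatten [seq G u.1 u.2 | u <- enum {: 'I_n * 'I_n}].
have GX j k w : w \in G j k -> w \in X.
  by move=> wG; apply/flattenP; exists (G j k) => //; apply/mapP; exists (j, k); rewrite ?mem_enum.
have X0 w : w \in X -> w.1 != 0 /\ w.2 != 0.
  move=> /flattenP[s /mapP[[j k] _ ->]].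
  have H : all (fun w => (w.1 != 0) && (w.2 != 0)) (G j k).
    by rewrite /= !andbT !mulf_neq0 ?invr_eq0 ?mulf_neq0.
  by move=> /(allP H) /andP.
(* The interval shrinks to 1 as [N] grows, so the perturbed parameters tend to the given ones. *)
have /boolp.choice[t ht] (N : nat) : exists t : R, [/\ 1 < t, t < 1 + N.+1%:R^-1
    & forall w, w \in X -> theta_generic p q (w.1 * t%:C ^ w.2)].
  by apply: (exists_generic r1 hq) => //; rewrite invr_gt0.
pose T N := (t N)%:C.
have T0 N : T N != 0.
  have [t1 _ _] := ht N.
  by rewrite eq_complex /= eqxx andbT gt_eqF // (lt_trans _ t1).
have T1 : tends T 1 by apply: tends_real1 => N; have [] := ht N.
have T3 : tends (fun N => T N ^+ 3) 1.
  have := tends_mul T1 (tends_mul T1 T1); rewrite !mulr1.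
  by under eq_fun do rewrite -expr2 -exprS.
have one0 : (1 : R[i]) != 0 by exact: oner_neq0.
have aT : tends (fun N => a * T N) a.
  by have := tends_mul (tends_cst a) T1; rewrite mulr1.
have bT : tends (fun N => b * T N ^+ 3) b.
  by have := tends_mul (tends_cst b) T3; rewrite mulr1.
have eT : tends (fun N => e * T N ^+ 3) e.
  by have := tends_mul (tends_cst e) T3; rewrite mulr1.
have gT : tends (fun N => g / T N ^+ 3) g.
  by have := tends_div one0 (tends_cst g) T3; rewrite divr1.
have lT : tends (fun N => lam / T N) lam.
  by have := tends_div one0 (tends_cst lam) T1; rewrite divr1.
have E N : \sum_(y : box m) lhs_summand p q m (a * T N) (b * T N ^+ 3) c d (e * T N ^+ 3) f
      (g / T N ^+ 3) z (fun k => y k)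
  = rhs_prefactor p q m (a * T N) (lam / T N) (e * T N ^+ 3) f (g / T N ^+ 3) z
    * \sum_(y : box m) rhs_summand p q m (a * T N) (b * T N ^+ 3) c d (e * T N ^+ 3) f
      (g / T N ^+ 3) (lam / T N) z (fun k => y k).
  have [_ _ gen] := ht N.
  have T30 : T N ^+ 3 != 0 by exact: expf_neq0.
  have gG j k i x : (i < 14)%N ->
      x = (nth (0, 0) (G j k) i).1 * T N ^ (nth (0, 0) (G j k) i).2 -> theta_generic p q x.
    by move=> i14 ->; apply/gen/(GX j k)/mem_nth.
  move: (T0 N) gG T30; move: (T N) => u u0 gG u30.
  apply: (generic_corollary r1 hq); try by nonzero_tac.
  - exact: perturbed_balancing.
  - by rewrite hlam perturbed_lambda.
  (* The quotients z_k / z_j are not perturbed; their conditions come from the denominators assumed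
     nonzero. *)
  - move=> j k [//|i] ik; have := epoch_factor_neq0 ik (nzqz j k).
    by congr (theta p _ != 0); rewrite exprS mulrCA !mulrA.
  - exact: vandermonde_neq0.
  - by move=> j k; apply: (gG j k 0) => //=; rewrite expr1z; ring.
  - move=> k x; rewrite !inE.
    case/orP => [/eqP->|]; first by apply: (gG k k 1) => //=; rewrite -exprnN; field; rewrite ?u0 ?hb.
    case/orP => [/eqP->|]; first by apply: (gG k k 2) => //=; rewrite expr1z; field; rewrite ?u0 ?hc.
    case/orP => [/eqP->|]; first by apply: (gG k k 3) => //=; rewrite expr1z; field; rewrite ?u0 ?hd.
    case/orP => [/eqP->|]; first by apply: (gG k k 4) => //=; rewrite -exprnN; field; rewrite ?u0 ?he.
    case/orP => [/eqP->|]; first by apply: (gG k k 5) => //=; rewrite expr1z; field; rewrite ?u0 ?hf.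
    by move/eqP->; apply: (gG k k 6) => //=; rewrite -exprnP; field; rewrite ?u0 ?hg.
  - by move=> k; apply: (gG k k 7) => //=; rewrite exprN1; ring.
  (* These expressions involve no index but are listed in [G j k], so some index is needed; [hn]
     provides one. *)
  - move=> x; rewrite !inE; pose k := Ordinal hn.
    case/orP => [/eqP->|]; first by apply: (gG k k 8) => //=; rewrite -exprnN; field; rewrite ?u0 ?he.
    case/orP => [/eqP->|]; first by apply: (gG k k 9) => //=; rewrite exprN1; field; rewrite ?u0 ?hf.
    by move/eqP->; apply: (gG k k 10) => //=; rewrite -exprnP; field; rewrite ?u0 ?hg.
  - by move=> j k; apply: (gG j k 11) => //=; rewrite -exprnP; ring.
  - by move=> j k; apply: (gG j k 12) => //=; rewrite -exprnP; field; rewrite ?u0 ha hq hz.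
  - by move=> j k; apply: (gG j k 13) => //=; rewrite -exprnP; ring.
have L : tends (fun N => \sum_(y : box m) lhs_summand p q m (a * T N) (b * T N ^+ 3) c d
      (e * T N ^+ 3) f (g / T N ^+ 3) z (fun k => y k))
    (\sum_(y : box m) lhs_summand p q m a b c d e f g z (fun k => y k)).
  by apply: tends_sum => y _; apply: (tends_lhs r1 hq aT bT eT gT) => //.
have RL : tends (fun N => rhs_prefactor p q m (a * T N) (lam / T N) (e * T N ^+ 3) f
       (g / T N ^+ 3) z
    * \sum_(y : box m) rhs_summand p q m (a * T N) (b * T N ^+ 3) c d (e * T N ^+ 3) f
      (g / T N ^+ 3) (lam / T N) z (fun k => y k))
    (rhs_prefactor p q m a lam e f g z
     * \sum_(y : box m) rhs_summand p q m a b c d e f g lam z (fun k => y k)).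
  apply: tends_mul; first exact: (tends_prefactor r1 hq aT eT gT lT).
  apply: tends_sum => y _; apply: (tends_rhs r1 hq aT bT eT gT lT) => //.
  (* The three symbols needed here are the first three of the six in [nzB]. *)
  - move=> k; have := nzB y k; rewrite /epochs !big_cons big_nil !mulrA !mulr1 => h.
    by apply: contra_neq h => ->; rewrite !mul0r.
  - by move=> j k; have [] := epochs_cons_neq0 (nzM y j k).
move: RL; under eq_fun do rewrite -E; exact: tends_unique L.
Qed.
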